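(* Let $\mathcal T,\mathcal X$ be complete separable metric spaces, $\mathcal X$ being equipped with a scaling and an origin $0$, and let $E=\mathcal T\times\mathcal X$, $F=\mathcal T\times\{0\}$, $\mathcal N=\mathcal N(E\setminus F)$. Let $\Pi$ be a Poisson point process on $E\setminus F$ with intensity $\lambda(dt)\nu(dx)$, where $\lambda$ is a finite Borel measure on $\mathcal T$ and $\nu$ is a probability distribution on $\mathcal X\setminus\{0\}$ with $\nu\in\mathrm{RV}(\mathcal X\setminus\{0\},(a_n),\mu)$. Then, for every $k\ge 0$, as $n\to\infty$, $$n^{k+1}\,\mathbb P(a_n^{-1}\Pi\in\cdot)\longrightarrow\mu^*_{k+1}(\cdot)\quad\text{in }\mathbb M(\mathcal N\setminus\mathcal N_k),$$ where the limit measure $\mu^*_{k+1}$ is non-null and given by $$\mu^*_{k+1}(B)=\frac1{(k+1)!}\int_{E^{k+1}}\mathbf 1_{\{\sum_{i=1}^{k+1}\varepsilon_{(t_i,x_i)}\in B\}}\ \otimes_{i=1}^{k+1}\lambda(dt_i)\mu(dx_i),\qquad B\in\mathcal B(\mathcal N\setminus\mathcal N_k).$$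
   Context: For a closed subset $F$ of a complete separable metric space $(E,d_E)$, $F^r=\{x\in E: d_E(x,y)<r \text{ for some } y\in F\}$; a set $B$ is bounded away from $F$ if $B\cap F^r=\emptyset$ for some $r>0$. $\mathbb M(E\setminus F)$ is the set of Borel measures $\mu$ on $E\setminus F$ with $\mu(E\setminus F^r)<\infty$ for all $r>0$; $\mu_n\to\mu$ in $\mathbb M(E\setminus F)$ means $\int f\,d\mu_n\to\int f\,d\mu$ for all bounded continuous $f:E\to\mathbb R$ with support bounded away from $F$. This is metrized by $\rho(\mu_1,\mu_2)=\int_0^\infty\{\rho_r(\mu_1^r,\mu_2^r)\wedge1\}e^{-r}dr$, with $\mu^r$ the restriction of $\mu$ to $E\setminus F^r$ and $\rho_r$ the Prohorov metric on finite measures on $E\setminus F^r$. Laws of random elements of $E$ are understood as restricted to $E\setminus F$. A scaling on a metric space $\mathcal X$ is a continuous map $(0,\infty)\times\mathcal X\to\mathcal X$, $(u,x)\mapsto ux$, with $1x=x$ and $u_1(u_2x)=(u_1u_2)x$. The origin $0\in\mathcal X$ satisfies $u0=0$ for all $u>0$, and $d_{\mathcal X}(0,x)<d_{\mathcal X}(0,ux)$ for $u>1$, $x\neq0$. $\nu\in\mathrm{RV}(\mathcal X\setminus\{0\},(a_n),\mu)$ means that $(a_n)$ is a positive sequence with $a_n\to\infty$, $\mu\in\mathbb M(\mathcal X\setminus\{0\})$ is non-null, and $n\nu(a_n\,\cdot)\to\mu(\cdot)$ in $\mathbb M(\mathcal X\setminus\{0\})$. $E=\mathcal T\times\mathcal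 X$ has metric $d_E((t,x),(t',x'))=d_{\mathcal T}(t,t')+d_{\mathcal X}(x,x')$ and scaling $u(t,x)=(t,ux)$. $\mathcal N=\mathcal N(E\setminus F)\subset\mathbb M(E\setminus F)$ is the closed subset of integer-valued (point) measures $\pi=\sum_{i\in I}\varepsilon_{z_i}$, with metric $\rho$ and scaling $u\pi=\sum_{i\in I}\varepsilon_{uz_i}$ ($\varepsilon_z$ is the Dirac mass). $\mathcal N_k\subset\mathcal N$ is the closed cone of point measures with at most $k$ points ($\mathcal N_0=\{0\}$). For $r>0$ let $\mathcal N_k^r=\{\pi\in\mathcal N:\rho(\pi,\psi)<r\text{ for some }\psi\in\mathcal N_k\}$. $\mathbb M(\mathcal N\setminus\mathcal N_k)$ is the set of Borel measures $\mu^*$ on $\mathcal N\setminus\mathcal N_k$ with $\mu^*(\mathcal N\setminus\mathcal N_k^r)<\infty$ for all $r>0$; $\mu_n^*\to\mu^*$ in $\mathbb M(\mathcal N\setminus\mathcal N_k)$ means $\int g\,d\mu_n^*\to\int g\,d\mu^*$ for all bounded continuous $g:\mathcal N\to\mathbb R$ (continuity being with respect to $\rho$) whose support is disjoint from $\mathcal N_k^r$ for some $r>0$. Laws of random elements of $\mathcal N$ are understood as restricted to $\mathcal N\setminus\mathcal N_k$.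
   Formalization: The limit measure is asserted to be non-null only when λ is not the zero measure; for λ = 0 the process is almost surely empty and the limit measure vanishes, while convergence and the formula are still stated for every finite λ. *)

(* Defs.v *)
From HB Require Import structures.
From mathcomp Require Import all_boot all_order all_algebra.
From mathcomp Require Import all_classical all_reals all_analysis.
From mathcomp Require Import measurable_realfun.
From mathcomp Require Import ring lra.

Set Implicit Arguments.
Unset Strict Implicit.
Unset Printing Implicit Defensive.

Import Order.TTheory GRing.Theory Num.Theory.
Import numFieldNormedType.Exports.

Local Open Scope classical_set_scope.
Local Open Scope ring_scope.

(* Complete separable metric spaces carrying their Borel sigma-algebra. They
   are nonempty, because completeType and measurableType extend pointedType;
   [point] is otherwise irrelevant. *)
HB.mixin Record isBorelPolish (d : measure_display) (R : realType) T
    & Metric R T & Complete T & Measurable d T := {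
  polish_separable : exists2 D : set T, countable D & dense D ;
  polish_borel : @measurable d T = <<s @open T >>
}.

#[short(type="polishType")]
HB.structure Definition BorelPolish (d : measure_display) (R : realType) :=
  { T of Metric R T & Complete T & Measurable d T & isBorelPolish d R T }.

Lemma open_mdist_ball (R : realType) (T : metricType R) (x : T) (r : R) :
  open [set y | mdist x y < r].
Proof.
rewrite openE => y /= xy; apply/nbhs_ballP.
exists (r - mdist x y); first by rewrite /= subr_gt0.
rewrite ballEmdist => z /= yz.
by rewrite (le_lt_trans (metric_triangle _ y _))// -ltrBrDl.
Qed.

Section distance.
Context {R : realType} {S : Type} (d : S -> S -> R).

Definition thicken (C : set S) (r : R) : set S :=
  [set x | exists2 y, C y & d x y < r].

Definition dopen : set (set S) :=
  [set U | forall x, U x -> exists2 r, 0 < r & [set y | d x y < r] `<=` U].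

Definition dcontinuous (f : S -> R) :=
  forall x e, 0 < e ->
    exists2 r, 0 < r & forall y, d x y < r -> `|f x - f y| < e.

End distance.

(* A Borel measure on S \ C is represented by a measure on S for which C is
   null; integrals are taken over the complement of C. *)
Section measures_away_from.
Context {disp : measure_display} {S : measurableType disp} {R : realType}.
Variables (d : S -> S -> R) (C : set S).
Local Open Scope ereal_scope.

Definition in_M (m : set S -> \bar R) :=
  m C = 0 /\ forall r : R, (0 < r)%R -> m (~` thicken d C r) < +oo.

(* Since [thicken d C r] is open, it misses the closed support of f as soon as
   f vanishes on it. *)
Definition test_fun (f : S -> R) :=
  [/\ exists M : R, forall x, (`|f x| <= M)%R, dcontinuous d f
    & exists2 r : R, (0 < r)%R & forall x, thicken d C r x -> f x = 0%R].

Definition cvg_M (m_ : nat -> set S -> \bar R) (m : set S -> \bar R) :=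
  forall f, test_fun f ->
    \int[m_ n]_(x in ~` C) (f x)%:E @[n --> \oo]
      --> \int[m]_(x in ~` C) (f x)%:E.

(* The Prohorov distance of two finite measures on the subspace D. *)
Definition prohorov (D : set S) (m1 m2 : set S -> \bar R) : R :=
  inf [set e : R | (0 < e)%R /\ forall A, measurable A -> A `<=` D ->
    m1 A <= m2 (thicken d A e `&` D) + e%:E /\
    m2 A <= m1 (thicken d A e `&` D) + e%:E].

Definition M_dist (m1 m2 : set S -> \bar R) : R :=
  (\int[lebesgue_measure]_(r in `]0%R, +oo[)
    (Num.min (prohorov (~` thicken d C r) m1 m2) 1 * expR (- r)))%R.

End measures_away_from.

(* The action is only specified for u > 0. As ]0, +oo[ x X is open in R x X,
   continuity on it is continuity at each of its points. *)
Record scaling (disp : measure_display) (R : realType)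
    (X : polishType disp R) := Scaling {
  act :> R -> X -> X ;
  origin : X ;
  act_continuous : forall u x, 0 < u ->
    {for (u, x), continuous (fun p : R * X => act p.1 p.2)} ;
  act1 : forall x, act 1 x = x ;
  actM : forall u v x, 0 < u -> 0 < v -> act u (act v x) = act (u * v) x ;
  act_origin : forall u, 0 < u -> act u origin = origin ;
  act_mdist : forall u x, 1 < u -> x <> origin ->
    mdist origin x < mdist origin (act u x)
}.

Definition regularly_varying (disp : measure_display) (R : realType)
    (X : polishType disp R) (s : scaling X) (nu : set X -> \bar R)
    (a : nat -> {posnum R}) (mu : {measure set X -> \bar R}) :=
  [/\ (a n)%:num @[n --> \oo] --> +oo,
    in_M mdist [set origin s] mu,
    mu (~` [set origin s]) != 0%E
  & cvg_M mdist [set origin s]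
      (fun n A => n%:R%:E * nu (s (a n)%:num @` A))%E mu].

(* The Borel sigma-algebra of the product space is the product sigma-algebra
   that the library puts on T * X; see [measurable_prod_dopen] below. *)
Section product_space.
Context {dT dX : measure_display} {R : realType}.
Variables (T : polishType dT R) (X : polishType dX R) (s : scaling X).

Definition prod_dist (p q : T * X) : R := mdist p.1 q.1 + mdist p.2 q.2.

Lemma measurable_prod_dopen :
  @measurable _ (T * X)%type = <<s dopen prod_dist >>.
Proof.
apply/seteqP; split; last first.
  apply: smallest_sub; first exact: sigma_algebra_measurable.
  move=> U oU.
  have [D1 cD1 dD1] := @polish_separable _ _ T.
  have [D2 cD2 dD2] := @polish_separable _ _ X.
  pose box (i : (T * X) * nat) : set (T * X) :=
    [set y | mdist i.1.1 y < i.2.+1%:R^-1] `*`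
    [set y | mdist i.1.2 y < i.2.+1%:R^-1].
  have mbox i : measurable (box i).
    apply: measurableX; rewrite polish_borel; apply: sub_sigma_algebra;
      exact: open_mdist_ball.
  have -> : U = \bigcup_(i in ((D1 `*` D2) `*` [set: nat]) `&`
                               [set i | box i `<=` U]) box i.
    apply/seteqP; split; last by move=> p [i [_ /= bU] bp]; exact: bU.
    move=> [t x] Utx; have [r r0 rU] := oU _ Utx.
    have [n nr] : exists n : nat, n.+1%:R^-1 < r / 4.
      have /cvgrPdist_lt/(_ (r / 4)) := @cvg_harmonic R.
      rewrite divr_gt0// => /(_ isT)[n _ /(_ n (leqnn _))] /=.
      rewrite sub0r normrN /= ger0_norm ?invr_ge0// => h.
      by exists n.
    have n0 : 0 < n.+1%:R^-1 :> R by rewrite invr_gt0.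
    have [t' [tt' Dt']] : [set y | mdist t y < n.+1%:R^-1] `&` D1 !=set0.
      by apply: dD1; [exists t => /=; rewrite mdistxx|exact: open_mdist_ball].
    have [x' [xx' Dx']] : [set y | mdist x y < n.+1%:R^-1] `&` D2 !=set0.
      by apply: dD2; [exists x => /=; rewrite mdistxx|exact: open_mdist_ball].
    exists ((t', x'), n); last first.
      by split => /=; rewrite metric_sym.
    split => // -[t2 x2] [/= h1 h2]; apply: rU; rewrite /prod_dist/=.
    have a1 := metric_triangle t t' t2; have a2 := metric_triangle x x' x2.
    apply: (le_lt_trans (lerD a1 a2)).
    have -> : r = (r / 4 + r / 4) + (r / 4 + r / 4) by field.
    by rewrite !ltrD// (lt_trans _ nr).
  rewrite bigcup_set_type; apply: countable_bigcupT_measurable => //.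
  rewrite (eq_countable (card_setT _)).
  apply: sub_countable (subset_card_le (@subIsetl _ _ _)) _.
  by do !apply: countableX => //; exact: countableP.
apply: smallest_sub; first exact: smallest_sigma_algebra.
have sub (d : measure_display) (Y : polishType d R) (f : T * X -> Y) :
    (forall p q, mdist (f p) (f q) <= prod_dist p q) ->
    preimage_set_system setT f measurable `<=` <<s dopen prod_dist >>.
  move=> fd _ [A mA <-].
  have mf : measurable_fun
      (setT : set (g_sigma_algebraType (dopen prod_dist))) f.
    apply: (@measurability _ _ (g_sigma_algebraType (dopen prod_dist)) Y
      setT f (@open Y)); first exact: polish_borel.
    move=> _ [U oU <-]; rewrite setTI; apply: sub_sigma_algebra => p /= Up.
    move: oU; rewrite openE => /(_ _ Up)/nbhs_ballP[e /= e0 eU].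
    exists e => // q /= pq; apply: eU; rewrite ballEmdist /=.
    exact: le_lt_trans (fd _ _) pq.
  exact: mf.
rewrite subUset; split; apply: sub => p q; rewrite /prod_dist.
  by rewrite lerDl mdist_ge0.
by rewrite lerDr mdist_ge0.
Qed.

Definition prod_act (u : R) (p : T * X) : T * X := (p.1, s u p.2).

Definition prod_axis : set (T * X) := setT `*` [set origin s].

Definition sum_dirac (z : seq (T * X)) (A : set (T * X)) : \bar R :=
  (\sum_(p <- z) \d_p A)%E.

Definition is_point_measure (m : set (T * X) -> \bar R) :=
  in_M prod_dist prod_axis m /\
  exists (I : set nat) (z : nat -> T * X),
    (forall i, I i -> ~ prod_axis (z i)) /\
    forall A, measurable A -> m A = (\esum_(i in I) \d_(z i) A)%E.

(* Two elements with the same values on measurable sets may differ on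
   non-measurable ones. They are then at distance 0, so that open sets,
   Borel sets and continuous functions do not distinguish them. *)
Record point_measure := PointMeasure {
  pm_measure :> {measure set (T * X) -> \bar R} ;
  pm_prop : is_point_measure pm_measure
}.

Lemma measurable_act u : 0 < u -> measurable_fun setT (s u : X -> X).
Proof.
move=> u0.
apply: (@measurability _ _ _ _ setT (s u) (@open X)).
  exact: polish_borel.
move=> _ [U oU <-]; rewrite setTI polish_borel; apply: sub_sigma_algebra.
apply: open_comp oU => x _.
have h := @act_continuous _ _ _ s u x u0.
apply: (@continuous_comp _ _ _ (fun y => (u, y)) (fun p : R * X => s p.1 p.2)).
  apply: (@cvg_pair _ _ _ _ (nbhs u) (nbhs x)); [exact: cvg_cst|exact: cvg_id].
exact: h.
Qed.

Lemma measurable_prod_act u : 0 < u ->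
  measurable_fun setT (prod_act u : T * X -> T * X).
Proof.
move=> u0; apply/measurable_fun_pairP; split; first exact: measurable_fst.
exact: (measurableT_comp (measurable_act u0) measurable_snd).
Qed.

Lemma act_eq_origin u x : 0 < u -> s u x = origin s -> x = origin s.
Proof.
move=> u0 e; rewrite -[x](act1 s) -(mulVf (lt0r_neq0 u0)) -actM ?invr_gt0//.
by rewrite e act_origin// invr_gt0.
Qed.

Lemma thicken_axis r p :
  thicken prod_dist prod_axis r p <-> mdist (origin s) p.2 < r.
Proof.
split=> [[q [_ /= qo]]|h].
  rewrite /prod_dist qo [mdist p.2 _]metric_sym; apply: le_lt_trans.
  by rewrite lerDr mdist_ge0.
exists (p.1, origin s) => //=.
by rewrite /prod_dist/= mdistxx add0r metric_sym.
Qed.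

Lemma measurable_thicken_axis r :
  measurable (thicken prod_dist prod_axis r).
Proof.
have -> : thicken prod_dist prod_axis r =
    snd @^-1` [set x | mdist (origin s) x < r].
  by apply/seteqP; split=> p; rewrite /= thicken_axis.
rewrite -[X in measurable X]setTI; apply: measurable_snd => //.
rewrite polish_borel; apply: sub_sigma_algebra.
exact: open_mdist_ball.
Qed.

Lemma prod_act_thicken u r : 0 < u -> 0 < r -> exists2 e, 0 < e &
  prod_act u @^-1` (~` thicken prod_dist prod_axis r) `<=`
    ~` thicken prod_dist prod_axis e.
Proof.
move=> u0 r0; have := @act_continuous _ _ _ s u (origin s) u0.
move=> /(_ (ball (s u (origin s)) r) (nbhsx_ballx _ _ r0)).
move=> /nbhs_ballP[e /= e0 he]; exists e => // p /= h; apply: contra_not h.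
rewrite !thicken_axis => pe.
have /= := he (u, p.2) _.
rewrite act_origin// ballEmdist/=; apply; split => /=; first exact: ballxx.
by rewrite ballEmdist.
Qed.

Lemma pushforward_point_measure u (m : {measure set (T * X) -> \bar R}) :
  0 < u -> is_point_measure m ->
  is_point_measure (pushforward m (prod_act u : T * X -> T * X)).
Proof.
move=> u0 [[mF mfin] [I [z [zF mE]]]]; split; first split.
- rewrite /pushforward; rewrite -[RHS]mF; congr (m _).
  apply/seteqP; split=> -[t x] [_ /= h]; split=> //=.
    exact: act_eq_origin h.
  by rewrite h act_origin.
- move=> r r0; have [e e0 he] := prod_act_thicken u0 r0.
  rewrite /pushforward; apply: le_lt_trans (mfin _ e0).
  apply: le_measure => //; rewrite inE.
  + rewrite -[X in measurable X]setTI; apply: measurable_prod_act => //.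
    apply: measurableC; exact: measurable_thicken_axis.
  + apply: measurableC; exact: measurable_thicken_axis.
- exists I, (prod_act u \o z); split.
    move=> i Ii [_ /= h]; apply: (zF _ Ii); split=> //=.
    exact: act_eq_origin h.
  move=> A mA; rewrite /pushforward mE.
    by apply: eq_esum => i _; rewrite !diracE.
  by rewrite -[X in measurable X]setTI; exact: measurable_prod_act.
Qed.

Section scaled_measure.
Variables (u : {posnum R}) (m : point_measure).

(* The image of the sum of the Dirac masses at the z_i is the sum of the Dirac
   masses at the u z_i. *)
Let image := pushforward m (prod_act u%:num : T * X -> T * X).

Let mact := measurable_prod_act (gt0 u).
Let image0 : image set0 = 0%E. Proof. exact: measure0. Qed.
Let image_ge0 A : (0 <= image A)%E. Proof. exact: measure_ge0. Qed.
Let image_sigma_additive : semi_sigma_additive image.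
Proof. exact: measure_semi_sigma_additive. Qed.

HB.instance Definition _ := isMeasure.Build _ _ _ image
  image0 image_ge0 image_sigma_additive.

Definition pm_scale : point_measure :=
  PointMeasure
    (pushforward_point_measure (gt0 u) (pm_prop m) : is_point_measure image).

End scaled_measure.

Lemma mzero_point_measure : is_point_measure (@mzero _ (T * X)%type R).
Proof.
split; first by split=> [|r _]; rewrite /mzero ?ltry.
exists set0, (fun=> point); split=> // A _.
by rewrite esum_set0.
Qed.

HB.instance Definition _ := gen_eqMixin point_measure.
HB.instance Definition _ := gen_choiceMixin point_measure.
HB.instance Definition _ :=
  isPointed.Build point_measure (PointMeasure mzero_point_measure).

Definition pm_dist (m1 m2 : point_measure) : R :=
  M_dist prod_dist prod_axis m1 m2.

HB.instance Definition _ := Measurable.copy point_measure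
  (g_sigma_algebraType (dopen pm_dist)).

Definition at_most (k : nat) : set point_measure :=
  [set m | exists2 z : seq (T * X), (size z <= k)%N &
    forall A, measurable A -> m A = sum_dirac z A].

Definition poisson_process (dO : measure_display) (O : measurableType dO)
    (P : probability O R) (Lambda : set (T * X) -> \bar R)
    (Pi : O -> point_measure) :=
  [/\ measurable_fun setT Pi,
    forall A : set (T * X), measurable A -> A `<=` ~` prod_axis ->
      measurable_fun setT (fun w => Pi w A : \bar R) /\
      forall U : set nat,
        P [set w | exists2 j, U j & Pi w A = j%:R%:E] =
        (* the second argument of poisson_prob is a dummy *)
        poisson_prob (fine (Lambda A)) 0 U
  & forall (n : nat) (A : 'I_n -> set (T * X)) (j : 'I_n -> nat),
      (forall i, measurable (A i) /\ A i `<=` ~` prod_axis) ->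
      trivIset setT A ->
      P (\bigcap_i [set w | Pi w (A i) = (j i)%:R%:E]) =
      (\prod_i P [set w | Pi w (A i) = (j i)%:R%:E])%E].

End product_space.

(* The n-fold product of m, built by integrating the measure of sections, as
   the binary product [\x] of the library is. *)
Fixpoint power_measure (d : measure_display) (E : measurableType d)
    (R : realType) (m : set E -> \bar R) (n : nat) :
    set (n.-tuple E) -> \bar R :=
  match n with
  | 0 => fun A => \d_[tuple] A
  | n'.+1 => fun A => (\int[m]_x
      power_measure m [set z : n'.-tuple E | A [tuple of x :: z]])%E
  end.

(* Main.v *)
(* Away from the axis, at distance at least r from it, the rescaled process has
   k + 1 points with probability of order n^-(k+1), and k + 2 points are an order
   of magnitude rarer. A Lipschitz function f that vanishes near the point
   measures with at most k points therefore only sees, up to negligible errors,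
   the event that there are exactly k + 1 points away from the axis, the others
   being dropped; given this event the points are independent, so that
   n^(k+1) E f is 1/(k+1)! times the integral of f(eps_(z_1) + ... + eps_(z_(k+1)))
   for the (k+1)-fold power of the rescaled intensity. These powers converge by
   induction on the number of factors, because for one factor the convergence is
   uniform over bounded Lipschitz functions supported away from the axis;
   separability provides the partition of unity that replaces tightness. *)

Require Import Defs.
From HB Require Import structures.
From mathcomp Require Import all_boot all_order all_algebra.
From mathcomp Require Import all_classical all_reals all_analysis.
From mathcomp Require Import measurable_realfun.
From mathcomp Require Import ring lra.

Set Implicit Arguments.
Unset Strict Implicit.
Unset Printing Implicit Defensive.

Import Order.TTheory GRing.Theory Num.Theory.
Import numFieldNormedType.Exports.

Local Open Scope classical_set_scope.
Local Open Scope ring_scope.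

(** * Lipschitz test functions *)

(** Three properties of the distance between point measures carry the argument. Erasing the points
    below level [r] costs at most [r], so a functional that vanishes near [at_most k] vanishes as
    soon as at most k points lie above a small enough level; on k + 1 points it therefore vanishes
    once one of them is near the axis, which confines all integrals to sets of finite mass. Moving
    one point by [h] costs at most [2 * h], so a Lipschitz functional is Lipschitz in each point.
    Finally, an open set of point measures is a countable union of sets described by counts; hence
    the laws of counts, which are all that the definition of a Poisson process provides, determine
    the law on Borel sets. Distances are only pseudometrics, because [pm_dist] vanishes between
    point measures that differ on non-measurable sets alone. *)

Definition pseudometric {R : realType} {S : Type} (d : S -> S -> R) :=
  [/\ forall x, d x x = 0, forall x y, d x y = d y x
    & forall x y z, d x z <= d x y + d y z].

Definition lip {R : realType} {S : Type} (d : S -> S -> R) (L : R)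
    (f : S -> R) :=
  forall x y, `|f x - f y| <= L * d x y.

Section pseudometric.
Context {R : realType} {S : Type} {d : S -> S -> R}.
Hypothesis dP : pseudometric d.

Lemma pseudometric_xx x : d x x = 0. Proof. by case: dP. Qed.
Lemma pseudometricC x y : d x y = d y x. Proof. by case: dP. Qed.
Lemma pseudometric_triangle x y z : d x z <= d x y + d y z.
Proof. by case: dP. Qed.

Lemma pseudometric_ge0 x y : 0 <= d x y.
Proof.
have := pseudometric_triangle x y x; rewrite pseudometric_xx pseudometricC.
by lra.
Qed.

Lemma dopen_thicken C r : dopen d (thicken d C r).
Proof.
move=> x [y Cy xy]; exists (r - d x y); first by rewrite subr_gt0.
move=> z /= xz; exists y => //.
rewrite (le_lt_trans (pseudometric_triangle _ x _))// pseudometricC.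
by rewrite -ltrBrDr.
Qed.

Lemma thickenD C r t : thicken d (thicken d C r) t `<=` thicken d C (r + t).
Proof.
move=> x [y [z Cz yz] xy]; exists z => //.
by rewrite (le_lt_trans (pseudometric_triangle _ y _))// addrC ltrD.
Qed.

Lemma lip_dcontinuous L f : lip d L f -> dcontinuous d f.
Proof.
move=> fL x e e0; exists (e / (`|L| + 1)).
  by rewrite divr_gt0// ltr_wpDl.
move=> y xy; rewrite (le_lt_trans (fL _ _))//.
rewrite (@le_lt_trans _ _ ((`|L| + 1) * d x y))//.
  by rewrite ler_wpM2r ?pseudometric_ge0// (le_trans (ler_norm _))// lerDl.
by rewrite mulrC -ltr_pdivlMr// ltr_wpDl.
Qed.

Lemma dcontinuousD f g :
  dcontinuous d f -> dcontinuous d g -> dcontinuous d (f \+ g).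
Proof.
move=> cf cg x e e0; have e20 : 0 < e / 2 by rewrite divr_gt0.
have [r r0 fr] := cf x _ e20; have [t t0 gt] := cg x _ e20.
exists (Num.min r t) => [|y]; first by rewrite lt_min r0.
rewrite lt_min => /andP[/fr fxy /gt gxy] /=.
rewrite opprD addrACA (le_lt_trans (ler_normD _ _))// (splitr e).
exact: ltrD.
Qed.

Lemma dcontinuousM c f : dcontinuous d f -> dcontinuous d (fun x => c * f x).
Proof.
move=> cf x e e0; have c0 : 0 < `|c| + 1 by rewrite ltr_wpDl.
have [r r0 fr] := cf x (e / (`|c| + 1)) (divr_gt0 e0 c0).
exists r => // y /fr fxy; rewrite -mulrBr normrM.
rewrite (@le_lt_trans _ _ ((`|c| + 1) * `|f x - f y|))//.
  by rewrite ler_wpM2r// lerDl.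
by rewrite mulrC -ltr_pdivlMr.
Qed.

(** The Pasch-Hausdorff envelope, that is the inf-convolution of [f] with [L * d]: for nonnegative
    [f] and [L], the largest L-Lipschitz minorant of [f]. *)
Definition lip_env (f : S -> R) (L : R) (x : S) : R :=
  inf [set f y + L * d x y | y in setT].

Section lip_env.
Variables (f : S -> R) (f0 : forall x, 0 <= f x).

Let lb L x : 0 <= L -> lbound [set f y + L * d x y | y in setT] 0.
Proof. by move=> L0 _ [y _ <-]; rewrite addr_ge0 ?mulr_ge0 ?pseudometric_ge0. Qed.

Let lbb L x : 0 <= L -> has_lbound [set f y + L * d x y | y in setT].
Proof. by move=> L0; exists 0; exact: lb. Qed.

Let n0 L x : [set f y + L * d x y | y in setT] !=set0.
Proof. by exists (f x + L * d x x), x. Qed.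

Lemma lip_env_le L x y : 0 <= L -> lip_env f L x <= f y + L * d x y.
Proof. by move=> L0; apply: ge_inf; [exact: lbb|exists y]. Qed.

Lemma le_lip_env L x c : (forall y, c <= f y + L * d x y) -> c <= lip_env f L x.
Proof. by move=> h; apply: lb_le_inf => // _ [y _ <-]. Qed.

Lemma lip_env_ge0 L x : 0 <= L -> 0 <= lip_env f L x.
Proof.
by move=> L0; apply: le_lip_env => y; rewrite addr_ge0 ?mulr_ge0 ?pseudometric_ge0.
Qed.

Lemma lip_env_le_self L x : 0 <= L -> lip_env f L x <= f x.
Proof.
by move=> L0; rewrite (le_trans (lip_env_le x x L0))// pseudometric_xx mulr0 addr0.
Qed.

Lemma lip_lip_env L : 0 <= L -> lip d L (lip_env f L).
Proof.
move=> L0; suff h x y : lip_env f L x - lip_env f L y <= L * d x y.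
  by move=> x y; rewrite ler_norml lerNl opprB h pseudometricC h.
rewrite lerBlDl -lerBlDr; apply: le_lip_env => z; rewrite lerBlDr.
rewrite (le_trans (lip_env_le x z L0))// -addrA lerD2l -mulrDr ler_wpM2l//.
by rewrite addrC pseudometric_triangle.
Qed.

Lemma lip_env_mono L L' x : 0 <= L -> L <= L' -> lip_env f L x <= lip_env f L' x.
Proof.
move=> L0 LL'; apply: le_lip_env => y; rewrite (le_trans (lip_env_le x y L0))//.
by rewrite lerD2l ler_wpM2r// pseudometric_ge0.
Qed.

(** Competitors [y] within the continuity radius of [x] lower the value by at most [e]; the others
    pay a penalty that exceeds [f x] once [n] is large. *)
Lemma lip_env_cvg x : dcontinuous d f ->
  lip_env f n%:R x @[n --> \oo] --> f x.
Proof.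
move=> cf; apply/cvgrPdist_le => e e0; have [r r0 fr] := cf x e e0.
have [N _ hN] := near_infty_natSinv_lt (PosNum (divr_gt0 r0 (ltr_wpDl (f0 x) ltr01))).
exists N.+1 => // -[//|n] /= Nn; rewrite ger0_norm; last first.
  by rewrite subr_ge0 lip_env_le_self.
rewrite lerBlDl -lerBlDr; apply: le_lip_env => y.
have [xy|xy] := ltP (d x y) r.
  have := fr _ xy; rewrite ltr_norml => /andP[_ h].
  by have := mulr_ge0 (ler0n R n.+1) (pseudometric_ge0 x y); lra.
have := hN _ Nn; rewrite /= ltr_pdivlMr ?ltr_wpDl// mulrC ltr_pdivrMr// => h.
have : n.+1%:R * r <= n.+1%:R * d x y by rewrite ler_wpM2l.
by have := f0 y; rewrite mulrC; lra.
Qed.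

End lip_env.

(** The envelope with constant [2 / r] of the indicator of the complement of the [r / 2]-thickening.
    Off the [r]-thickening every zero of that indicator is at distance at least [r / 2], where the
    penalty has reached 1. *)
Lemma lip_cutoff C (r : R) : 0 < r ->
  exists g : S -> R, [/\ forall x, 0 <= g x <= 1, lip d (2 / r) g,
    forall x, thicken d C (r / 2) x -> g x = 0
    & forall x, ~ thicken d C r x -> g x = 1].
Proof.
move=> r0; have r20 : 0 <= 2 / r by rewrite divr_ge0// ltW.
pose phi x : R := if x \in thicken d C (r / 2) then 0 else 1.
have phi0 x : 0 <= phi x by rewrite /phi; case: ifP.
have phi1 x : phi x <= 1 by rewrite /phi; case: ifP.
exists (lip_env phi (2 / r)); split => [x||x Cx|x Cx].
- by rewrite lip_env_ge0//= (le_trans (lip_env_le_self phi0 _ r20)).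
- exact: lip_lip_env.
- apply/eqP; rewrite eq_le lip_env_ge0// andbT.
  by rewrite (le_trans (lip_env_le_self phi0 _ r20))// /phi mem_set.
- apply/eqP; rewrite eq_le (le_trans (lip_env_le_self phi0 _ r20))//=.
  apply: le_lip_env => y; rewrite /phi; case: ifPn => [|_].
    rewrite inE => Cy; rewrite add0r mulrAC ler_pdivlMr// mul1r mulrC -ler_pdivrMr//.
    rewrite leNgt; apply/negP => xy; apply: Cx.
    rewrite (splitr r); apply: thickenD; exists y => //.
  by rewrite lerDl mulr_ge0// pseudometric_ge0.
Qed.

End pseudometric.

(** * Reduction of convergence away from a set to Lipschitz test functions *)

Section portmanteau.
Context {disp : measure_display} {S : measurableType disp} {R : realType}.
Variables (d : S -> S -> R) (C : set S).
Hypotheses (dP : pseudometric d) (dB : dopen d `<=` measurable)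
  (mC : measurable C).

Lemma dcontinuous_measurable (f : S -> R) :
  dcontinuous d f -> measurable_fun setT f.
Proof.
move=> cf; apply: (measurability _ (RGenOInfty.measurableE R)).
move=> _ [_ [c ->] <-]; rewrite setTI; apply: dB => x /=.
rewrite in_itv/= andbT => cx; have fxc : 0 < f x - c by rewrite subr_gt0.
have [r r0 fr] := cf x _ fxc.
exists r => // y /= /fr; rewrite in_itv/= andbT ltr_norml => /andP[_].
lra.
Qed.

Lemma measurable_thicken A r : measurable (thicken d A r).
Proof. by apply: dB; exact: dopen_thicken. Qed.

Lemma integral_vanish_lty (m : {measure set S -> \bar R}) (f : S -> R) M r :
  in_M d C m -> 0 < r -> (forall x, 0 <= f x <= M) -> measurable_fun setT f ->
  (forall x, thicken d C r x -> f x = 0) ->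
  (\int[m]_(x in ~` C) (f x)%:E < +oo)%E.
Proof.
move=> [mC0 mfin] r0 fM mf fr.
have M0 : 0 <= M by have /andP[/le_trans h /h] := fM point.
have mD : measurable (~` thicken d C r).
  by apply: measurableC; exact: measurable_thicken.
apply: (@le_lt_trans _ _ (\int[m]_(x in ~` C)
    (M * \1_(~` thicken d C r) x)%:E)%E).
  apply: ge0_le_integral => //.
  - exact: measurableC.
  - by move=> x _; rewrite lee_fin; case/andP: (fM x).
  - by apply/measurable_EFinP; exact: measurable_funTS.
  - apply/measurable_EFinP/measurable_funTS; apply: measurable_funM => //.
  - move=> x _; rewrite lee_fin indicE; have [|] := boolP (x \in _).
      by rewrite mulr1; case/andP: (fM x).
    by rewrite notin_setE /= => /contrapT /fr ->; rewrite mulr0.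
under eq_integral do rewrite EFinM.
rewrite ge0_integralZl//; [|exact: measurableC|]; last first.
  by apply/measurable_EFinP/measurable_funTS.
rewrite integral_indic//; last exact: measurableC.
rewrite lte_mul_pinfty//.
apply: le_lt_trans (mfin r r0); apply: le_measure; rewrite ?inE//.
by apply: measurableI => //; exact: measurableC.
Qed.

Variables (m_ : nat -> {measure set S -> \bar R}) (m : {measure set S -> \bar R}).
Hypotheses (mM : in_M d C m)
  (cvg_lip : forall (f : S -> R) M L r, 0 < r -> (forall x, 0 <= f x <= M) ->
    lip d L f -> (forall x, thicken d C r x -> f x = 0) ->
    (\int[m_ n]_(x in ~` C) (f x)%:E @[n --> \oo]
      --> \int[m]_(x in ~` C) (f x)%:E)%E).

(* [f] is the increasing limit of its Lipschitz envelopes; the upper bound on the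
   limsup follows by applying this to [M * g - f] for a Lipschitz cutoff [g]. *)
Let integral_le_liminf (f : S -> R) M r e : 0 < r ->
  (forall x, 0 <= f x <= M) -> dcontinuous d f ->
  (forall x, thicken d C r x -> f x = 0) -> 0 < e ->
  (\forall n \near \oo, \int[m]_(x in ~` C) (f x)%:E <=
     \int[m_ n]_(x in ~` C) (f x)%:E + e%:E)%E.
Proof.
move=> r0 fM cf fr e0.
have f0 x : 0 <= f x by case/andP: (fM x).
have mf := dcontinuous_measurable cf.
have mE j : measurable_fun setT (lip_env (d := d) f j%:R).
  apply: dcontinuous_measurable; apply: (lip_dcontinuous dP (L := j%:R)).
  exact: lip_lip_env.
have envM j x : 0 <= lip_env (d := d) f j%:R x <= M.
  rewrite lip_env_ge0//= (le_trans (lip_env_le_self dP f0 _ _))//.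
  by case/andP: (fM x).
have envr j x : thicken d C r x -> lip_env (d := d) f j%:R x = 0.
  move=> Cx; apply/eqP; rewrite eq_le lip_env_ge0// andbT.
  by rewrite (le_trans (lip_env_le_self dP f0 _ _))// fr.
have If := integral_vanish_lty mM r0 fM mf fr.
have If0 : (0 <= \int[m]_(x in ~` C) (f x)%:E)%E.
  by apply: integral_ge0 => x _; rewrite lee_fin.
have envI : (\int[m]_(x in ~` C) (lip_env (d := d) f j%:R x)%:E @[j --> \oo]
    --> \int[m]_(x in ~` C) (f x)%:E)%E.
  have := @cvg_monotone_convergence _ S R m (~` C) (measurableC mC)
    (fun j x => (lip_env (d := d) f j%:R x)%:E).
  have -> : (\int[m]_(x in ~` C) limn (fun j => (lip_env (d := d) f j%:R x)%:E))%E
    = (\int[m]_(x in ~` C) (f x)%:E)%E.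
    apply: eq_integral => x _; apply/cvg_lim => //.
    by apply: cvg_EFin; [exact: nearW|exact: lip_env_cvg].
  apply.
  - by move=> j; apply/measurable_EFinP/measurable_funTS.
  - by move=> j x _; rewrite lee_fin lip_env_ge0.
  - by move=> x _ i j ij; rewrite lee_fin lip_env_mono// ler_nat.
have e20 : 0 < e / 2 by rewrite divr_gt0.
have [j hj] : exists j, (\int[m]_(x in ~` C) (f x)%:E <=
    \int[m]_(x in ~` C) (lip_env (d := d) f j%:R x)%:E + (e / 2)%:E)%E.
  move: envI If0 If; case: (\int[m]_(x in ~` C) (f x)%:E)%E => // v envI _ _.
  have /fine_cvgP[fin /cvgrPdist_le/(_ _ e20)] := envI.
  move=> h; near \oo => j; exists j.
  have vfin : (\int[m]_(x in ~` C) (lip_env (d := d) f j%:R x)%:E)%E \is a fin_num.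
    by near: j.
  have : `|v - fine (\int[m]_(x in ~` C) (lip_env (d := d) f j%:R x)%:E)%E| <= e / 2.
    by near: j.
  rewrite -(fineK vfin) -EFinD lee_fin /= ler_norml => /andP[_].
  lra.
have := @cvg_lip _ M _ _ r0 (envM j) (lip_lip_env dP f0 (ler0n _ j)) (envr j).
move=> cj.
have vfin : (\int[m]_(x in ~` C) (lip_env (d := d) f j%:R x)%:E)%E \is a fin_num.
  rewrite ge0_fin_numE; last first.
    by apply: integral_ge0 => x _; rewrite lee_fin lip_env_ge0.
  exact: (integral_vanish_lty mM r0 (envM j) (mE j) (envr j)).
move: cj hj vfin.
case: (\int[m]_(x in ~` C) (lip_env (d := d) f j%:R x)%:E)%E => // v cj hj _.
have /fine_cvgP[fin /cvgrPdist_le/(_ _ e20) vn] := cj.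
near=> n.
apply: (le_trans hj).
apply: (@le_trans _ _ (\int[m_ n]_(x in ~` C) (lip_env (d := d) f j%:R x)%:E +
    e%:E)%E).
  have nfin : (\int[m_ n]_(x in ~` C) (lip_env (d := d) f j%:R x)%:E)%E
    \is a fin_num by near: n.
  have : `|v - fine (\int[m_ n]_(x in ~` C) (lip_env (d := d) f j%:R x)%:E)%E| <= e / 2.
    by near: n.
  by rewrite -(fineK nfin) -!EFinD lee_fin /= ler_norml => /andP[_]; lra.
apply: leeD => //; apply: ge0_le_integral => //.
- exact: measurableC.
- by move=> x _; rewrite lee_fin lip_env_ge0.
- by apply/measurable_EFinP/measurable_funTS.
- by apply/measurable_EFinP/measurable_funTS.
- by move=> x _; rewrite lee_fin lip_env_le_self.
Unshelve. all: by end_near.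
Qed.

Lemma cvg_M_lip : cvg_M d C (fun n => m_ n) m.
Proof.
move=> f [[M fM] cf [r r0 fr]].
have M0 : 0 <= M by rewrite (le_trans _ (fM point)).
have [g [g01 gL gr2 gr]] := lip_cutoff dP C r0.
have r20 : 0 < r / 2 by rewrite divr_gt0.
have fr2 x : thicken d C (r / 2) x -> f x = 0.
  by case=> y Cy xy; apply: fr; exists y => //; lra.
have cg := lip_dcontinuous dP gL.
have mf := dcontinuous_measurable cf; have mg := dcontinuous_measurable cg.
(* Both are nonnegative because [M * g] dominates the absolute value of [f]. As the integral of [g]
   converges, the one-sided bound for [h1] controls the integral of [f] from below and the one for
   [h2] controls it from above. *)
pose h1 x := M * g x + f x; pose h2 x := M * g x + -1 * f x.
have fg x : `|f x| <= M * g x.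
  have [Cx|Cx] := pselect (thicken d C r x).
    by rewrite fr// normr0 mulr_ge0//; case/andP: (g01 x).
  by rewrite gr// mulr1.
have h1M x : 0 <= h1 x <= 2 * M.
  have := fM x; have := fg x; have := ler_wpM2l M0 (proj2 (andP (g01 x))).
  by rewrite /h1 !ler_norml => h /andP[? ?] /andP[? ?]; lra.
have h2M x : 0 <= h2 x <= 2 * M.
  have := fM x; have := fg x; have := ler_wpM2l M0 (proj2 (andP (g01 x))).
  by rewrite /h2 !ler_norml => h /andP[? ?] /andP[? ?]; lra.
have ch1 : dcontinuous d h1.
  by apply: dcontinuousD => //; exact: dcontinuousM.
have ch2 : dcontinuous d h2.
  by apply: dcontinuousD => //; exact: dcontinuousM.
have h1r x : thicken d C (r / 2) x -> h1 x = 0.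
  by move=> Cx; rewrite /h1 fr2// gr2// mulr0 addr0.
have h2r x : thicken d C (r / 2) x -> h2 x = 0.
  by move=> Cx; rewrite /h2 fr2// gr2// !mulr0 addr0.
have Ig := integral_vanish_lty mM r20 g01 mg gr2.
have Ig0 (m' : {measure set S -> \bar R}) : (0 <= \int[m']_(x in ~` C) (g x)%:E)%E.
  by apply: integral_ge0 => x _; rewrite lee_fin; case/andP: (g01 x).
have gfin : (\int[m]_(x in ~` C) (g x)%:E)%E \is a fin_num by rewrite ge0_fin_numE.
have cvg_g := @cvg_lip _ _ _ _ r20 g01 gL gr2.
have mCC := measurableC mC.
have intg (m' : {measure set S -> \bar R}) :
    (\int[m']_(x in ~` C) (g x)%:E)%E \is a fin_num ->
    m'.-integrable (~` C) (fun x => (g x)%:E).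
  move=> h; apply/integrableP; split; first by apply/measurable_EFinP/measurable_funTS.
  rewrite (eq_integral (fun x => (g x)%:E)) => [|x _]; last first.
    by rewrite /= ger0_norm//; case/andP: (g01 x).
  by rewrite -ge0_fin_numE.
have intMg (m' : {measure set S -> \bar R}) :
    (\int[m']_(x in ~` C) (g x)%:E)%E \is a fin_num ->
    m'.-integrable (~` C) (fun x => (M * g x)%:E).
  by move=> h; under eq_fun do rewrite EFinM; apply: integrableZl => //; exact: intg.
have intf (m' : {measure set S -> \bar R}) :
    (\int[m']_(x in ~` C) (g x)%:E)%E \is a fin_num ->
    m'.-integrable (~` C) (fun x => (f x)%:E).
  move=> h; apply: (le_integrable mCC _ _ (intMg _ h)).
    by apply/measurable_EFinP/measurable_funTS.
  move=> x _; rewrite /= lee_fin (le_trans (fg x))// ler_norm//.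
have Ih1 (m' : {measure set S -> \bar R}) :
    (\int[m']_(x in ~` C) (g x)%:E)%E \is a fin_num ->
    (\int[m']_(x in ~` C) (h1 x)%:E)%E =
    ((M * fine (\int[m']_(x in ~` C) (g x)%:E)%E) +
      fine (\int[m']_(x in ~` C) (f x)%:E)%E)%:E.
  move=> h; rewrite /h1.
  under eq_integral do rewrite EFinD.
  rewrite integralD//; [|exact: intMg|exact: intf].
  under [in LHS]eq_integral do rewrite EFinM.
  rewrite integralZl//; last exact: intg.
  rewrite EFinD EFinM !fineK//.
  by apply: integrable_fin_num => //; exact: intf.
have Ih2 (m' : {measure set S -> \bar R}) :
    (\int[m']_(x in ~` C) (g x)%:E)%E \is a fin_num ->
    (\int[m']_(x in ~` C) (h2 x)%:E)%E =
    ((M * fine (\int[m']_(x in ~` C) (g x)%:E)%E) -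
      fine (\int[m']_(x in ~` C) (f x)%:E)%E)%:E.
  move=> h; rewrite /h2.
  under eq_integral do rewrite EFinD.
  rewrite integralD//; [|exact: intMg|]; last first.
    by under eq_fun do rewrite EFinM; apply: integrableZl => //; exact: intf.
  under [in LHS]eq_integral do rewrite EFinM.
  rewrite integralZl//; last exact: intg.
  under [X in (_ + X)%E]eq_integral do rewrite EFinM.
  rewrite integralZl//; last exact: intf.
  rewrite -(fineK h) -[in LHS](fineK (integrable_fin_num mCC (intf _ h))).
  by rewrite -!EFinM -EFinD /= mulN1r.
have /fine_cvgP[nfin /cvgrPdist_le cg'] : (\int[m_ n]_(x in ~` C) (g x)%:E @[n --> \oo]
  --> (fine (\int[m]_(x in ~` C) (g x)%:E))%:E)%E by rewrite fineK.
rewrite -(fineK (integrable_fin_num mCC (intf _ gfin))).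
apply/fine_cvgP; split.
  near=> n; apply: integrable_fin_num => //; apply: intf; near: n; exact: nfin.
apply/cvgrPdist_le => e e0.
have e20 : 0 < e / 2 by rewrite divr_gt0.
have e2M : 0 < e / 2 / (M + 1) by rewrite divr_gt0// ltr_wpDl.
have H1 := integral_le_liminf r20 h1M ch1 h1r e20.
have H2 := integral_le_liminf r20 h2M ch2 h2r e20.
near=> n.
have nf : (\int[m_ n]_(x in ~` C) (g x)%:E)%E \is a fin_num by near: n; exact: nfin.
have : (\int[m]_(x in ~` C) (h1 x)%:E <= \int[m_ n]_(x in ~` C) (h1 x)%:E + (e / 2)%:E)%E.
  by near: n.
have : (\int[m]_(x in ~` C) (h2 x)%:E <= \int[m_ n]_(x in ~` C) (h2 x)%:E + (e / 2)%:E)%E.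
  by near: n.
have : `|fine (\int[m]_(x in ~` C) (g x)%:E) -
    fine (\int[m_ n]_(x in ~` C) (g x)%:E)| <= e / 2 / (M + 1).
  by near: n; exact: cg'.
rewrite !Ih1// !Ih2// -!EFinD !lee_fin.
set G := fine _; set Gn := fine _; set F := fine _; set Fn := fine _.
move=> hG h2' h1'.
have : `|M * (G - Gn)| <= e / 2.
  rewrite normrM (ger0_norm M0) (le_trans (ler_wpM2l M0 hG))//.
  rewrite mulrCA ler_piMr// ?(ltW e20)// ler_pdivrMr ?ltr_wpDl// mul1r; lra.
rewrite /= -/Fn !ler_norml mulrBr => /andP[? ?]; apply/andP; split; lra.
Unshelve. all: by end_near.
Qed.

End portmanteau.

(** * The Prohorov distance *)

Section prohorov.
Context {disp : measure_display} {S : measurableType disp} {R : realType}.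
Variable d : S -> S -> R.
Hypotheses (dP : pseudometric d) (dB : dopen d `<=` measurable).
Implicit Types (D : set S) (m : {measure set S -> \bar R}) (e : R).
Local Open Scope ereal_scope.

Let mthicken A r : measurable (thicken d A r).
Proof. exact: measurable_thicken. Qed.

Definition prohorov_close D (m1 m2 : set S -> \bar R) e :=
  forall A, measurable A -> A `<=` D ->
    m1 A <= m2 (thicken d A e `&` D) + e%:E /\
    m2 A <= m1 (thicken d A e `&` D) + e%:E.

Lemma prohorov_ge0 D m1 m2 : (0 <= prohorov d D m1 m2)%R.
Proof.
rewrite /prohorov; set A := [set _ | _].
have [->|/set0P A0] := eqVneq A set0; first by rewrite inf0.
by apply: lb_le_inf => // e [/ltW].
Qed.

Lemma prohorov_le D m1 m2 e : (0 < e)%R ->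
  prohorov_close D m1 m2 e -> (prohorov d D m1 m2 <= e)%R.
Proof. by move=> e0 h; apply: ge_inf; [exists 0%R => x [/ltW]|]. Qed.

(** The infimum of the empty set is 0 by convention, so a positive lower bound needs an admissible
    [e]. Finiteness of the masses provides one: above both masses every inequality is trivial. *)
Lemma le_prohorov D m1 m2 c : measurable D -> m1 D < +oo -> m2 D < +oo ->
  (forall e, (0 < e)%R -> prohorov_close D m1 m2 e -> (c <= e)%R) ->
  (c <= prohorov d D m1 m2)%R.
Proof.
move=> mD f1 f2 h; apply: lb_le_inf; last by move=> e [e0 he]; exact: h.
have f1' : m1 D \is a fin_num by rewrite ge0_fin_numE.
have f2' : m2 D \is a fin_num by rewrite ge0_fin_numE.
exists (fine (m1 D) + fine (m2 D) + 1)%R; split.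
  by rewrite ltr_wpDl// addr_ge0 ?fine_ge0.
have le_e (m m' : {measure set S -> \bar R}) A e : measurable A -> A `<=` D ->
    m D \is a fin_num -> (fine (m D) <= e)%R ->
    m A <= m' (thicken d A e `&` D) + e%:E.
  move=> mA AD mf he; apply: (@le_trans _ _ (m D)).
    by apply: le_measure; rewrite ?inE.
  by rewrite -(fineK mf) (le_trans _ (leeDr _ _))// lee_fin.
move=> A mA AD; split; apply: le_e => //.
  by rewrite -addrA lerDl addr_ge0 ?fine_ge0.
by rewrite -addrA addrCA lerDl addr_ge0 ?fine_ge0.
Qed.

Lemma prohorovC D m1 m2 : prohorov d D m1 m2 = prohorov d D m2 m1.
Proof.
rewrite /prohorov; congr (inf _); apply/seteqP; split=> e [e0 h]; split=> // A mA AD;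
  by have [] := h A mA AD.
Qed.

Lemma prohorov_eq0 D m1 m2 : measurable D ->
  (forall A, measurable A -> A `<=` D -> m1 A = m2 A) ->
  prohorov d D m1 m2 = 0%R.
Proof.
move=> mD h; apply/eqP; rewrite eq_le prohorov_ge0 andbT.
apply/ler_addgt0Pr => e e0; rewrite add0r; apply: prohorov_le => // A mA AD.
have mT : measurable (thicken d A e `&` D) by exact: measurableI.
have AT : A `<=` thicken d A e `&` D.
  by move=> x Ax; split; [exists x => //; rewrite (pseudometric_xx dP)|exact: AD].
rewrite h// (@h (thicken d A e `&` D))//.
have H : m2 A <= m2 (thicken d A e `&` D) + e%:E.
  rewrite (le_trans _ (leeDl _ _)) ?lee_fin ?(ltW e0)//.
  by apply: le_measure; rewrite ?inE.
by split.
Qed.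

Lemma prohorov_triangle D m1 m2 m3 : measurable D ->
  m1 D < +oo -> m2 D < +oo -> m3 D < +oo ->
  (prohorov d D m1 m3 <= prohorov d D m1 m2 + prohorov d D m2 m3)%R.
Proof.
move=> mD f1 f2 f3.
rewrite -lerBlDl; apply: le_prohorov => // e2 e20 h2.
rewrite lerBlDl -lerBlDr; apply: le_prohorov => // e1 e10 h1.
rewrite lerBlDr; apply: prohorov_le => [|A mA AD]; first exact: addr_gt0.
have mT B e : measurable (thicken d B e `&` D) by exact: measurableI.
have step (m m' m'' : {measure set S -> \bar R}) e e' :
    m A <= m' (thicken d A e `&` D) + e%:E ->
    m' (thicken d A e `&` D) <=
      m'' (thicken d (thicken d A e `&` D) e' `&` D) + e'%:E ->
    m A <= m'' (thicken d A (e + e')%R `&` D) + (e + e')%:E.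
  move=> le1 le2; rewrite (le_trans le1)// EFinD [(e%:E + _)%E]addeC addeA leeD2r//.
  rewrite (le_trans le2)// leeD2r//; apply: le_measure; rewrite ?inE//.
  apply: setSI; apply: subset_trans (thickenD dP (d := d) (C := A) (r := e) (t := e')).
  by move=> x [y [yA _] xy]; exists y.
split.
  by apply: (step _ _ _ _ _ (h1 A mA AD).1); exact: (h2 _ _ _).1.
by rewrite [(e1 + e2)%R]addrC; apply: (step _ _ _ _ _ (h2 A mA AD).2); exact: (h1 _ _ _).2.
Qed.

(** Meant for two radii between which neither measure has mass: test sets and their thickenings can
    then be cut down to [D] without changing any value. *)
Lemma prohorov_subset D D' m1 m2 : measurable D -> measurable D' -> D `<=` D' ->
  m1 (D' `\` D) = 0 -> m2 (D' `\` D) = 0 ->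
  prohorov d D m1 m2 = prohorov d D' m1 m2.
Proof.
move=> mD mD' DD' z1 z2.
have key (m : {measure set S -> \bar R}) A : m (D' `\` D) = 0 ->
    measurable A -> A `<=` D' -> m A = m (A `&` D).
  move=> mz mA AD'; rewrite (measureDI m mA mD) [X in X + _](_ : _ = 0) ?add0e//.
  apply: (subset_measure0 _ _ _ mz); [exact: measurableD|exact: measurableD|].
  exact: setSD.
have mT A e : measurable (thicken d A e `&` D') by exact: measurableI.
rewrite /prohorov; congr (inf _); apply/seteqP; split=> e [e0 h]; split=> // A mA AD.
  have [] := h (A `&` D) (measurableI _ _ mA mD) (@subIsetr _ _ _).
  rewrite -(key m1 A z1 mA AD) -(key m2 A z2 mA AD) => h1 h2.
  have sub (m : {measure set S -> \bar R}) :
      m (thicken d (A `&` D) e `&` D) <= m (thicken d A e `&` D').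
    apply: le_measure; rewrite ?inE//; first exact: measurableI.
    by apply: setISS => // x [y [Ay _] xy]; exists y.
  by split; [apply: (le_trans h1)|apply: (le_trans h2)]; rewrite leeD2r.
have DT (m : {measure set S -> \bar R}) : m (D' `\` D) = 0 ->
    m (thicken d A e `&` D') = m (thicken d A e `&` D).
  by move=> mz; rewrite key//; congr (m _); rewrite -setIA (setIidr DD').
have /= := h A mA (subset_trans AD DD').
by rewrite !DT.
Qed.

End prohorov.

(** * Point measures *)

Lemma pseudometric_mdist (R : realType) (T : metricType R) :
  pseudometric (@mdist R T).
Proof.
by split; [exact: mdistxx|exact: metric_sym|exact: metric_triangle].
Qed.

Section product_geometry.
Context {dT dX : measure_display} {R : realType}.
Context {T : polishType dT R} {X : polishType dX R} {s : scaling X}.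
Implicit Types (p q : T * X) (r e : R).

Lemma pseudometric_prod_dist : pseudometric (@prod_dist _ _ R T X).
Proof.
split=> [p|p q|p q t]; rewrite /prod_dist.
- by rewrite !mdistxx addr0.
- by rewrite metric_sym [X in _ + X]metric_sym.
- by rewrite addrACA lerD// metric_triangle.
Qed.

Lemma prod_dopen_measurable :
  dopen (@prod_dist _ _ R T X) `<=` @measurable _ (T * X)%type.
Proof. by rewrite measurable_prod_dopen; exact: sub_sigma_algebra. Qed.

Lemma polish_dense_seq (d : measure_display) (Y : polishType d R) :
  exists q : nat -> Y, forall x e, 0 < e -> exists i, mdist x (q i) < e.
Proof.
have [D cD dD] := @polish_separable _ _ Y.
have near_D x e : 0 < e -> exists2 y, D y & mdist x y < e.
  move=> e0; have [] := dD _ _ (open_mdist_ball x e).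
    by exists x; rewrite /= mdistxx.
  by move=> y [xy Dy]; exists y.
have [q qD] := pcard_surjP cD.
exists q => x e /(near_D x)[y Dy xy].
by have [i _ qi] := qD _ Dy; exists i; rewrite qi.
Qed.

Lemma prod_dense_seq : exists q : nat -> T * X,
  forall p e, 0 < e -> exists i, prod_dist p (q i) < e.
Proof.
have [q1 h1] := polish_dense_seq T; have [q2 h2] := polish_dense_seq X.
pose c i : T * X := if (unpickle i : option (nat * nat)) is Some (a, b)
  then (q1 a, q2 b) else (q1 0, q2 0).
exists c => p e e0; have e20 : 0 < e / 2 by rewrite divr_gt0.
have [a ha] := h1 p.1 _ e20; have [b hb] := h2 p.2 _ e20.
exists (pickle (a, b)); rewrite /c pickleK /prod_dist/= (splitr e); exact: ltrD.
Qed.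

Definition level p : R := mdist (origin s) p.2.

Lemma level_ge0 p : 0 <= level p. Proof. exact: mdist_ge0. Qed.

Lemma level_le p q : level p <= level q + prod_dist p q.
Proof.
rewrite /level (le_trans (metric_triangle _ q.2 _))// lerD2l metric_sym.
by rewrite /prod_dist lerDr mdist_ge0.
Qed.

Lemma prod_axisP p : prod_axis s p <-> level p = 0.
Proof.
split=> [[_ /= h]|/mdist_positivity h]; first by rewrite /level h mdistxx.
by split; rewrite /= -?h.
Qed.

Lemma measurable_prod_axis : @measurable _ (T * X)%type (prod_axis s).
Proof.
rewrite -[prod_axis s]setCK; apply: measurableC; apply: prod_dopen_measurable.
move=> p /prod_axisP /eqP p0; exists (level p); first by rewrite lt0r p0 level_ge0.
move=> q /= pq /prod_axisP q0; have := level_le p q.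
by rewrite q0 add0r leNgt pq.
Qed.

Definition away r : set (T * X) := ~` thicken (@prod_dist _ _ R T X) (prod_axis s) r.

Lemma awayE r : away r = [set p | r <= level p].
Proof.
by apply/seteqP; split=> p; rewrite /away /setC /= thicken_axis; [
  move/negP; rewrite -leNgt|move=> h; apply/negP; rewrite -leNgt].
Qed.

Lemma measurable_away r : @measurable _ (T * X)%type (away r).
Proof. by apply: measurableC; exact: measurable_thicken_axis. Qed.

Lemma away_axis r A : 0 < r -> A `<=` away r -> A `<=` ~` prod_axis s.
Proof.
move=> r0 Ar p /Ar; rewrite awayE /= => h /prod_axisP p0.
by move: h; rewrite p0 leNgt r0.
Qed.

Lemma sub_away r e : r <= e -> away e `<=` away r.
Proof. by move=> re p; rewrite !awayE; exact: le_trans. Qed.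

End product_geometry.
Arguments level {dT dX R T X} s p.
Arguments away {dT dX R T X} s r.

Section counting.
Context {d : measure_display} {E : measurableType d} {R : realType}.
Implicit Types (z : seq E) (A B : set E).

Definition cnt A z := count (mem A) z.

Lemma cnt_setU A B z : A `&` B = set0 -> cnt (A `|` B) z = (cnt A z + cnt B z)%N.
Proof.
move=> AB; rewrite /cnt -count_predUI.
rewrite [X in (_ + X)%N](@eq_count _ _ pred0) ?count_pred0 ?addn0.
  by apply: eq_count => p; rewrite /= in_setU.
move=> p /=; apply/negP => /andP[/set_mem Ap /set_mem Bp].
by have : (A `&` B) p by []; rewrite AB.
Qed.

Lemma sub_cnt A B z : A `<=` B -> (cnt A z <= cnt B z)%N.
Proof.
by move=> AB; apply: sub_count => p /= /set_mem Ap; apply: mem_set; exact: AB.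
Qed.

Lemma cnt_filter A B z : cnt A [seq p <- z | p \in B] = cnt (A `&` B) z.
Proof. by rewrite /cnt count_filter; apply: eq_count => p /=; rewrite in_setI. Qed.

Lemma cnt_size A z : (cnt A z <= size z)%N. Proof. exact: count_size. Qed.

End counting.

Section point_measures.
Context {dT dX : measure_display} {R : realType}.
Context {T : polishType dT R} {X : polishType dX R} {s : scaling X}.
Local Notation E := (T * X)%type.
Implicit Types (pi : point_measure T s) (z : seq E) (A B : set E) (r : R).
Local Open Scope ereal_scope.

Lemma sum_diracE z A : (sum_dirac z A : \bar R) = (cnt A z)%:R%:E.
Proof.
elim: z => [|p z IH]; first by rewrite /sum_dirac big_nil.
by rewrite /sum_dirac big_cons -/(sum_dirac z A) IH diracE /cnt /= natrD EFinD.
Qed.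

Lemma pm_axis pi : pi (prod_axis s) = 0.
Proof. by case: (pm_prop pi) => -[]. Qed.

Lemma pm_away_lty pi r : (0 < r)%R -> pi (away s r) < +oo.
Proof. by case: (pm_prop pi) => -[_ h] _; exact: h. Qed.

(** Finite mass leaves only finitely many indices off the thickening, since an infinite sum of unit
    masses is infinite. Above a positive level, point measures are handled through such lists. *)
Lemma pm_points pi r : (0 < r)%R -> exists z,
  all (mem (away s r)) z /\
  forall A, measurable A -> A `<=` away s r -> pi A = (cnt A z)%:R%:E.
Proof.
move=> r0; have [_ [I [z [_ pE]]]] := pm_prop pi.
pose J := I `&` [set i | away s r (z i)].
have pJ A : measurable A -> A `<=` away s r -> pi A = \esum_(i in J) \d_(z i) A.
  move=> mA Ar; rewrite pE// /J [RHS]esum_mkcondr; apply: eq_esum => i Ii.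
  case: ifPn => //; rewrite notin_setE /= => zi.
  by rewrite diracE memNset// => /Ar.
have fJ : finite_set J.
  apply: contrapT => iJ; have := pm_away_lty pi r0.
  rewrite pJ//; last exact: measurable_away.
  have := infinite_card_dirac R iJ.
  rewrite (@eq_esum _ _ _ (fun i => \d_(z i) (away s r)) (fun i => \d_i J)).
    by move=> ->.
  by move=> i Ji; rewrite !diracE !mem_set//; case: Ji.
exists (map z (finmap.enum_fset (fset_set J))); split.
  apply/allP => _ /mapP[i iJ ->]; apply: mem_set.
  by move: iJ; rewrite in_fset_set// => /set_mem[].
move=> A mA Ar; rewrite pJ// esum_fset// fsbig_finite//= /cnt count_map.
elim: (finmap.enum_fset (fset_set J)) => [|i l IH]; first by rewrite big_nil.
by rewrite big_cons IH diracE /= natrD EFinD.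
Qed.

Section restriction.
Variables (S : set E) (mS : measurable S) (pi : point_measure T s).

Lemma restr_point_measure : is_point_measure s (mrestr pi mS).
Proof.
have [[p0 pfin] [I [z [zF pE]]]] := pm_prop pi.
split; first split.
- rewrite /mrestr; apply: (subset_measure0 _ _ (@subIsetl _ _ _) p0).
    by apply: measurableI => //; exact: measurable_prod_axis.
  exact: measurable_prod_axis.
- move=> r r0; apply: le_lt_trans (pfin r r0); rewrite /mrestr.
  have m := @measurable_away _ _ _ T X s r.
  by apply: le_measure; rewrite ?inE//; exact: measurableI.
- exists (I `&` [set i | S (z i)]), z; split=> [i [Ii _]|A mA]; first exact: zF.
  rewrite /mrestr pE; last exact: measurableI.
  rewrite [RHS]esum_mkcondr; apply: eq_esum => i Ii; rewrite !diracE in_setI.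
  case: ifPn => [/set_mem /= Sz|]; first by rewrite (mem_set Sz) andbT.
  by rewrite notin_setE /= => Sz; rewrite (memNset Sz) andbF.
Qed.

Definition pm_restr : point_measure T s := PointMeasure restr_point_measure.

Lemma pm_restrE A : pm_restr A = pi (A `&` S). Proof. by []. Qed.

End restriction.

Section sequence.
Variable z : seq E.
Let z' := [seq p <- z | p \in ~` prod_axis s].
Let mz := msum (fun i => \d_(nth point z' i) : {measure set E -> \bar R}) (size z').

Lemma pm_seq_subproof A : mz A = (cnt (A `\` prod_axis s) z)%:R%:E.
Proof.
rewrite /mz /msum setDE -cnt_filter -/z' -sum_diracE /sum_dirac.
by rewrite (big_nth point) big_mkord.
Qed.

Lemma seq_point_measure : is_point_measure s mz.
Proof.
split; first split.
- rewrite pm_seq_subproof setDv /cnt (eq_count (a2 := pred0)) ?count_pred0// => p.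
  by rewrite /= in_set0.
- by move=> r r0; rewrite pm_seq_subproof ltry.
- exists [set i | (i < size z')%N], (nth point z'); split.
    move=> i /= iz; have := mem_nth point iz.
    by rewrite mem_filter => /andP[/set_mem].
  move=> A mA; rewrite /mz /msum esum_fset; [|exact: finite_II|by []].
  exact: (@fsbig_ord _ _ _ (size z') (fun k => \d_(nth point z' k) A)).
Qed.

(** Points on the axis are discarded, since a point measure must not charge it. This makes the
    construction total on lists, hence a measurable map on all tuples. *)
Definition pm_seq : point_measure T s := PointMeasure seq_point_measure.

Lemma pm_seqE A : pm_seq A = (cnt (A `\` prod_axis s) z)%:R%:E.
Proof. exact: pm_seq_subproof. Qed.

End sequence.

Lemma pm_seq_off z A : A `<=` ~` prod_axis s -> pm_seq z A = (cnt A z)%:R%:E.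
Proof. by move=> h; rewrite pm_seqE setDE setIidl. Qed.

End point_measures.
Arguments pm_seq {dT dX R T X} s z.

(** * The distance between point measures *)

(** The function is the pointwise limit of its values at the last point before [r] of the grid of
    step 1/(n+1). The approximations factor through a countable grid, and left constancy turns the
    limit into an eventual equality. *)
Lemma left_constant_measurable (R : realType) (h : R -> R) :
  (forall r, 0 < r -> exists2 e, 0 < e &
    forall t, r - e < t <= r -> h t = h r) ->
  measurable_fun (`]0, +oo[%classic : set R) h.
Proof.
move=> hl.
pose c n (r : R) : int := Num.ceil (r * n.+1%:R).
pose k n (i : int) : R := (i%:~R - 1) / n.+1%:R.
apply: (@measurable_fun_cvg _ _ _ _ (fun n r => h (k n (c n r)))) => [n|r].
  apply: measurable_funTS => _ Y mY; rewrite setTI.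
  have mc : measurable_fun setT (fun r => (c n r)%:~R : R).
    apply: nondecreasing_measurable => // x y xy.
    by rewrite ler_int /c le_ceil// ler_wpM2r.
  have -> : (fun r => h (k n (c n r))) @^-1` Y =
      \bigcup_(i in [set i | Y (h (k n i))])
        (fun r => (c n r)%:~R : R) @^-1` [set i%:~R].
    apply/seteqP; split=> [x /= Yx|x [i /= Yi /eqP]]; first by exists (c n x).
    by rewrite eqr_int => /eqP ->.
  rewrite bigcup_mkcond; apply: countable_bigcupT_measurable.
    exact: countableP.
  by move=> i; case: ifP => // _; rewrite -[X in measurable X]setTI; exact: mc.
rewrite /= in_itv/= andbT => r0; have [e e0 he] := hl r r0.
apply: cvg_near_cst; near=> n; apply: he; rewrite /k /c.
have n0 : 0 < n.+1%:R :> R by [].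
have /andP[h1 h2] := ceil_itv (r * n.+1%:R); rewrite intrD in h1.
apply/andP; split; last by rewrite ler_pdivrMr// ltW.
rewrite ltr_pdivlMr// ltrBrDr (lt_le_trans _ h2)// mulrBl.
have : n.+1%:R^-1 < e by near: n; exact: (near_infty_natSinv_lt (PosNum e0)).
rewrite -[n.+1%:R^-1]mul1r ltr_pdivrMr//; lra.
Unshelve. all: by end_near.
Qed.

Lemma gt_gap (R : realType) (l : seq R) (r : R) :
  exists2 e, 0 < e & forall x, x \in l -> x < r -> x <= r - e.
Proof.
elim: l => [|x l [e e0 IH]]; first by exists 1.
have [xr|rx] := ltP x r.
  exists (Num.min e (r - x)) => [|y]; first by rewrite lt_min e0 subr_gt0.
  rewrite inE => /orP[/eqP ->|yl] yr; first by rewrite lerBrDr -lerBrDl ge_min lexx orbT.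
  by rewrite (le_trans (IH _ yl yr))// lerB// ge_min lexx.
exists e => // y; rewrite inE => /orP[/eqP ->|]; first by rewrite ltNge rx.
exact: IH.
Qed.

Section exponential_weight.
Context {R : realType}.
Local Notation leb := (@lebesgue_measure R).

Lemma integrable_expRN :
  leb.-integrable `]0, +oo[ (fun r => (expR (- r))%:E).
Proof.
have : leb.-integrable `]0, +oo[ (EFin \o exponential_pdf 1).
  apply: (integrableS _ _ _ (integrable_exponential_pdf (@ltr01 R))) => //.
apply: eq_integrable => // r; rewrite inE/= in_itv/= andbT => r0.
by rewrite /= exponential_pdfE ?ltW// mul1r mulN1r.
Qed.

Lemma integrable_pos_Zl (c : R) (f : R -> R) :
  leb.-integrable `]0, +oo[ (fun r => (f r)%:E) ->
  leb.-integrable `]0, +oo[ (fun r => (c * f r)%:E).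
Proof.
move=> h; rewrite (_ : (fun r => _) = (fun r => c%:E * (f r)%:E)%E)//.
by apply: integrableZl => //; exact: measurable_itv.
Qed.

Lemma Rintegral_expRN_le1 :
  (\int[leb]_(r in `]0, +oo[) expR (- r) <= 1)%R.
Proof.
have h : (\int[leb]_(r in `]0%R, +oo[) (expR (- r))%:E)%E \is a fin_num.
  by apply: integrable_fin_num; [exact: measurable_itv|exact: integrable_expRN].
rewrite -lee_fin /Rintegral fineK// -(integral_exponential_pdf (@ltr01 R)).
rewrite [leRHS](_ : _ = \int[leb]_(r in setT) (exponential_pdf 1 r)%:E)%E//.
have pos (r : R) : (0 <= (exponential_pdf 1 r)%:E)%E.
  by rewrite lee_fin exponential_pdf_ge0.
apply: (@le_trans _ _ (\int[leb]_(r in `]0%R, +oo[) (exponential_pdf 1 r)%:E)%E).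
  rewrite le_eqVlt; apply/orP; left; apply/eqP; apply: eq_integral => r.
  rewrite inE/= in_itv/= andbT => r0.
  by rewrite /= exponential_pdfE ?ltW// mul1r mulN1r.
apply: ge0_subset_integral => //.
by apply/measurable_EFinP; exact: measurable_exponential_pdf.
Qed.

End exponential_weight.

Lemma Rintegral_indic_oc {R : realType} (a b : R) : 0 <= a <= b ->
  \int[@lebesgue_measure R]_(r in `]0, +oo[) \1_(`]a, b]%classic) r = b - a.
Proof.
move=> /andP[a0 ab].
have mI : measurable (`]a, b]%classic : set R) by exact: measurable_itv.
have mJ : measurable (`]0, +oo[%classic : set R) by exact: measurable_itv.
rewrite /Rintegral integral_indic// setIidl; last first.
  by move=> r /=; rewrite !in_itv/= andbT => /andP[+ _]; exact: le_lt_trans.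
rewrite [X in fine X](_ : _ = (b - a)%:E)//.
etransitivity; first exact: (lebesgue_measure_itv `]a, b]).
rewrite /= lte_fin; case: ltP => //= ba.
by congr EFin; apply/esym/eqP; rewrite subr_eq0 eq_le ba.
Qed.

Section pm_dist.
Context {dT dX : measure_display} {R : realType}.
Context {T : polishType dT R} {X : polishType dX R} {s : scaling X}.
Local Notation E := (T * X)%type.
Local Notation leb := (@lebesgue_measure R).
Implicit Types (pi psi phi : point_measure T s) (z : seq E) (r e : R).

Local Notation pr pi psi r := (prohorov (@prod_dist _ _ R T X) (away s r) pi psi).

Let dP : pseudometric (@prod_dist _ _ R T X) := pseudometric_prod_dist.
Let dB := @prod_dopen_measurable _ _ R T X.
Let mA r := @measurable_away _ _ R T X s r.

(** Above level [r / 2] both measures have finitely many points, so some interval to the left of [r]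
    contains none of their levels. To the right of [r] constancy may fail, as a point at level
    exactly [r] is lost. *)
Let prohorov_left_constant pi psi r : 0 < r -> exists2 e, 0 < e &
  forall t, r - e < t <= r -> pr pi psi t = pr pi psi r.
Proof.
move=> r0; have r20 : 0 < r / 2 by rewrite divr_gt0.
have [z [_ zE]] := pm_points pi r20; have [w [_ wE]] := pm_points psi r20.
have [e e0 he] := gt_gap (map (level s) (z ++ w)) r.
exists (Num.min e (r / 2)) => [|t /andP[rt tr]]; first by rewrite lt_min e0.
have t2 : r / 2 <= t.
  have : Num.min e (r / 2) <= r / 2 by rewrite ge_min lexx orbT.
  by lra.
have te : r - e < t.
  by apply: le_lt_trans rt; rewrite lerB// ge_min lexx.
have cnt0 (l : seq E) : {subset l <= z ++ w} -> cnt (away s t `\` away s r) l = 0%N.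
  move=> lzw; apply/eqP; rewrite eqn0Ngt -has_count; apply/hasPn => p /lzw pzw /=.
  rewrite notin_setE !awayE /= => -[tp /negP]; rewrite -ltNge => pr.
  have := he (level s p) (map_f _ pzw) pr.
  by move=> /(lt_le_trans (lt_le_trans te tp)); rewrite ltxx.
have sub : away (T := T) s t `\` away s r `<=` away s (r / 2).
  exact: subset_trans (@subDsetl _ _ _) (sub_away t2).
apply/esym; apply: prohorov_subset => //.
- exact: sub_away.
- rewrite zE//; last exact: measurableD.
  by rewrite cnt0// => p pz; rewrite mem_cat pz.
- rewrite wE//; last exact: measurableD.
  by rewrite cnt0// => p pz; rewrite mem_cat pz orbT.
Qed.

Let weight pi psi r := Num.min (pr pi psi r) 1 * expR (- r).

Let pm_distE pi psi : pm_dist pi psi = \int[leb]_(r in `]0, +oo[) weight pi psi r.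
Proof. by []. Qed.

Let measurable_weight pi psi :
  measurable_fun (`]0, +oo[%classic : set R) (weight pi psi).
Proof.
apply: measurable_funM; last first.
  apply: measurable_funTS; apply: continuous_measurable_fun => x.
  apply: (@continuous_comp _ _ _ (fun r => - r) expR); first exact: opp_continuous.
  exact: continuous_expR.
apply: measurable_minr => //; apply: left_constant_measurable => r.
exact: prohorov_left_constant.
Qed.

Let weight_ge0 pi psi r : 0 <= weight pi psi r.
Proof. by rewrite mulr_ge0 ?expR_ge0// le_min ler01 prohorov_ge0. Qed.

Let weight_le pi psi r : weight pi psi r <= expR (- r).
Proof. by rewrite /weight ler_piMl ?expR_ge0// ge_min lexx orbT. Qed.

Let integrable_weight pi psi :
  leb.-integrable `]0, +oo[ (EFin \o weight pi psi).
Proof.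
apply: (le_integrable _ _ _ integrable_expRN) => //.
  by apply/measurable_EFinP; exact: measurable_weight.
move=> r _; rewrite /= lee_fin ger0_norm ?weight_ge0//.
by rewrite ger0_norm ?expR_ge0// weight_le.
Qed.

(** Off []a, b]] the integrand is at most [c * expR (- r)], of integral at most [c]; on []a, b]] it
    is at most 1. The exceptional interval allows for radii at which a point is present in one
    measure only. *)
Lemma pm_dist_le pi psi (c a b : R) : 0 <= c -> 0 <= a <= b ->
  (forall r, 0 < r -> ~ (a < r <= b) -> pr pi psi r <= c) ->
  pm_dist pi psi <= c + (b - a).
Proof.
move=> c0 /andP[a0 ab] h; rewrite pm_distE.
have mI : measurable (`]a, b]%classic : set R) by exact: measurable_itv.
have I2 : leb.-integrable `]0, +oo[ (EFin \o (fun r => \1_(`]a, b]%classic) r : R)).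
  apply: (@integrableS _ _ _ _ setT) => //.
  exact: integrable_indic_itv.
have I1 : leb.-integrable `]0, +oo[ (EFin \o (fun r => c * expR (- r))).
  exact: (integrable_pos_Zl _ integrable_expRN).
apply: (@le_trans _ _ (\int[leb]_(r in `]0, +oo[) (c * expR (- r) + \1_(`]a, b]%classic) r))).
  apply: le_Rintegral => //.
    exact: (integrableD _ I1 I2).
  move=> r; rewrite /= in_itv/= andbT => r0; rewrite indicE.
  have [|] := boolP (r \in _); rewrite ?inE ?notin_setE /= in_itv/= => rab.
    rewrite (le_trans (weight_le _ _ _))//.
    rewrite (@le_trans _ _ 1)// ?lerDr ?mulr_ge0 ?expR_ge0//.
    by rewrite -expR0 ler_expR lerNl oppr0 ltW.
  rewrite addr0 ler_wpM2r ?expR_ge0// ge_min h//.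
rewrite RintegralD//; apply: lerD; last first.
  by rewrite Rintegral_indic_oc// a0.
  rewrite RintegralZl//; last exact: integrable_expRN.
  by rewrite -[leRHS]mulr1 ler_wpM2l// Rintegral_expRN_le1.
Qed.

(** The constant is the length of []0, e]] times the least value of the exponential weight on it. *)
Lemma le_pm_dist pi psi (e : R) : 0 < e ->
  (forall r, 0 < r <= e -> 1 <= pr pi psi r) ->
  e * expR (- e) <= pm_dist pi psi.
Proof.
move=> e0 h; rewrite pm_distE.
have I2 : leb.-integrable `]0, +oo[ (EFin \o (fun r => \1_(`]0, e]%classic) r : R)).
  apply: (@integrableS _ _ _ _ setT) => //.
  exact: integrable_indic_itv.
rewrite mulrC -[X in _ * X]subr0 -Rintegral_indic_oc; last by rewrite lexx ltW.
rewrite -RintegralZl//; apply: le_Rintegral => //.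
  exact: (integrable_pos_Zl _ I2).
move=> r; rewrite /= in_itv/= andbT => r0; rewrite indicE.
have [|_] := boolP (r \in _); last by rewrite mulr0 weight_ge0.
rewrite inE /= in_itv/= r0 /= => re.
by rewrite mulr1 /weight min_r ?h ?r0// mul1r ler_expR lerN2.
Qed.

Lemma pseudometric_pm_dist : pseudometric (@pm_dist _ _ R T X s).
Proof.
split=> [pi|pi psi|pi phi psi]; rewrite !pm_distE.
- rewrite (@eq_Rintegral _ _ _ _ _ (fun=> 0)) => [|r _]; last first.
    by rewrite /weight prohorov_eq0// min_l// mul0r.
  by rewrite Rintegral_cst// mul0r.
- by apply: eq_Rintegral => r _; rewrite /weight prohorovC.
- rewrite -RintegralD//; apply: le_Rintegral => //.
    exact: (integrableD _ (integrable_weight pi phi) (integrable_weight phi psi)).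
  move=> r; rewrite /= in_itv/= andbT => r0.
  rewrite /weight -mulrDl ler_wpM2r ?expR_ge0//.
  have fin pi' : (pi' (away s r) < +oo)%E by exact: pm_away_lty.
  have tri := prohorov_triangle dP dB (mA r) (fin pi) (fin phi) (fin psi).
  have p1 := prohorov_ge0 (@prod_dist _ _ R T X) (away s r) pi phi.
  have p2 := prohorov_ge0 (@prod_dist _ _ R T X) (away s r) phi psi.
  rewrite !minEle; do !case: ifPn => //; rewrite -?ltNge; lra.
Qed.

Lemma pm_dist_agree pi psi : (forall A, measurable A -> pi A = psi A) ->
  pm_dist pi psi = 0.
Proof.
move=> h; apply/eqP; rewrite eq_le (pseudometric_ge0 pseudometric_pm_dist) andbT.
apply: (le_trans (pm_dist_le (lexx 0) (_ : 0 <= 0 <= 0) _)); rewrite ?lexx//.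
  by move=> r _ _; rewrite prohorov_eq0// => A mA' _; exact: h.
Qed.

Lemma pm_dist_restr pi r : 0 <= r -> pm_dist pi (pm_restr (mA r) pi) <= r.
Proof.
move=> r0; apply: (le_trans (pm_dist_le (lexx 0) (_ : 0 <= 0 <= r) _)).
- by rewrite lexx.
- move=> t t0 /negP; rewrite t0 /= -ltNge => rt.
  rewrite prohorov_eq0// => A mA' At; rewrite pm_restrE setIidl//.
  by apply: subset_trans At _; apply: sub_away; exact: ltW.
- by rewrite add0r subr0.
Qed.

(** At radii outside []l, u]], [p] and [q] are both kept or both dropped, and the Prohorov distance
    is at most the displacement. The interval []l, u]] between their levels is no longer than the
    displacement, which gives the second half of the factor 2. *)
Lemma pm_dist_seq_cons (p q : E) z :
  pm_dist (pm_seq s (p :: z)) (pm_seq s (q :: z)) <= 2 * prod_dist p q.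
Proof.
set l := Num.min (level s p) (level s q); set u := Num.max (level s p) (level s q).
have lu : 0 <= l <= u.
  by rewrite le_min !level_ge0 /= ge_min le_max lexx.
have ul : u - l <= prod_dist p q.
  have := level_le (s := s) p q; have := level_le (s := s) q p.
  rewrite (pseudometricC dP q p) /u /l maxEle minEle; case: ifP => _; lra.
have dpq := pseudometric_ge0 dP p q.
(* [thicken] asks for a strict inequality, so the moved point is only reached with a margin [e]. *)
apply/ler_addgt0Pr => e e0.
have c0 : 0 <= prod_dist p q + e by rewrite addr_ge0// ltW.
apply: (le_trans (pm_dist_le c0 lu _)); last by lra.
move=> r r0 rlu; apply: prohorov_le; first by lra.
have lev : (r <= level s p) = (r <= level s q).
  apply/idP/idP => h; rewrite leNgt; apply/negP => h'; apply: rlu;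
    by rewrite /l /u gt_min le_max h h' ?orbT.
have awq x y A : A `<=` away s r -> (r <= level s x) = (r <= level s y) ->
  prod_dist x y < prod_dist p q + e -> (x \in A <= (y \in
    thicken (@prod_dist _ _ R T X) A (prod_dist p q + e) `&` away s r))%N.
  move=> Ar rxy xy; have [|//] := boolP (x \in A); rewrite inE => Ax.
  rewrite mem_set//; split; last by have := Ar _ Ax; rewrite !awayE /= rxy.
  by exists x => //; rewrite (pseudometricC dP).
have cz A : A `<=` away s r -> (cnt A z <= cnt
    (thicken (@prod_dist _ _ R T X) A (prod_dist p q + e) `&` away s r) z)%N.
  move=> Ar; apply: sub_cnt => x Ax; split; last exact: Ar.
  by exists x => //; rewrite (pseudometric_xx dP); lra.
have off A : A `<=` away s r -> A `<=` ~` prod_axis s by exact: away_axis.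
move=> A mA' Ar; rewrite !pm_seq_off; [|exact: off..].
have lt1 : prod_dist p q < prod_dist p q + e by lra.
have lt2 : prod_dist q p < prod_dist p q + e by rewrite (pseudometricC dP); lra.
split; rewrite -[leLHS]adde0 leeD ?lee_fin// ler_nat leq_add ?cz//; exact: awq.
Qed.

(** Tested on [away s r] itself, with [r] at most [e], an admissible [c] satisfies [k + 1 <= k + c];
    hence the Prohorov distance is at least 1 at all these radii. *)
Lemma pm_dist_ge_count pi psi k e : 0 < e ->
  (k.+1%:R%:E <= pi (away s e))%E -> (psi (~` prod_axis s) <= k%:R%:E)%E ->
  e * expR (- e) <= pm_dist pi psi.
Proof.
move=> e0 hpi hpsi; apply: le_pm_dist => // r /andP[r0 re].
apply: le_prohorov => //; [exact: pm_away_lty|exact: pm_away_lty|].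
move=> c c0 /(_ (away s r) (mA r) (@subset_refl _ _))[h _].
have H : (k.+1%:R%:E <= k%:R%:E + c%:E)%E.
  apply: (le_trans hpi); apply: (@le_trans _ _ (pi (away s r))).
    by apply: le_measure; rewrite ?inE//; exact: sub_away.
  apply: (le_trans h); rewrite leeD2r// (le_trans _ hpsi)//.
  have mF := @measurable_prod_axis _ _ R T X s.
  apply: le_measure; rewrite ?inE//.
  - apply: measurableI => //; exact: measurable_thicken.
  - exact: measurableC.
  - by apply: away_axis r0 _; exact: subIsetr.
by move: H; rewrite -EFinD lee_fin -natr1 lerD2l.
Qed.

End pm_dist.

(** * Borel sets of point measures *)

Section eval_sigma_algebra.
Context {dT dX : measure_display} {R : realType}.
Context {T : polishType dT R} {X : polishType dX R} {s : scaling X}.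
Local Notation E := (T * X)%type.
Local Notation dE := (@prod_dist _ _ R T X).
Local Notation N := (point_measure T s).
Implicit Types (pi psi : N) (z : seq E) (r e : R).

(** Finite counts suffice as generators: infinite mass is the complement of their union. *)
Definition eval_sets : set (set N) :=
  [set B | exists (A : set E) (j : nat), measurable A /\ B = [set pi : N | pi A = j%:R%:E]].

Lemma eval_measurable (d : measure_display) (O : measurableType d) (F : O -> N) :
  (forall A j, measurable A -> measurable [set w | F w A = j%:R%:E]) ->
  forall B, <<s eval_sets>> B -> measurable [set w | B (F w)].
Proof.
move=> h B sB; rewrite -[X in measurable X]setTI.
have mF : measurable_fun setT (F : O -> g_sigma_algebraType eval_sets).
  apply: (measurability (rT := g_sigma_algebraType eval_sets) eval_sets) => //.
  by move=> _ [_ [A [j [mA ->]]] <-]; rewrite setTI; exact: h.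
exact: mF.
Qed.

(** The sets that do not separate [pi] from [psi] form a sigma-algebra containing the generators. *)
Lemma eval_invariant B pi psi : <<s eval_sets>> B ->
  (forall A, measurable A -> pi A = psi A) -> B pi -> B psi.
Proof.
move=> sB h; suff H : <<s eval_sets>> `<=` [set C | C pi <-> C psi] by case: (H _ sB).
apply: smallest_sub; first split.
- by split.
- by move=> C /= hC; rewrite /setD /=; tauto.
- move=> F hF; rewrite /bigcup /=; split=> -[i _ Fi]; exists i => //; exact/hF.
- by move=> _ [A [j [mA ->]]] /=; rewrite h.
Qed.

Lemma pm_seq_perm z w : perm_eq z w -> forall A, pm_seq s z A = pm_seq s w A.
Proof. by move=> /permP zw A; rewrite !pm_seqE /cnt zw. Qed.

Lemma pm_dist_seq_mid u v (p q : E) :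
  pm_dist (pm_seq s (u ++ p :: v)) (pm_seq s (u ++ q :: v)) <= 2 * dE p q.
Proof.
have dP := @pseudometric_pm_dist _ _ R T X s.
have head x : pm_dist (pm_seq s (u ++ x :: v)) (pm_seq s (x :: u ++ v)) = 0.
  by apply: pm_dist_agree => A _; apply: pm_seq_perm; rewrite perm_catC /= perm_cons perm_catC.
apply: (le_trans (pseudometric_triangle dP _ (pm_seq s (p :: u ++ v)) _)).
rewrite head add0r.
apply: (le_trans (pseudometric_triangle dP _ (pm_seq s (q :: u ++ v)) _)).
by rewrite [X in _ + X](pseudometricC dP) head addr0 pm_dist_seq_cons.
Qed.

(** With [f] the cell index, it reorders one list of points so that corresponding points of the two
    lists lie in the same cell. *)
Lemma perm_map_match (I J : eqType) (f : I -> J) (z w : seq I) :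
  perm_eq (map f z) (map f w) -> exists2 v, perm_eq v w & map f v = map f z.
Proof.
elim: z w => [|x z IH] w zw; first by exists w => //; apply/eqP; rewrite -size_eq0 -(perm_size zw).
have /mapP[y yw xy] : f x \in map f w by rewrite -(perm_mem zw) mem_head.
have wy := perm_to_rem yw.
have : perm_eq (map f z) (map f (rem y w)).
  by rewrite -(perm_cons (f x)) (perm_trans zw)// xy -map_cons perm_map.
move=> /IH[v vw vz]; exists (y :: v); last by rewrite /= vz xy.
by rewrite (perm_trans _ (_ : perm_eq (y :: rem y w) _)) ?perm_cons// perm_sym.
Qed.

Section cells.
Variables (q : nat -> E) (qd : forall p e, 0 < e -> exists i, dE p (q i) < e).

(** The points for which the i-th ball around the dense sequence is the first to contain them: a
    countable partition into small sets. *)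
Definition cell e i : set E :=
  thicken dE [set q i] e `\` \bigcup_(j in `I_i) thicken dE [set q j] e.

Lemma measurable_cell e i : measurable (cell e i).
Proof.
have m j : measurable (thicken dE [set q j] e).
  by apply: measurable_thicken; [exact: pseudometric_prod_dist|exact: prod_dopen_measurable].
by apply: measurableD => //; apply: bigcup_measurable => j _.
Qed.

Lemma cell_dist e i p p' : cell e i p -> cell e i p' -> dE p p' <= 2 * e.
Proof.
move=> [[_ -> pq] _] [[_ -> pq'] _].
have dP := @pseudometric_prod_dist _ _ R T X.
have := pseudometric_triangle dP p (q i) p'.
by rewrite (pseudometricC dP (q i)); lra.
Qed.

Lemma cell_uniq e i j p : cell e i p -> cell e j p -> i = j.
Proof.
move=> [pi ni] [pj nj]; case: (ltngtP i j) => // ij.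
- by exfalso; apply: nj; exists i.
- by exfalso; apply: ni; exists j.
Qed.

Lemma cell_cover e p : 0 < e -> exists i, cell e i p.
Proof.
move=> e0; have ex : exists i, p \in thicken dE [set q i] e.
  by have [i pq] := qd p e0; exists i; rewrite inE; exists (q i).
case: (ex_minnP ex) => i /set_mem pi mini; exists i; split => // -[j /= ji pj].
by have := mini j (mem_set pj); rewrite leqNgt ji.
Qed.

Definition cell_idx e p : nat := xget 0%N [set i | cell e i p].

Lemma cell_idxP e i p : 0 < e -> cell e i p <-> cell_idx e p = i.
Proof.
move=> e0; have [j pj] := cell_cover p e0.
have xj : cell e (cell_idx e p) p by exact: (@xgetPex _ 0%N [set i | cell e i p]) (ex_intro _ j pj).
by split=> [pi|<-//]; exact: cell_uniq pi.
Qed.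

(** The list of cell indices records a configuration above level [r] up to displacements within
    cells. Lists of naturals being countable, so is the family for rational radii. *)
Definition cell_nbhs r e (u : seq nat) : set N :=
  [set pi | pi (away s r) = (size u)%:R%:E /\
    forall i, pi (away s r `&` cell e i) = (count_mem i u)%:R%:E].

Lemma cell_nbhs_eval r e u : <<s eval_sets>> (cell_nbhs r e u).
Proof.
have gen A j : measurable A ->
    @measurable _ (g_sigma_algebraType eval_sets) [set pi | pi A = j%:R%:E].
  by move=> mA; apply: sub_sigma_algebra; exists A, j.
have -> : cell_nbhs r e u = [set pi | pi (away s r) = (size u)%:R%:E] `&`
    \bigcap_i [set pi | pi (away s r `&` cell e i) = (count_mem i u)%:R%:E].
  by apply/seteqP; split=> pi [h1 h2]; split=> // i; [move=> _|]; exact: h2.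
suff : @measurable _ (g_sigma_algebraType eval_sets)
    ([set pi | pi (away s r) = (size u)%:R%:E] `&`
    \bigcap_i [set pi | pi (away s r `&` cell e i) = (count_mem i u)%:R%:E]) by [].
apply: measurableI; first by apply: gen; exact: measurable_away.
apply: bigcapT_measurable => i; apply: gen.
by apply: measurableI; [exact: measurable_away|exact: measurable_cell].
Qed.

Let pm_points_idx pi r e : 0 < r -> 0 < e -> exists z,
  [/\ pm_dist pi (pm_seq s z) <= r, pi (away s r) = (size z)%:R%:E
    & forall i, pi (away s r `&` cell e i) = (count_mem i (map (cell_idx e) z))%:R%:E].
Proof.
move=> r0 e0; have [z [zr zE]] := pm_points pi r0; exists z.
have mA := @measurable_away _ _ R T X s r.
have cz A : cnt (A `&` away s r) z = cnt A z.
  by apply: eq_in_count => p /(allP zr) /= pr; rewrite in_setI pr andbT.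
split.
- apply: le_trans (pm_dist_restr pi (ltW r0)).
  have dP := @pseudometric_pm_dist _ _ R T X s.
  apply: (le_trans (pseudometric_triangle dP _ (pm_restr mA pi) _)).
  rewrite -[leRHS]addr0 lerD2l pm_dist_agree// => A mA'.
  rewrite pm_restrE zE; [|exact: measurableI|exact: subIsetr].
  rewrite pm_seqE -[in RHS]cz; congr (_%:R%:E); congr (cnt _ _).
  rewrite setDE -setIA; congr (_ `&` _); apply/esym/setIidPr.
  exact: (away_axis r0).
- rewrite zE// (_ : cnt _ z = size z)//.
  by apply/eqP; rewrite -all_count; exact: zr.
- move=> i; rewrite zE; [|by apply: measurableI => //; exact: measurable_cell|exact: subIsetl].
  rewrite setIC cz count_map; congr (_%:R%:E); apply: eq_count => p /=.
  by apply/idP/eqP; rewrite inE => /(cell_idxP _ _ e0).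
Qed.

(** The term [2 * r] erases the low points of both measures. The remaining points are paired within
    cells and exchanged one at a time, each moving by at most [2 * e] and so costing at most
    [4 * e]. *)
Lemma cell_nbhs_dist r e u pi psi : 0 < r -> 0 < e ->
  cell_nbhs r e u pi -> cell_nbhs r e u psi ->
  pm_dist pi psi <= 2 * r + (size u)%:R * (4 * e).
Proof.
move=> r0 e0 [piN piu] [psiN psiu].
have dP := @pseudometric_pm_dist _ _ R T X s.
have [z [dz zN zu]] := pm_points_idx pi r0 e0.
have [w [dw wN wu]] := pm_points_idx psi r0 e0.
have zw : perm_eq (map (cell_idx e) z) (map (cell_idx e) w).
  apply/allP => i _ /=; have := zu i; have := wu i; rewrite piu psiu.
  by move=> -[/eqP +] -[/eqP]; rewrite !eqr_nat => /eqP <- /eqP <-.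
have zsize : size z = size u.
  by move: zN; rewrite piN => -[/eqP]; rewrite eqr_nat => /eqP.
have [v vw vz] := perm_map_match zw.
have chain t z1 v1 : map (cell_idx e) v1 = map (cell_idx e) z1 ->
    pm_dist (pm_seq s (t ++ z1)) (pm_seq s (t ++ v1)) <= (size z1)%:R * (4 * e).
  elim: z1 v1 t => [|x z1 IH] [|y v1] t //=.
    by rewrite (pseudometric_xx dP) mul0r.
  case=> xy vz1.
  apply: (le_trans (pseudometric_triangle dP _ (pm_seq s (t ++ y :: z1)) _)).
  rewrite -[in leRHS]natr1 mulrDl addrC lerD//; last first.
    rewrite (le_trans (pm_dist_seq_mid _ _ _ _))// mul1r.
    have cx : cell e (cell_idx e x) x by exact/cell_idxP.
    have cy : cell e (cell_idx e x) y by exact/cell_idxP.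
    by have := cell_dist cx cy; lra.
  by have := IH _ (rcons t y) vz1; rewrite !cat_rcons.
apply: (le_trans (pseudometric_triangle dP _ (pm_seq s z) _)).
have h1 : pm_dist (pm_seq s z) (pm_seq s v) <= (size u)%:R * (4 * e).
  by rewrite -zsize; have := chain [::] z v vz.
have h2 : pm_dist (pm_seq s v) (pm_seq s w) = 0.
  by apply: pm_dist_agree => A _; exact: pm_seq_perm.
have h3 : pm_dist (pm_seq s z) psi <= (size u)%:R * (4 * e) + (0 + r).
  apply: (le_trans (pseudometric_triangle dP _ (pm_seq s v) _)); apply: lerD => //.
  apply: (le_trans (pseudometric_triangle dP _ (pm_seq s w) _)); apply: lerD.
    by rewrite h2.
  by rewrite (pseudometricC dP).
by rewrite (le_trans (lerD dz h3))// add0r addrCA -mulr2n -[r *+ 2]mulr_natl addrC.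
Qed.

Lemma cell_nbhs_mem r e pi : 0 < r -> 0 < e ->
  exists u, cell_nbhs r e u pi /\ pi (away s r) = (size u)%:R%:E.
Proof.
move=> r0 e0; have [z [_ zN zu]] := pm_points_idx pi r0 e0.
by exists (map (cell_idx e) z); rewrite /cell_nbhs size_map.
Qed.

End cells.

Lemma dopen_eval : dopen (@pm_dist _ _ R T X s) `<=` <<s eval_sets>>.
Proof.
move=> U oU; have [q qd] := @prod_dense_seq _ _ R T X.
pose V (i : nat * nat * seq nat) : set N :=
  cell_nbhs q i.1.1.+1%:R^-1 i.1.2.+1%:R^-1 i.2.
have -> : U = \bigcup_(i in [set i | V i `<=` U]) V i.
  apply/seteqP; split=> [pi Upi|pi [i iU] Vi]; last exact: iU.
  have [t t0 tU] := oU _ Upi.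
  (* The level is chosen first, so that erasing costs less than [t / 2]. It fixes the number of
     points above it, relative to which the cell size is then chosen to make the displacements cost
     less than [t / 2]. *)
  have [m _ /(_ m (leqnn m)) hm] := near_infty_natSinv_lt (PosNum (divr_gt0 t0 (ltr0n R 4))).
  have m0 : 0 < m.+1%:R^-1 :> R by rewrite invr_gt0.
  have [u0 [_ piN]] := cell_nbhs_mem qd pi m0 m0.
  have N0 : 0 < t / 8 / ((size u0)%:R + 1) by rewrite !divr_gt0// ltr_wpDl.
  have [n _ /(_ n (leqnn n)) hn] := near_infty_natSinv_lt (PosNum N0).
  have n0 : 0 < n.+1%:R^-1 :> R by rewrite invr_gt0.
  have [u [Vpi]] := cell_nbhs_mem qd pi m0 n0.
  rewrite piN => -[/eqP]; rewrite eqr_nat => /eqP uu0.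
  exists (m, n, u) => // psi Vpsi; apply: tU => /=.
  apply: (le_lt_trans (cell_nbhs_dist qd m0 n0 Vpi Vpsi)).
  have {}hn : n.+1%:R^-1 * ((size u0)%:R + 1) < t / 8.
    by rewrite -ltr_pdivlMr ?ltr_wpDl.
  move: hm hn n0; rewrite /= -uu0.
  move: (n.+1%:R^-1) (m.+1%:R^-1) ((size u0)%:R : R) => b a c hm hn b0.
  nra.
rewrite bigcup_mkcond.
suff : @measurable _ (g_sigma_algebraType eval_sets)
  (\bigcup_i (if i \in [set i | V i `<=` U] then V i else set0)) by [].
apply: countable_bigcupT_measurable; first exact: countableP.
by move=> i; case: ifP => // _; exact: cell_nbhs_eval.
Qed.

Lemma measurable_eval (B : set N) : measurable B -> <<s eval_sets>> B.
Proof.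
apply: smallest_sub; first exact: smallest_sigma_algebra.
exact: dopen_eval.
Qed.

End eval_sigma_algebra.

(** * Closedness of the set of point measures with at most k points *)

Section at_most.
Context {dT dX : measure_display} {R : realType}.
Context {T : polishType dT R} {X : polishType dX R} {s : scaling X}.
Local Notation N := (point_measure T s).
Implicit Types (pi psi : N) (k : nat).

Lemma at_most_le k psi A : at_most k psi -> measurable A -> (psi A <= k%:R%:E)%E.
Proof.
move=> [z zk zE] mA; rewrite zE// sum_diracE lee_fin ler_nat.
exact: leq_trans (cnt_size _ _) zk.
Qed.

(** If every [away s e] has mass at most [k], then so has the whole space, by continuity from below
    and because the axis is null; the measure is then a sum of at most [k] unit masses. *)
Lemma not_at_most k pi : ~ at_most k pi ->
  exists2 e : R, 0 < e & (k.+1%:R%:E <= pi (away s e))%E.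
Proof.
move=> nk; apply: contrapT => h; apply: nk.
have le_k e : 0 < e -> (pi (away s e) <= k%:R%:E)%E.
  move=> e0; have [z [_ zE]] := pm_points pi e0.
  have mA := @measurable_away _ _ R T X s e.
  rewrite zE// lee_fin ler_nat leqNgt; apply/negP => kz.
  by apply: h; exists e => //; rewrite zE// lee_fin ler_nat.
have mF := @measurable_prod_axis _ _ R T X s.
have le_kT : (pi setT <= k%:R%:E)%E.
  have -> : setT = prod_axis s `|` \bigcup_n away (T := T) s n.+1%:R^-1.
    apply/esym/seteqP; split => // p _.
    have [/prod_axisP|p0] := eqVneq (level s p) 0; first by left.
    have lp : 0 < level s p by rewrite lt0r p0 level_ge0.
    have [n _ /(_ n (leqnn n)) hn] := near_infty_natSinv_lt (PosNum lp).
    by right; exists n => //; rewrite awayE /= ltW.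
  have mU : measurable (\bigcup_n away (T := T) s n.+1%:R^-1).
    by apply: bigcup_measurable => n _; exact: measurable_away.
  apply: (le_trans (measureU2 _ _ _)) => //.
  rewrite [X in (X + _)%E]pm_axis add0e.
  have cv : pi (away s n.+1%:R^-1) @[n --> \oo] -->
      pi (\bigcup_n away (T := T) s n.+1%:R^-1).
    apply: (nondecreasing_cvg_mu (F := fun n : nat => away (T := T) s n.+1%:R^-1)).
    - by move=> n; exact: measurable_away.
    - exact: mU.
    - move=> m n mn; apply/subsetPset; apply: sub_away.
      by rewrite lef_pV2 ?posrE// ler_nat.
  have cl : limn (fun n => pi (away s n.+1%:R^-1)) =
      pi (\bigcup_n away (T := T) s n.+1%:R^-1) by apply: cvg_lim => //; exact: cv.
  apply: (le_trans (_ : _ <= limn (fun n => pi (away s n.+1%:R^-1)))%E).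
    by rewrite cl.
  apply: lime_le; first by apply: cvgP; exact: cv.
  by apply: nearW => n; exact: le_k.
have [_ [I [z [_ pE]]]] := pm_prop pi.
have zT : pi setT = (\esum_(i in I) \d_i I)%E.
  by rewrite pE//; apply: eq_esum => i Ii; rewrite !diracE !mem_set.
have fI : finite_set I.
  apply: contrapT => /(infinite_card_dirac R) Ioo.
  by move: le_kT; rewrite zT Ioo.
exists (map z (finmap.enum_fset (fset_set I))).
  rewrite size_map -(ler_nat R) -lee_fin.
  by rewrite -(finite_card_dirac R fI) -zT.
move=> A mA; rewrite pE// esum_fset// fsbig_finite//= /sum_dirac big_map.
by [].
Qed.

Lemma dopen_not_at_most k : dopen (@pm_dist _ _ R T X s) (~` at_most k).
Proof.
move=> pi /not_at_most[e e0 he]; exists (e * expR (- e)).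
  by rewrite mulr_gt0// expR_gt0.
move=> psi /= ppsi kpsi; have mF := @measurable_prod_axis _ _ R T X s.
have := pm_dist_ge_count e0 he (at_most_le kpsi (measurableC mF)).
by rewrite leNgt ppsi.
Qed.

Lemma measurable_at_most k : measurable (at_most k : set N).
Proof.
rewrite -[X in measurable X]setCK; apply: measurableC; apply: sub_sigma_algebra.
exact: dopen_not_at_most.
Qed.

End at_most.

(** * Powers of a measure *)

Section sigma_finite_pack.
Context {d : measure_display} {E : measurableType d} {R : realType}.

Definition sigma_finite_pack (m : {measure set E -> \bar R})
    (h : sigma_finite setT m) : {sigma_finite_measure set E -> \bar R} :=
  HB.pack_for (SigmaFiniteMeasure.type E R) (Measure.sort m)
    (@isSFinite.Build _ _ _ (Measure.sort m) (sfinite_measure_sigma_finite h))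
    (@isSigmaFinite.Build _ _ _ (Measure.sort m) h).

Context {d' : measure_display} {E' : measurableType d'}.

Definition pushforward_pack (m : {measure set E -> \bar R}) (f : E -> E')
    (mf : measurable_fun setT f) : {measure set E' -> \bar R} :=
  measure_function_pushforward__canonical__measure_function_Measure m mf.

(* The canonical [\x] of finite measures shadows the sigma-finite one. *)
Lemma sigma_finite_product (m : {sigma_finite_measure set E -> \bar R})
    (m' : {sigma_finite_measure set E' -> \bar R}) :
  sigma_finite setT (m \x m')%E.
Proof.
have [F FT mF] := sigma_finiteT m; have [G GT mG] := sigma_finiteT m'.
pose c i : set (E * E') := if (unpickle i : option (nat * nat)) is Some (a, b)
  then F a `*` G b else set0.
exists c => [|i].
  apply/esym/seteqP; split=> // -[x y] _.
  have [a _ Fx] : (\bigcup_i F i) x by rewrite -FT.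
  have [b _ Gy] : (\bigcup_i G i) y by rewrite -GT.
  by exists (pickle (a, b)) => //; rewrite /c pickleK.
rewrite /c; case: unpickle => [[a b]|]; last by rewrite measure0.
have [mFa Fa] := mF a; have [mGb Gb] := mG b; split; first exact: measurableX.
by rewrite product_measure1E// lte_mul_pinfty// ge0_fin_numE.
Qed.

End sigma_finite_pack.

Section power_measure.
Context {d : measure_display} {E : measurableType d} {R : realType}.
Variable m : {sigma_finite_measure set E -> \bar R}.

Definition tcons n (p : E * n.-tuple E) : n.+1.-tuple E := [tuple of p.1 :: p.2].

Lemma measurable_tcons n : measurable_fun setT (@tcons n).
Proof.
exact: (@measurable_cons _ _ (E * n.-tuple E)%type E fst n snd
  measurable_fst measurable_snd).
Qed.

(** [power_measure] is a bare set function. As the image of a product measure under [tcons] it is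
    countably additive; it is sigma-finite because an exhausting sequence can be pulled back along
    the measurable left inverse of [tcons]. *)
Lemma power_measure_pack n :
  exists M : {sigma_finite_measure set (n.-tuple E) -> \bar R},
    forall A, M A = power_measure m A.
Proof.
elim: n => [|n [M IH]].
  by exists (\d_([tuple] : 0.-tuple E)).
have eqM A : pushforward (m \x M)%E (@tcons n) A = power_measure m A.
  rewrite /pushforward /product_measure1 /=; apply: eq_integral => x _ /=.
  by rewrite IH; congr (power_measure m _); apply/seteqP; split=> z; rewrite /xsection /= inE.
have sf : sigma_finite setT (pushforward_pack (m \x M)%E (@measurable_tcons n)).
  have [F FT mF] := sigma_finite_product m M.
  pose sp (t : n.+1.-tuple E) := (thead t, [tuple of behead t]).
  have msp : measurable_fun setT sp.
    apply/measurable_fun_pairP; split; first exact: measurable_tnth.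
    exact: measurable_behead.
  have spK p : sp (tcons p) = p.
    by case: p => x t; rewrite /sp /tcons /= theadE; congr pair; exact/val_inj.
  exists (fun i => sp @^-1` F i).
    by rewrite -preimage_bigcup -FT preimage_setT.
  move=> i; have [mFi Fi] := mF i; split.
    by rewrite -[X in measurable X]setTI; exact: msp.
  apply: le_lt_trans Fi; rewrite le_eqVlt; apply/orP; left; apply/eqP.
  rewrite /pushforward_pack /= /pushforward; congr ((m \x M)%E _).
  by apply/seteqP; split=> p /=; rewrite spK.
by exists (sigma_finite_pack sf) => A; exact: eqM.
Qed.

Lemma power_measure_integral_ge0 n (h : n.-tuple E -> \bar R) :
  (forall z, 0 <= h z)%E -> (0 <= \int[power_measure m (n := n)]_z h z)%E.
Proof.
move=> h0; have [M ME] := power_measure_pack n.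
have ME' : (M : set _ -> \bar R) = power_measure m (n := n) by exact/funext.
by rewrite -ME'; apply: integral_ge0.
Qed.

Lemma power_measure_integralS n (h : n.+1.-tuple E -> \bar R) :
  measurable_fun setT h -> (forall z, 0 <= h z)%E ->
  (\int[power_measure m (n := n.+1)]_z h z =
   \int[m]_x \int[power_measure m (n := n)]_z h [tuple of x :: z])%E.
Proof.
move=> mh h0; have [M ME] := power_measure_pack n.
have ME' : (M : set _ -> \bar R) = power_measure m (n := n) by exact/funext.
have -> : power_measure m (n := n.+1) = pushforward (m \x M)%E (@tcons n).
  apply/funext => A; rewrite /pushforward /product_measure1 /=.
  apply: eq_integral => x _ /=; rewrite ME; congr (power_measure m _).
  by apply/seteqP; split=> z; rewrite /xsection /= inE.
rewrite ge0_integral_pushforward//; last exact: measurable_tcons.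
rewrite preimage_setT fubini_tonelli1; last 2 first.
- exact: measurableT_comp (@measurable_tcons n).
- by move=> p; exact: h0.
by apply: eq_integral => x _; rewrite /fubini_F /= -[in RHS]ME'.
Qed.

Lemma power_measure_integral0 (h : 0.-tuple E -> \bar R) : (forall z, 0 <= h z)%E ->
  measurable_fun setT h ->
  (\int[power_measure m (n := 0)]_z h z = h [tuple])%E.
Proof. by move=> h0 mh; rewrite (integral_dirac _ measurableT)// diracT mul1e. Qed.

Lemma measurable_power_section n (h : n.+1.-tuple E -> \bar R) :
  measurable_fun setT h -> (forall z, 0 <= h z)%E ->
  measurable_fun setT (fun x =>
    \int[power_measure m (n := n)]_z h [tuple of x :: z])%E.
Proof.
move=> mh h0; have [M ME] := power_measure_pack n.
have ME' : (M : set _ -> \bar R) = power_measure m (n := n) by exact/funext.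
rewrite -ME'.
apply: (@measurable_fun_fubini_tonelli_F _ _ _ _ _ M (h \o @tcons n)).
  exact: measurableT_comp (@measurable_tcons n).
by move=> p; exact: h0.
Qed.

End power_measure.

(** * Poisson processes *)

Section multinomial.
Context {d : measure_display} {E : measurableType d} {R : realType}.
Variable m : {finite_measure set E -> \bar R}.
Context {J : finType}.
Variables (C : J -> set E).
Hypotheses (mC : forall b, measurable (C b)) (tC : trivIset setT C).

Let v b := fine (m (C b)).

Definition count_set n (c : J -> nat) : set (n.-tuple E) :=
  [set z | forall b, cnt (C b) z = c b].

Lemma measurable_cnt A n (k : nat) : measurable A ->
  measurable [set z : n.-tuple E | cnt A z = k].
Proof.
move=> mA.
have -> : [set z : n.-tuple E | cnt A z = k] =
    (fun z : n.-tuple E => \sum_(i < n) \1_A (tnth z i) : R) @^-1` [set k%:R].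
  apply/seteqP; split=> z /=; rewrite /cnt -sum1_count big_tuple big_mkcond /=.
    move=> <-; rewrite natr_sum; apply: eq_bigr => i _; rewrite indicE.
    by case: ifP.
  move=> /eqP; rewrite (_ : \sum_(i < n) _ =
      (\sum_(i < n) (if tnth z i \in A then 1 else 0))%N%:R).
    by rewrite eqr_nat -big_mkcond => /eqP.
  by rewrite natr_sum; apply: eq_bigr => i _; rewrite indicE; case: ifP.
rewrite -[X in measurable X]setTI; apply: measurable_sum => //= i.
by apply: measurableT_comp => //; exact: measurable_tnth.
Qed.

Lemma measurable_count_set n c : measurable (@count_set n c).
Proof.
have -> : @count_set n c = \bigcap_(b in [set: J]) [set z : n.-tuple E | cnt (C b) z = c b].
  by apply/seteqP; split=> z h b; [move=> _|]; exact: h.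
by apply: fin_bigcap_measurable => // b _; exact: measurable_cnt.
Qed.

Lemma sum_cnt_le (z : seq E) : (\sum_b cnt (C b) z <= size z)%N.
Proof.
elim: z => [|x z IH]; first by rewrite big1.
rewrite (eq_bigr (fun b => (x \in C b) + cnt (C b) z)%N)// big_split /=.
rewrite -add1n leq_add//.
have [[b Cb]|nC] := pselect (exists b, C b x); last first.
  by rewrite big1// => b _; rewrite memNset// => Cb; apply: nC; exists b.
rewrite (bigD1 b)//= big1 ?addn0 ?leq_b1// => b' b'b.
rewrite memNset// => Cb'; move/eqP: b'b; apply.
by apply: (@tC b' b) => //; exists x.
Qed.

(** Split according to the cell [b] of the first point: the other points realize [c] lowered by one
    at [b]. The term of [b] is [c b] times [n!] times the product, and the [c b] add up to
    [n.+1]. *)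
Lemma multinomial_measure n (c : J -> nat) : (\sum_b c b)%N = n ->
  power_measure m (@count_set n c) =
  (n`!%:R * \prod_b (v b ^+ c b / (c b)`!%:R))%:E.
Proof.
elim: n c => [|n IH] c cn.
  have c0 b : c b = 0%N.
    by apply/eqP; rewrite -leqn0 -cn (bigD1 b)//= leq_addr.
  rewrite /= diracE mem_set => [|b]; last by rewrite c0.
  by rewrite big1 ?mulr1// => b _; rewrite c0 expr0 divr1.
pose cm b b' := (c b' - (b' == b))%N.
have cmn b : (0 < c b)%N -> (\sum_b' cm b b')%N = n.
  move=> cb; apply/eqP; rewrite -eqSS -cn (bigD1 b)//= [X in _ == X](bigD1 b)//=.
  rewrite /cm eqxx -addSn subn1 prednK// eqn_add2l; apply/eqP.
  by apply: eq_bigr => b' /negPf ->; rewrite subn0.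
(* If [c b] is 0, the first point cannot lie in [C b]; the truncated subtraction in [cm] would not
   show this. *)
pose a b : R := if (0 < c b)%N then
  n`!%:R * \prod_b' (v b' ^+ cm b b' / (cm b b')`!%:R) else 0.
have v0 b : 0 <= v b by rewrite fine_ge0.
have a0 b : 0 <= a b.
  rewrite /a; case: ifP => // _; rewrite mulr_ge0// prodr_ge0// => b' _.
  by rewrite divr_ge0// exprn_ge0.
have -> : power_measure m (@count_set n.+1 c) = (\int[m]_x power_measure m
    [set z : n.-tuple E | @count_set n.+1 c [tuple of x :: z]])%E by [].
rewrite [LHS](_ : _ = \int[m]_x \sum_(b : J) (a b * \1_(C b) x)%:E)%E; last first.
  apply: eq_integral => x _.
  have [[b Cb]|nC] := pselect (exists b, C b x); last first.
    rewrite [X in power_measure m X](_ : _ = set0); last first.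
      apply/seteqP; split=> // z /= h; have := sum_cnt_le z.
      rewrite (eq_bigr c) => [|b _]; first by rewrite cn size_tuple ltnn.
      have /= := h b; rewrite /cnt /= memNset ?add0n// => Cb.
      by apply: nC; exists b.
    have [M ME] := power_measure_pack m n; rewrite -ME measure0 big1// => b _.
    by rewrite indicE memNset ?mulr0// => Cb; apply: nC; exists b.
  have Cb' b' : (x \in C b') = (b' == b).
    apply/idP/eqP => [|->]; rewrite inE// => Cb'.
    by apply: (@tC b' b) => //; exists x.
  rewrite (bigD1 b)//= big1 => [|b' b'b]; last by rewrite indicE Cb' (negPf b'b) mulr0.
  rewrite adde0 indicE Cb' eqxx mulr1 /a; case: ifP => cb.
    rewrite -IH ?cmn//; congr (power_measure m _); apply/seteqP; split=> z /= h b'.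
      by have /= := h b'; rewrite /cnt /= Cb' /cm => <-; rewrite addKn.
    by rewrite /cnt /= Cb' [X in (_ + X)%N](h b') /cm subnKC//; case: eqP => // ->.
  rewrite [X in power_measure m X](_ : _ = set0).
    by have [M ME] := power_measure_pack m n; rewrite -ME measure0.
  apply/seteqP; split=> // z /= h; have /= := h b.
  by rewrite /cnt /= Cb' eqxx; move/negbT: cb; rewrite lt0n negbK => /eqP ->.
rewrite ge0_integral_sum//; last 2 first.
- move=> b; apply/measurable_EFinP; apply: measurable_funM => //.
- by move=> b x _; rewrite lee_fin mulr_ge0.
rewrite (eq_bigr (fun b => (v b * a b)%:E)) => [|b _]; last first.
  under eq_integral do rewrite EFinM.
  rewrite ge0_integralZl_EFin//; last by apply/measurable_EFinP.
  by rewrite integral_indic// setIT [RHS]EFinM /v fineK ?fin_num_measure// muleC.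
rewrite sumEFin; congr EFin.
transitivity (\sum_b
    ((c b)%:R * (n`!%:R * \prod_b' (v b' ^+ c b' / (c b')`!%:R)))); last first.
  by rewrite -mulr_suml -natr_sum cn factS natrM mulrA.
apply: eq_bigr => b _; rewrite /a; case: ifPn => [cb|]; last first.
  by rewrite -eqn0Ngt => /eqP ->; rewrite mulr0 mul0r.
rewrite mulrCA [RHS]mulrCA; congr (_ * _).
rewrite (bigD1 b)//= [in RHS](bigD1 b)//= /cm eqxx subn1.
rewrite (eq_bigr (fun b' => v b' ^+ c b' / (c b')`!%:R)) => [|b' /negPf ->]; last first.
  by rewrite subn0.
rewrite !mulrA; congr (_ * _).
rewrite -[in RHS](prednK cb) factS exprS natrM.
have n0 : (c b).-1.+1%:R != 0 :> R by rewrite pnatr_eq0.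
have n1 : (c b).-1`!%:R != 0 :> R by rewrite pnatr_eq0 -lt0n fact_gt0.
move: ((c b).-1.+1%:R) n0 ((c b).-1`!%:R) n1 (v b * _) => x x0 y y0 w.
by rewrite invfM mulrACA mulfV// mul1r.
Qed.

End multinomial.
Arguments measurable_cnt {d E} R [A] n k.

Section poisson_pmf_bounds.
Context {R : realType}.

Lemma poisson_prob_point (t : R) k j : 0 <= t ->
  poisson_prob t k [set j] = (expR (- t) * (t ^+ j / j`!%:R))%:E.
Proof.
move=> t0; rewrite /poisson_prob; case: ifPn => [t1|].
  rewrite esum_set1 ?lee_fin ?poisson_pmf_ge0//.
  by rewrite /poisson_pmf t1 mulrC.
(* At rate 0 [poisson_prob] is by definition the Dirac mass at 0, which the formula reproduces
   because [0 ^+ 0 = 1]. *)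
rewrite -leNgt => t1; have -> : t = 0 by apply/eqP; rewrite eq_le t0 t1.
rewrite oppr0 expR0 mul1r diracE; case: j => [|j].
  by rewrite mem_set// expr0 divr1.
by rewrite memNset// expr0n /= mul0r.
Qed.

(** Shifting the index by [j] multiplies the Poisson weights by at most [t ^+ j], as [i!] is at most
    [(i + j)!], and the weights sum to 1. *)
Lemma poisson_prob_tail (t : R) k j : 0 <= t ->
  (poisson_prob t k [set i | (j <= i)%N] <= (t ^+ j)%:E)%E.
Proof.
move=> t0; rewrite /poisson_prob; case: ifPn => [t1|].
  have -> : [set i | (j <= i)%N] = addn^~ j @` setT.
    apply/seteqP; split=> [i /= ji|_ [i _ <-]] /=; last by rewrite leq_addl.
    by exists (i - j)%N => //; rewrite subnK.
  rewrite esum_image; last first.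
    by move=> a b _ _ /addIn.
  have : poisson_prob t k setT = 1%E by exact: probability_setT.
  rewrite /poisson_prob t1 -nneseries_esumT; last first.
    by move=> i; rewrite lee_fin poisson_pmf_ge0.
  move=> s1; apply: (@le_trans _ _
      (\esum_(i in setT) ((t ^+ j)%:E * (poisson_pmf t i)%:E))%E).
    apply: le_esum => i _; rewrite -EFinM lee_fin /poisson_pmf t1.
    rewrite mulrA ler_wpM2r ?expR_ge0// exprD mulrCA mulrA ler_wpM2l//.
      by rewrite mulr_ge0// exprn_ge0.
    rewrite lef_pV2 ?posrE ?ltr0n ?fact_gt0// ler_nat leq_fact//.
    exact: leq_addr.
  rewrite -nneseries_esumT; last first.
    by move=> i; rewrite -EFinM lee_fin mulr_ge0 ?exprn_ge0 ?poisson_pmf_ge0.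
  rewrite nneseriesZl ?s1 ?mule1// => i _.
  by rewrite lee_fin poisson_pmf_ge0.
rewrite -leNgt => t1; have -> : t = 0 by apply/eqP; rewrite eq_le t0 t1.
rewrite diracE expr0n; case: j => [|j]; first by rewrite lee_fin; case: (_ \in _).
by rewrite memNset.
Qed.

End poisson_pmf_bounds.

Lemma ge0_integral_mrestr {d : measure_display} {E : measurableType d}
    {R : realType} (m : {measure set E -> \bar R}) (D : set E)
    (mD : measurable D) (f : E -> \bar R) :
  measurable_fun setT f -> (forall x, 0 <= f x)%E ->
  (\int[mrestr m mD]_x f x = \int[m]_(x in D) f x)%E.
Proof.
move=> mf f0; rewrite (ge0_negligible_integral (mu := mrestr m mD)
  (measurableC mD) measurableT mf)//; last by rewrite /= /mrestr setICl measure0.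
rewrite setTD setCK; apply: eq_measure_integral => A mA AD.
by rewrite /= /mrestr setIidl.
Qed.

Section poisson_process.
Context {dT dX dO : measure_display} {R : realType}.
Context {T : polishType dT R} {X : polishType dX R} {s : scaling X}.
Context {O : measurableType dO} {P : probability O R}.
Local Notation E := (T * X)%type.
Local Notation N := (point_measure T s).
Variables (Lam : {finite_measure set E -> \bar R}) (Pi : O -> N).
Hypothesis PiP : poisson_process P Lam Pi.
Implicit Types (A : set E) (r : R).

Let mF := @measurable_prod_axis _ _ R T X s.

Lemma poisson_measurable A (j : nat) :
  measurable A -> measurable [set w | Pi w A = j%:R%:E].
Proof.
move=> mA; case: PiP => _ /(_ (A `\` prod_axis s)) h _.
have [||mPi _] := h; [exact: measurableD|by move=> p []|].
have -> : [set w | Pi w A = j%:R%:E] =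
    (fun w => Pi w (A `\` prod_axis s) : \bar R) @^-1` [set j%:R%:E].
  apply/seteqP; split=> w /=.
    rewrite (measureDI (Pi w) mA mF) [X in (_ + X)%E](_ : _ = 0%E) ?adde0//.
    by apply: (subset_measure0 _ _ _ (pm_axis (Pi w))) => //; exact: measurableI.
  rewrite (measureDI (Pi w) mA mF) [X in (_ + X)%E](_ : _ = 0%E) ?adde0//.
  by apply: (subset_measure0 _ _ _ (pm_axis (Pi w))) => //; exact: measurableI.
by rewrite -[X in measurable X]setTI; exact: mPi.
Qed.

Lemma poisson_point A (j : nat) : measurable A -> A `<=` ~` prod_axis s ->
  P [set w | Pi w A = j%:R%:E] =
  (expR (- fine (Lam A)) * (fine (Lam A) ^+ j / j`!%:R))%:E.
Proof.
move=> mA AF; case: PiP => _ /(_ A mA AF)[_ /(_ [set j]) h] _.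
rewrite -(poisson_prob_point 0 j) ?fine_ge0// -h; congr (P _).
by apply/seteqP; split=> w /= => [?|[i -> //]]; exists j.
Qed.

Lemma poisson_tail r (k : nat) : 0 < r ->
  (P [set w | (k%:R%:E <= Pi w (away s r))%E] <= (fine (Lam (away s r)) ^+ k)%:E)%E.
Proof.
move=> r0; have mA := @measurable_away _ _ R T X s r.
case: PiP => _ /(_ _ mA (away_axis r0 (@subset_refl _ _)))[_ h] _.
rewrite (_ : [set w | _] = [set w | exists2 j, [set j | (k <= j)%N] j &
    Pi w (away s r) = j%:R%:E]).
  by rewrite h; apply: poisson_prob_tail; rewrite fine_ge0.
apply/seteqP; split=> w /= => [|[j kj ->]]; last by rewrite lee_fin ler_nat.
have [z [_ zE]] := pm_points (Pi w) r0.
by rewrite zE// lee_fin ler_nat => kz; exists (cnt (away s r) z).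
Qed.

Lemma poisson_counts (J : finType) (C : J -> set E) (c : J -> nat) :
  (forall b, measurable (C b) /\ C b `<=` ~` prod_axis s) -> trivIset setT C ->
  P [set w | forall b, Pi w (C b) = (c b)%:R%:E] =
  (expR (- \sum_b fine (Lam (C b))) *
   \prod_b (fine (Lam (C b)) ^+ c b / (c b)`!%:R))%:E.
Proof.
move=> mC tC; case: (PiP) => _ _ ind.
pose e (i : 'I_#|J|) : J := enum_val i.
have h := ind #|J| (C \o e) (c \o e) (fun i => mC (e i)).
have -> : [set w | forall b, Pi w (C b) = (c b)%:R%:E] =
    \bigcap_i [set w | Pi w ((C \o e) i) = ((c \o e) i)%:R%:E].
  apply/seteqP; split=> w /= hw; first by move=> i _; exact: hw.
  by move=> b; have := hw (enum_rank b) I; rewrite /= /e enum_rankK.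
rewrite h; last first.
  by move=> i j _ _ [p [Ci Cj]]; apply: enum_val_inj; apply: tC => //; exists p.
rewrite -(big_enum_val (fun b => P [set w | Pi w (C b) = (c b)%:R%:E])) /=.
rewrite (eq_bigr (fun b => (expR (- fine (Lam (C b))) *
    (fine (Lam (C b)) ^+ c b / (c b)`!%:R))%:E)) => [|b _]; last first.
  by have [? ?] := mC b; exact: poisson_point.
rewrite -(big_morph EFin EFinM erefl) big_split/= -sumrN expR_sum.
by congr (_ * _)%:E; apply: eq_bigl => b; rewrite inE.
Qed.

Section conditional_law.
Variables (r : R) (r0 : 0 < r) (n : nat).
Let S := away (T := T) s r.
Let mS : measurable S := @measurable_away _ _ R T X s r.

Definition restr_law_set (B : set N) : set O :=
  [set w | Pi w S = n%:R%:E /\ B (pm_restr mS (Pi w))].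

Definition points_set (B : set N) : set (n.-tuple E) :=
  [set z | cnt S z = n /\ B (pm_seq s z)].

Let off A : A `<=` S -> A `<=` ~` prod_axis s. Proof. exact: away_axis r0. Qed.

Let restr_eval B : <<s @eval_sets _ _ R T X s>> B ->
  measurable [set w | B (pm_restr mS (Pi w))].
Proof.
apply: eval_measurable => A j mA; apply: poisson_measurable.
exact: measurableI.
Qed.

Let seq_eval B : <<s @eval_sets _ _ R T X s>> B ->
  measurable [set z : n.-tuple E | B (pm_seq s z)].
Proof.
apply: eval_measurable => A j mA.
rewrite (_ : [set w | _] = [set z : n.-tuple E | cnt (A `\` prod_axis s) z = j]).
  by apply: (measurable_cnt R); exact: measurableD.
apply/seteqP; split=> z /=; rewrite pm_seqE; last by move=> ->.
by case=> /eqP; rewrite eqr_nat => /eqP.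
Qed.

Lemma measurable_restr_law_set B : <<s @eval_sets _ _ R T X s>> B ->
  measurable (restr_law_set B).
Proof.
by move=> sB; apply: measurableI; [exact: poisson_measurable|exact: restr_eval].
Qed.

(* Finitely many test sets are refined to a partition of S, indexed by the sign
   patterns [b]; on it the counts of the process are independent Poisson
   variables and those of the points are multinomial. *)
Section pattern.
Variables (m : nat) (A : 'I_m -> set E) (j : 'I_m -> nat).
Hypothesis mA : forall i, measurable (A i).
Let J := {ffun 'I_m -> bool}.

Let pattern (p : E) : J := [ffun i => p \in A i].
Let C (b : J) : set E := S `&` [set p | pattern p = b].

Let mC b : measurable (C b).
Proof.
apply: measurableI => //.
have -> : [set p | pattern p = b] =
    \bigcap_(i in [set: 'I_m]) (if b i then A i else ~` A i).
  apply/seteqP; split=> p /=.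
    move=> <- i _; rewrite ffunE; case: ifPn; first by rewrite inE.
    by rewrite notin_setE.
  move=> h; apply/ffunP => i; rewrite ffunE; have := h i I.
  by case: (b i) => h'; [rewrite mem_set|rewrite memNset].
apply: fin_bigcap_measurable => // i _.
by case: (b i) => //; exact: measurableC.
Qed.

Let tC : trivIset setT C.
Proof. by move=> b b' _ _ [p [[_ /= <-] [_ /= <-]]]. Qed.

Let sum_pattern (Q : pred J) (z : seq E) :
  (\sum_(b | Q b) cnt (C b) z = cnt (S `&` [set p | Q (pattern p)]) z)%N.
Proof.
elim: z => [|x z IH]; first by rewrite big1.
rewrite /cnt /= -/(cnt _ z) -IH.
rewrite (eq_bigr (fun b => (x \in C b) + cnt (C b) z)%N)// big_split /=; congr addn.
have [xS|xS] := boolP (x \in S); last first.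
  rewrite in_setI (negPf xS) /= big1// => b _; by rewrite in_setI (negPf xS).
have xC b : (x \in C b) = (b == pattern x).
  by rewrite in_setI xS /=; apply/idP/eqP; rewrite inE.
rewrite in_setI xS /=; have [Qx|Qx] := boolP (Q (pattern x)).
  rewrite (bigD1 (pattern x))//= xC eqxx big1 ?addn0 ?mem_set// => b /andP[_ bx].
  by rewrite xC (negPf bx).
rewrite memNset ?big1//; last exact/negP.
by move=> b Qb; rewrite xC; case: eqP => // bx; move: Qx; rewrite -bx Qb.
Qed.

(** The vectors of cell counts compatible with the prescribed values. Entries bounded by [n] make
    the set finite, so that both events are finite disjoint unions over it. *)
Let D : set {ffun J -> 'I_n.+1} := [set c : {ffun J -> 'I_n.+1} |
  (\sum_b c b)%N = n /\
  forall i, (\sum_(b : J | b i) c b)%N = j i].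

Let eventP (z : seq E) : cnt S z = n ->
  ((forall i, cnt (A i `&` S) z = j i) <->
   exists2 c, D c & forall b, cnt (C b) z = c b).
Proof.
move=> zn.
have sumT : (\sum_b cnt (C b) z = n)%N.
  rewrite -zn (sum_pattern predT); congr (cnt _ z).
  by apply/seteqP; split=> p // [].
have sumA i : (\sum_(b : J | b i) cnt (C b) z = cnt (A i `&` S) z)%N.
  rewrite (sum_pattern (fun b : J => b i)); congr (cnt _ z).
  by apply/seteqP; split=> p [] /=; rewrite ffunE inE.
split=> [h|[c [_ Dc] hc] i]; last first.
  by rewrite -sumA -Dc; apply: eq_bigr => b _; rewrite hc.
have ltn b : (cnt (C b) z < n.+1)%N.
  by rewrite ltnS -zn; apply: sub_cnt => p [].
exists [ffun b => Ordinal (ltn b)]; last by move=> b; rewrite ffunE.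
split; first by apply: etrans sumT; apply: eq_bigr => b _; rewrite ffunE.
by move=> i; apply: etrans (h i); apply: etrans (sumA i); apply: eq_bigr => b _; rewrite ffunE.
Qed.

(** For one vector of cell counts, the Poisson probabilities multiply to [expR (- fine (Lam S))]
    times the product of the [v ^+ c / c!], which is the multinomial mass divided by [n!]. *)
Lemma restr_law_pattern :
  P (restr_law_set [set pi | forall i, pi (A i) = (j i)%:R%:E]) =
  ((expR (- fine (Lam S)) / n`!%:R)%:E *
   power_measure Lam (points_set [set pi | forall i, pi (A i) = (j i)%:R%:E]))%E.
Proof.
pose E_ (c : {ffun J -> 'I_n.+1}) := [set w | forall b, Pi w (C b) = (c b)%:R%:E].
pose V_ (c : {ffun J -> 'I_n.+1}) := @count_set _ E J C n (fun b => c b).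
have sumS (z : seq E) : (\sum_b cnt (C b) z = cnt S z)%N.
  by rewrite (sum_pattern predT); congr (cnt _ z); apply/seteqP; split=> p // [].
have CS b : C b `<=` S by exact: subIsetl.
have -> : restr_law_set [set pi | forall i, pi (A i) = (j i)%:R%:E] =
    \bigcup_(c in D) E_ c.
  apply/seteqP; split=> w.
    case=> /= wS wA; have [z [_ zE]] := pm_points (Pi w) r0.
    have zS : cnt S z = n.
      by move: wS; rewrite zE// => -[/eqP]; rewrite eqr_nat => /eqP.
    have [|c Dc hc] := (eventP zS).1.
      move=> i; have := wA i; rewrite pm_restrE zE; first by case=> /eqP; rewrite eqr_nat => /eqP.
        exact: measurableI.
      exact: subIsetr.
    by exists c => // b; rewrite zE ?hc//; exact: CS.
  case=> c Dc wc; have [z [_ zE]] := pm_points (Pi w) r0.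
  have hc b : cnt (C b) z = c b.
    by have := wc b; rewrite zE//; case=> /eqP; rewrite eqr_nat => /eqP.
  have zS : cnt S z = n.
    by rewrite -sumS -(proj1 Dc); apply: eq_bigr => b _; rewrite hc.
  split=> /=; first by rewrite zE// zS.
  move=> i; rewrite pm_restrE zE; [|exact: measurableI|exact: subIsetr].
  by rewrite (proj2 (eventP zS) _ i)//; exists c.
have -> : points_set [set pi | forall i, pi (A i) = (j i)%:R%:E] =
    \bigcup_(c in D) V_ c.
  have AS (z : n.-tuple E) B : cnt S z = n ->
      cnt (B `\` prod_axis s) z = cnt (B `&` S) z.
    move=> zS; have /allP zin : all (mem S) z by rewrite all_count -/(cnt S z) zS size_tuple.
    apply: eq_in_count => p /zin /= pS; rewrite in_setD in_setI pS andbT andb_idr// => _.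
    by rewrite inE in pS; rewrite notin_setE; exact: off pS.
  apply/seteqP; split=> z.
    case=> /= zS zA; have [|c Dc hc] := (eventP zS).1; last by exists c.
    move=> i; have := zA i; rewrite pm_seqE AS//.
    by case=> /eqP; rewrite eqr_nat => /eqP.
  case=> c Dc hc.
  have zS : cnt S z = n.
    by apply: etrans (esym (sumS z)) _; apply: etrans (proj1 Dc); apply: eq_bigr => b _; rewrite hc.
  split=> // i; rewrite pm_seqE AS//.
  by rewrite (proj2 (eventP zS) _ i)//; exists c.
have mE c : measurable (E_ c).
  have -> : E_ c = \bigcap_(b in [set: J]) [set w | Pi w (C b) = (c b)%:R%:E].
    by apply/seteqP; split=> w h b; [move=> _|]; exact: h.
  apply: fin_bigcap_measurable => [|b _]; first exact: finite_finset.
  exact: poisson_measurable.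
have mV c : measurable (V_ c) by exact: (measurable_count_set (R := R) mC).
have tE : trivIset D E_.
  move=> c c' _ _ [w [h h']]; apply/ffunP => b; apply: val_inj.
  by have := h b; rewrite (h' b) => -[/eqP]; rewrite eqr_nat => /eqP.
have tV : trivIset D V_.
  move=> c c' _ _ [z [h h']]; apply/ffunP => b; apply: val_inj.
  by rewrite /= -(h b) (h' b).
have fD : finite_set D by exact: finite_finset.
have [M ME] := power_measure_pack Lam n.
rewrite -ME !measure_fin_bigcup// ge0_mule_fsumr//.
apply: eq_fsbigr => c /set_mem Dc.
have MV := ME (V_ c); rewrite (multinomial_measure Lam mC tC (proj1 Dc)) in MV.
apply: (@etrans _ _ ((expR (- fine (Lam S)) / n`!%:R)%:E * M (V_ c))%E) => //.
have CF b : measurable (C b) /\ C b `<=` ~` prod_axis s.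
  by split=> //; apply: off; exact: CS.
apply: etrans (poisson_counts (fun b => c b) CF tC) _.
rewrite MV -EFinM.
have -> : \sum_b fine (Lam (C b)) = fine (Lam S).
  have -> : S = \bigcup_(b in [set: J]) C b.
    by apply/seteqP; split=> [p Sp|p [b _ []//]]; exists (pattern p).
  rewrite measure_fin_bigcup//; last exact: finite_finset.
  rewrite sum_fine => [|b _]; last exact: fin_num_measure.
  rewrite (fsbig_seq _ _ (index_enum_uniq J)); congr fine; apply: eq_fsbigl.
  by apply/seteqP; split=> b // _; exact: mem_index_enum.
congr EFin; rewrite -mulrA; congr (_ * _); rewrite mulrA mulVf ?mul1r//.
Qed.

End pattern.

(** Both sides are finite measures in [B]. They agree on the sets given by finitely many counts,
    which form a pi-system containing the whole space, the case of no test set. *)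
Lemma conditional_law B : <<s @eval_sets _ _ R T X s>> B ->
  P (restr_law_set B) =
  ((expR (- fine (Lam S)) / n`!%:R)%:E * power_measure Lam (points_set B))%E.
Proof.
move=> sB; pose GT := g_sigma_algebraType (@eval_sets _ _ R T X s).
have [M ME] := power_measure_pack Lam n.
have mO : measurable [set w | Pi w S = n%:R%:E] by exact: poisson_measurable.
have mZ : measurable [set z : n.-tuple E | cnt S z = n] by exact: (measurable_cnt R).
have mF1 : measurable_fun setT (fun w => pm_restr mS (Pi w) : GT).
  by move=> _ Y mY; rewrite setTI; exact: restr_eval.
have mF2 : measurable_fun setT (fun z : n.-tuple E => pm_seq s z : GT).
  by move=> _ Y mY; rewrite setTI; exact: seq_eval.
have c0 : 0 <= expR (- fine (Lam S)) / n`!%:R by rewrite divr_ge0// expR_ge0.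
pose m1 := pushforward_pack (mrestr P mO) mF1.
pose m2 := mscale (NngNum c0) (pushforward_pack (mrestr M mZ) mF2).
pose G : set (set GT) := [set C | exists m (A : 'I_m -> set E) (j : 'I_m -> nat),
  (forall i, measurable (A i)) /\ C = [set pi : N | forall i, pi (A i) = (j i)%:R%:E]].
have m1E C : m1 C = P (restr_law_set C).
  by congr (P _); apply/seteqP; split=> w [].
have m2E C : m2 C = ((expR (- fine (Lam S)) / n`!%:R)%:E *
    power_measure Lam (points_set C))%E.
  rewrite -ME /m2 /mscale /=; congr (_ * M _)%E.
  by apply/seteqP; split=> w [].
rewrite -m1E -m2E.
have sG : @measurable _ GT = <<s G>>.
  apply/seteqP; split; apply: smallest_sub; try exact: smallest_sigma_algebra.
    move=> _ [A [j [mA ->]]]; apply: sub_sigma_algebra.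
    exists 1%N, (fun=> A), (fun=> j); split=> //.
    by apply/seteqP; split=> pi //= /(_ ord0).
  move=> _ [m [A [j [mA ->]]]].
  have -> : [set pi : N | forall i, pi (A i) = (j i)%:R%:E] =
      \bigcap_(i in [set: 'I_m]) [set pi : N | pi (A i) = (j i)%:R%:E].
    by apply/seteqP; split=> pi h i; [move=> _|]; exact: h.
  apply: (@fin_bigcap_measurable _ GT) => // i _.
  by apply: sub_sigma_algebra; exists (A i), (j i).
apply: (measure_unique G (fun=> setT) sG) => //.
- move=> _ _ [m [A [j [mA ->]]]] [m' [A' [j' [mA' ->]]]].
  exists (m + m')%N, (fun i => match fintype.split i with inl a => A a | inr b => A' b end),
    (fun i => match fintype.split i with inl a => j a | inr b => j' b end).
  split; first by move=> i; case: (fintype.split i).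
  apply/seteqP; split=> pi /=.
    by move=> [h h'] i; case: (fintype.split i).
  move=> h; split=> i.
    by have := h (lshift m' i); rewrite (unsplitK (inl i)).
  by have := h (rshift m i); rewrite (unsplitK (inr i)).
- move=> _; exists 0%N, (fun=> set0), (fun=> 0%N); split=> //.
  by apply/seteqP; split=> // pi _ [].
- by rewrite bigcup_const//; exists 0%N.
- move=> _ [m [A [j [mA ->]]]]; apply: etrans (m1E _) _.
  by rewrite restr_law_pattern//; exact/esym/m2E.
- move=> _; rewrite m1E (le_lt_trans (probability_le1 _ _)) ?ltry//.
  by apply: measurable_restr_law_set; exact: (@measurableT _ GT).
Qed.

Lemma conditional_expectation (f : N -> R) : (forall pi, 0 <= f pi) ->
  measurable_fun setT f ->
  (\int[P]_(w in [set w | Pi w S = n%:R%:E]) (f (pm_restr mS (Pi w)))%:E =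
   (expR (- fine (Lam S)) / n`!%:R)%:E *
   \int[power_measure Lam (n := n)]_(z in [set z | cnt S z = n]) (f (pm_seq s z))%:E)%E.
Proof.
move=> f0 mf; have [M ME] := power_measure_pack Lam n.
have ME' : (M : set _ -> \bar R) = power_measure Lam (n := n) by exact/funext.
rewrite -[in RHS]ME'.
have mO : measurable [set w | Pi w S = n%:R%:E] by exact: poisson_measurable.
have mZ : measurable [set z : n.-tuple E | cnt S z = n] by exact: (measurable_cnt R).
have mF1 : measurable_fun setT (fun w => pm_restr mS (Pi w) : N).
  by move=> _ Y mY; rewrite setTI; apply: restr_eval; exact: measurable_eval.
have mF2 : measurable_fun setT (fun z : n.-tuple E => pm_seq s z : N).
  by move=> _ Y mY; rewrite setTI; apply: seq_eval; exact: measurable_eval.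
have c0 : 0 <= expR (- fine (Lam S)) / n`!%:R by rewrite divr_ge0// expR_ge0.
pose m1 := pushforward_pack (mrestr P mO) mF1.
pose m2 := mscale (NngNum c0) (pushforward_pack (mrestr M mZ) mF2).
have mEf : measurable_fun setT (EFin \o f) by exact/measurable_EFinP.
transitivity (\int[m1]_pi (f pi)%:E)%E.
  rewrite ge0_integral_pushforward//; last by move=> pi _; rewrite lee_fin.
  rewrite preimage_setT ge0_integral_mrestr//; last by move=> w; rewrite lee_fin.
  exact: measurableT_comp mEf mF1.
transitivity (\int[m2]_pi (f pi)%:E)%E.
  apply: eq_measure_integral => B mB _.
  transitivity (P (restr_law_set B)).
    by congr (P _); apply/seteqP; split=> w [].
  rewrite conditional_law; last exact: measurable_eval.
  rewrite -ME /m2 /mscale /=; congr (_ * M _)%E.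
  by apply/seteqP; split=> w [].
rewrite ge0_integral_mscale//; last by move=> pi _; rewrite lee_fin.
congr (_ * _)%E; rewrite ge0_integral_pushforward//; last first.
  by move=> pi _; rewrite lee_fin.
rewrite preimage_setT ge0_integral_mrestr//; last by move=> w; rewrite lee_fin.
exact: measurableT_comp mEf mF2.
Qed.

End conditional_law.

Lemma poisson_process_scale (u : {posnum R}) :
  poisson_process P (pushforward Lam (prod_act s u%:num : E -> E))
    (fun w => pm_scale u (Pi w)).
Proof.
have mact A : measurable A -> measurable (prod_act s u%:num @^-1` A).
  by move=> mA; rewrite -[X in measurable X]setTI; exact: measurable_prod_act.
have actF A : A `<=` ~` prod_axis s -> prod_act s u%:num @^-1` A `<=` ~` prod_axis s.
  by move=> AF p /AF /= h [_ /= ps]; apply: h; split=> //=; rewrite ps act_origin.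
split=> [|A mA AF|n A j mA tA].
- move=> _ B mB; rewrite setTI; apply: (eval_measurable _ (measurable_eval mB)).
  move=> A j mA; exact: (poisson_measurable j (mact _ mA)).
- by case: PiP => _ /(_ _ (mact _ mA) (actF _ AF)) h _; exact: h.
- case: PiP => _ _ /(_ n (fun i => prod_act s u%:num @^-1` A i) j); apply.
    by move=> i; have [mAi AiF] := mA i; split; [exact: mact|exact: actF].
  by move=> a b _ _ [p [ap bp]]; apply: tA => //; exists (prod_act s u%:num p).
Qed.

End poisson_process.

(** * Uniform convergence over Lipschitz classes *)

(** The two bounds force [u n] to be finite, so that estimates can be carried out in the extended
    reals without finiteness conditions. *)
Lemma cvge_le_addP {R : realType} (u : nat -> \bar R) (l : R) :
  (u n @[n --> \oo] --> l%:E) <-> forall e, 0 < e ->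
    \forall n \near \oo, (u n <= l%:E + e%:E /\ l%:E <= u n + e%:E)%E.
Proof.
split=> [/fine_cvgP[ufin ul] e e0|h].
  have /cvgrPdist_le/(_ e e0) ule := ul.
  near=> n.
  have un : u n \is a fin_num by near: n.
  have : `|l - fine (u n)| <= e by near: n.
  rewrite -(fineK un) -!EFinD !lee_fin /= ler_norml => /andP[? ?].
  by split; lra.
apply/fine_cvgP; split.
  have := h 1 ltr01; apply: filterS => n; case: (u n) => [x|[]//|[_]] //.
apply/cvgrPdist_le => e e0; have := h e e0; apply: filterS => n /=.
case: (u n) => [x|[]//|[_]] //=; rewrite -!EFinD !lee_fin => -[? ?].
by rewrite ler_norml; apply/andP; split; lra.
Unshelve. all: by end_near.
Qed.

Section uniform_convergence.
Context {disp : measure_display} {S : measurableType disp} {R : realType}.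
Variables (d : S -> S -> R) (C : set S).
Hypotheses (dP : pseudometric d) (dB : dopen d `<=` measurable)
  (mC : measurable C).
Variable q : nat -> S.
Hypothesis qd : forall x e, 0 < e -> exists i, d x (q i) < e.

(** Equal to 1 within distance [e / 2] of [q j] and to 0 beyond distance [e]. *)
Let bump (e : R) j x := Num.min 1 (Num.max 0 (2 - 2 / e * d x (q j))).

Let bump_lip e j : 0 < e -> lip d (2 / e) (bump e j).
Proof.
move=> e0 x y; have c0 : 0 <= 2 / e by rewrite divr_ge0// ltW.
have xy : 2 / e * `|d x (q j) - d y (q j)| <= 2 / e * d x y.
  rewrite ler_wpM2l// ler_norml; apply/andP; split.
    by rewrite lerNl opprB lerBlDr (pseudometricC dP x) (pseudometric_triangle dP).
  by rewrite lerBlDr (pseudometric_triangle dP).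
apply: le_trans xy; rewrite -[X in X * _](ger0_norm c0) -normrM mulrBr.
rewrite /bump; move: (_ * d x _) (_ * d y _) => u v.
have := ler_norm (u - v); have := ler_norm (v - u); rewrite distrC.
move: `|u - v| => n; rewrite ler_norml !minEle !maxEle; clear.
by do !case: ifPn; rewrite -?ltNge => *; apply/andP; split; lra.
Qed.

(* The increments of [unity e] are a partition of unity whose j-th term is
   supported in the e-ball around [q j]. *)
Fixpoint unity (e : R) j x : R :=
  if j is j'.+1 then Num.max (unity e j' x) (bump e j' x) else 0.

Let bump_ge0 e j x : 0 <= bump e j x.
Proof. by rewrite /bump le_min ler01 le_max lexx. Qed.

Let bump_le1 e j x : bump e j x <= 1.
Proof. by rewrite /bump ge_min lexx. Qed.

Let unity_ge0 e j x : 0 <= unity e j x.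
Proof. by elim: j => //= j IH; rewrite le_max IH. Qed.

Let unity_le1 e j x : unity e j x <= 1.
Proof. by elim: j => //= j IH; rewrite ge_max IH bump_le1. Qed.

Let unity_mono e j x : unity e j x <= unity e j.+1 x.
Proof. by rewrite /= le_max lexx. Qed.

Let unity_step e j x : 0 < e -> unity e j x < unity e j.+1 x -> d x (q j) < e.
Proof.
move=> e0; rewrite /= lt_max ltxx /= => h.
have : 0 < bump e j x by apply: le_lt_trans h.
rewrite /bump lt_min ltr01 lt_max ltxx /= subr_gt0 mulrAC.
by rewrite ltr_pdivrMr// ltr_pM2l.
Qed.

Let unity_cvg e x : 0 < e -> \forall j \near \oo, unity e j x = 1.
Proof.
move=> e0; have [i di] := qd x (divr_gt0 e0 (ltr0n R 2)).
exists i.+1 => // j /= ij; apply/eqP; rewrite eq_le unity_le1 /=.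
have -> : j = (j - i.+1 + i.+1)%N by rewrite subnK.
elim: (j - i.+1)%N => [|n IH]; last by rewrite (le_trans IH).
rewrite add0n /= le_max; apply/orP; right; rewrite /bump le_min lexx le_max.
apply/orP; right; rewrite lerBrDr -lerBrDl mulrAC ler_pdivrMr//; lra.
Qed.

Let unity_lip e j : 0 < e -> lip d (2 / e) (unity e j).
Proof.
move=> e0; elim: j => [|j IH] x y /=.
  by rewrite subrr normr0 mulr_ge0 ?divr_ge0 ?(pseudometric_ge0 dP)// ltW.
have := IH x y; have := bump_lip j e0 x y; rewrite !ler_norml => /andP[? ?] /andP[? ?].
by rewrite !maxEle; do !case: ifPn; rewrite -?ltNge => *; apply/andP; split; lra.
Qed.

Definition lip_class (M L r : R) (f : S -> R) :=
  [/\ forall x, 0 <= f x <= M, lip d L f & forall x, thicken d C r x -> f x = 0].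

Local Notation int m f := (\int[m]_(x in ~` C) (f x)%:E)%E.

Let mCC : measurable (~` C). Proof. exact: measurableC. Qed.

Section approximation.
Variables (M L r e : R) (r0 : 0 < r) (e0 : 0 < e) (g : S -> R).
Hypotheses (g01 : forall x, 0 <= g x <= 1) (mg : measurable_fun setT g)
  (g1 : forall x, ~ thicken d C r x -> g x = 1).

Let phi j x := g x * (unity e j.+1 x - unity e j x).
Let rest k x := g x * (1 - unity e k x).

Let phi_ge0 j x : 0 <= phi j x.
Proof. by rewrite mulr_ge0 ?subr_ge0//; case/andP: (g01 x). Qed.

Let rest_ge0 k x : 0 <= rest k x.
Proof. by rewrite mulr_ge0 ?subr_ge0//; case/andP: (g01 x). Qed.

Let munity j : measurable_fun setT (unity e j).
Proof.
apply: (dcontinuous_measurable dB); apply: (lip_dcontinuous dP (L := 2 / e)).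
exact: unity_lip.
Qed.

Let mphi j : measurable_fun setT (phi j).
Proof. by apply: measurable_funM => //; exact: measurable_funB. Qed.

Let mrest k : measurable_fun setT (rest k).
Proof. by apply: measurable_funM => //; exact: measurable_funB. Qed.

Let sum_phi k x : \sum_(j < k) phi j x = g x * unity e k x.
Proof.
elim: k => [|k IH]; first by rewrite big_ord0 mulr0.
by rewrite big_ord_recr /= IH /phi -mulrDr addrC subrK.
Qed.

(** Where [phi j] is nonzero, [f] differs from [f (q j)] by at most [L * e]. So [f] is a combination
    of k fixed functions with coefficients in [0, M], up to [L * e * g] and the tail [M * rest k].
    The error does not depend on [f]: [L * e * K] for each measure, [k%:R * M * e1] for the fixed
    functions, and [M * e2] for the tail, which is only needed under [m1] because dropping it under
    [m2] goes in the right direction. *)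
Lemma lip_class_approx (m1 m2 : {measure set S -> \bar R}) (k : nat) (K e1 e2 : R) :
  0 <= e1 -> 0 <= e2 -> 0 <= K ->
  (forall j : 'I_k, int m1 (phi j) <= int m2 (phi j) + e1%:E)%E ->
  (int m1 g <= K%:E)%E -> (int m2 g <= K%:E)%E -> (int m1 (rest k) <= e2%:E)%E ->
  forall f, 0 <= L -> lip_class M L r f ->
  (int m1 f <= int m2 f + (2 * L * e * K + k%:R * M * e1 + M * e2)%:E)%E.
Proof.
move=> e10 e20 K0 h1 gK1 gK2 h2 f L0 [fM fL fr].
have f0 x : 0 <= f x by case/andP: (fM x).
have fM' x : f x <= M by case/andP: (fM x).
have M0 : 0 <= M by exact: le_trans (f0 point) (fM' point).
have g0 x : 0 <= g x by case/andP: (g01 x).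
have Le0 : 0 <= L * e by rewrite mulr_ge0// ltW.
have mf := dcontinuous_measurable dB (lip_dcontinuous dP fL).
have fg x : f x = f x * g x.
  have [/fr ->|/g1 ->] := pselect (thicken d C r x); by rewrite ?mul0r ?mulr1.
pose sm x := \sum_(j < k) f (q j) * phi j x.
have sm0 x : 0 <= sm x by apply: sumr_ge0 => j _; rewrite mulr_ge0.
have close j x : `|f x * phi j x - f (q j) * phi j x| <= L * e * phi j x.
  rewrite -mulrBl normrM [X in _ * X]ger0_norm//.
  have := unity_mono e j x; rewrite le_eqVlt => /orP[/eqP uE|/unity_step h].
    by rewrite /phi uE subrr mulr0 !mulr0.
  rewrite ler_wpM2r// (le_trans (fL _ _))// ler_wpM2l// ltW//.
  exact: h.
have fsum x : f x = \sum_(j < k) f x * phi j x + f x * rest k x.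
  by rewrite -mulr_sumr sum_phi /rest -mulrDr -mulrDr [unity _ _ _ + _]addrC subrK mulr1 -fg.
have sum_le_g x : \sum_(j < k) L * e * phi j x <= L * e * g x.
  by rewrite -mulr_sumr ler_wpM2l// sum_phi ler_piMr.
have up x : f x <= sm x + L * e * g x + M * rest k x.
  rewrite {1}fsum lerD ?ler_wpM2r// (le_trans _ (lerD (lexx _) (sum_le_g x)))//.
  rewrite -big_split /=; apply: ler_sum => j _.
  by have := close j x; rewrite ler_norml lerBlDl => /andP[].
have down x : sm x <= f x + L * e * g x.
  rewrite fsum addrAC (le_trans _ (_ : \sum_(j < k) f x * phi j x + L * e * g x <= _))//.
    rewrite (le_trans _ (lerD (lexx _) (sum_le_g x)))//.
    rewrite -big_split /=; apply: ler_sum => j _.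
    by have := close j x; rewrite distrC ler_norml lerBlDl => /andP[].
  by rewrite lerDl mulr_ge0.
have msm : measurable_fun setT sm.
  by apply: measurable_sum => j; apply: measurable_funM => //; exact: measurable_cst.
have intZ (m' : {measure set S -> \bar R}) c (h : S -> R) : 0 <= c -> (forall x, 0 <= h x) ->
    measurable_fun setT h -> int m' (fun x => c * h x)%R = (c%:E * int m' h)%E.
  move=> c0 h0 mh; under eq_integral do rewrite EFinM.
  by rewrite ge0_integralZl_EFin//; [move=> x _; rewrite lee_fin|
    apply/measurable_EFinP/measurable_funTS].
have intD (m' : {measure set S -> \bar R}) (h h' : S -> R) : (forall x, 0 <= h x) ->
    (forall x, 0 <= h' x) -> measurable_fun setT h -> measurable_fun setT h' ->
    int m' (fun x => h x + h' x)%R = (int m' h + int m' h')%E.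
  move=> h0 h0' mh mh'; under eq_integral do rewrite EFinD.
  by rewrite ge0_integralD//; try (by move=> x _; rewrite lee_fin);
    apply/measurable_EFinP/measurable_funTS.
have intle (m' : {measure set S -> \bar R}) (h h' : S -> R) : (forall x, 0 <= h x) ->
    (forall x, h x <= h' x) -> measurable_fun setT h -> measurable_fun setT h' ->
    (int m' h <= int m' h')%E.
  move=> h0 hh mh mh'; apply: ge0_le_integral => //.
  - by move=> x _; rewrite lee_fin.
  - by apply/measurable_EFinP/measurable_funTS.
  - by apply/measurable_EFinP/measurable_funTS.
  - by move=> x _; rewrite lee_fin.
have intsm (m' : {measure set S -> \bar R}) :
    int m' sm = (\sum_(j < k) (f (q j))%:E * int m' (phi j))%E.
  rewrite /sm; under eq_integral do rewrite -sumEFin.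
  rewrite ge0_integral_sum//; last 2 first.
  - move=> j; apply/measurable_EFinP/measurable_funTS; apply: measurable_funM => //.
  - by move=> j x _; rewrite lee_fin mulr_ge0.
  by apply: eq_bigr => j _; exact: intZ.
have mLg : measurable_fun setT (fun x => L * e * g x) by exact: measurable_funM.
have mMr : measurable_fun setT (fun x => M * rest k x) by exact: measurable_funM.
have Lg0 x : 0 <= L * e * g x by rewrite mulr_ge0.
have Mr0 x : 0 <= M * rest k x by rewrite mulr_ge0.
have smD : (int m1 sm <= int m2 sm + (k%:R * M * e1)%:E)%E.
  rewrite !intsm.
  apply: (@le_trans _ _ (\sum_(j < k) ((f (q j))%:E * int m2 (phi j) + (M * e1)%:E))%E).
    apply: lee_sum => j _.
    apply: (@le_trans _ _ ((f (q j))%:E * (int m2 (phi j) + e1%:E))%E).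
      by rewrite lee_wpmul2l ?lee_fin.
    rewrite ge0_muleDr ?lee_fin//; last first.
      by apply: integral_ge0 => x _; rewrite lee_fin.
    by rewrite leeD2l// -EFinM lee_fin ler_wpM2r.
  rewrite big_split /= leeD2l// sumEFin lee_fin sumr_const card_ord.
  by rewrite -mulrA mulr_natl.
have I1 : (int m1 f <= int m1 sm + (L * e * K)%:E + (M * e2)%:E)%E.
  apply: (le_trans (intle m1 _ _ f0 up mf _)).
    by apply: measurable_funD => //; exact: measurable_funD.
  rewrite intD//; [|by move=> x; rewrite addr_ge0|exact: measurable_funD].
  rewrite intD//; rewrite !intZ//.
  apply: leeD; last by rewrite EFinM lee_wpmul2l ?lee_fin.
  by rewrite leeD2l// [(L * e * K)%:E]EFinM lee_wpmul2l ?lee_fin.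
have I2 : (int m2 sm <= int m2 f + (L * e * K)%:E)%E.
  apply: (le_trans (intle m2 _ _ sm0 down msm _)); first exact: measurable_funD.
  by rewrite intD// intZ// leeD2l// [(L * e * K)%:E]EFinM lee_wpmul2l ?lee_fin.
apply: (le_trans I1).
apply: (@le_trans _ _ (int m2 f + (L * e * K)%:E + (k%:R * M * e1)%:E +
    (L * e * K)%:E + (M * e2)%:E)%E).
  by rewrite !leeD2r// (le_trans smD)// leeD2r.
rewrite (_ : 2 * L * e * K = L * e * K + L * e * K); last by ring.
rewrite !EFinD !addeA; move: (L * e * K) (k%:R * M * e1) (M * e2) => u v w.
by rewrite (addeAC _ v%:E u%:E).
Qed.

End approximation.

Let dcontinuous_mul f g : (forall x, `|f x| <= 1) -> (forall x, `|g x| <= 1) ->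
  dcontinuous d f -> dcontinuous d g -> dcontinuous d (fun x => f x * g x).
Proof.
move=> f1 g1 cf cg x e e0; have e20 : 0 < e / 2 by rewrite divr_gt0.
have [r r0 fr] := cf x _ e20; have [t t0 gt] := cg x _ e20.
exists (Num.min r t) => [|y]; first by rewrite lt_min r0.
rewrite lt_min => /andP[/fr fxy /gt gxy] /=.
have -> : f x * g x - f y * g y = f x * (g x - g y) + (f x - f y) * g y by lra.
rewrite (le_lt_trans (ler_normD _ _))// !normrM (splitr e) addrC ltrD//.
  by rewrite (le_lt_trans _ fxy)// ler_piMr.
by rewrite (le_lt_trans _ gxy)// ler_piMl.
Qed.

(** The mesh [e] is chosen first, to make the discretization error small; then [k], by dominated
    convergence, to make the tail small under the limit. What remains is convergence for the
    finitely many test functions [phi j], [g] and [rest k], which are independent of [f]; the last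
    one transfers smallness of the tail to [m_ n]. *)
Lemma cvg_uniform_lip (m_ : nat -> {measure set S -> \bar R})
    (m : {measure set S -> \bar R}) : in_M d C m -> cvg_M d C (fun n => m_ n) m ->
  forall M L r eps, 0 <= M -> 0 <= L -> 0 < r -> 0 < eps ->
  \forall n \near \oo, forall f, lip_class M L r f ->
    (int (m_ n) f <= int m f + eps%:E /\ int m f <= int (m_ n) f + eps%:E)%E.
Proof.
move=> mM mcvg M L r eps M0 L0 r0 eps0.
have [g [g01 gL gr2 gr]] := lip_cutoff dP C r0.
have r20 : 0 < r / 2 by rewrite divr_gt0.
have cg := lip_dcontinuous dP gL; have mg := dcontinuous_measurable dB cg.
have g0 x : 0 <= g x by case/andP: (g01 x).
have g1 x : `|g x| <= 1 by rewrite ger0_norm//; case/andP: (g01 x).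
have Ifin h : (forall x, 0 <= h x <= g x) -> measurable_fun setT h ->
    int m h \is a fin_num.
  move=> hg mh; rewrite ge0_fin_numE; last first.
    by apply: integral_ge0 => x _; rewrite lee_fin; case/andP: (hg x).
  apply: (integral_vanish_lty dP dB mC mM r20 (M := 1) _ mh).
    by move=> x; have /andP[-> /le_trans -> //] := hg x; case/andP: (g01 x).
  move=> x Cx; have := hg x; rewrite gr2// => /andP[h0 h0'].
  by apply/eqP; rewrite eq_le h0' h0.
have near_le h e : (forall x, 0 <= h x <= g x) -> dcontinuous d h -> 0 < e ->
    \forall n \near \oo, (int (m_ n) h <= int m h + e%:E /\
      int m h <= int (m_ n) h + e%:E)%E.
  move=> hg ch e0; have hfin := Ifin _ hg (dcontinuous_measurable dB ch).
  suff cv : (int (m_ n) h @[n --> \oo] --> (fine (int m h))%:E)%E.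
    by have := (cvge_le_addP _ _).1 cv e e0; rewrite fineK.
  rewrite fineK//; apply: mcvg; split => //.
    exists 1 => x; have /andP[h0 h1] := hg x.
    by rewrite ger0_norm// (le_trans h1)//; case/andP: (g01 x).
  exists (r / 2) => // x Cx; have := hg x; rewrite gr2// => /andP[h0 h0'].
  by apply/eqP; rewrite eq_le h0' h0.
have gfin : int m g \is a fin_num by apply: Ifin => // x; rewrite g0 lexx.
(* The extra 1 makes [K] bound the integral of [g] under [m_ n] too, for large [n]. *)
pose K := fine (int m g) + 1.
have K0 : 0 <= K.
  by rewrite addr_ge0// fine_ge0//; apply: integral_ge0 => x _; rewrite lee_fin.
have mgK : (int m g <= K%:E)%E by rewrite -(fineK gfin) lee_fin /K lerDl.
have LK0 : 0 < 6 * L * K + 1 by rewrite ltr_wpDl// !mulr_ge0.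
(* Chosen so that the discretization error [2 * L * e * K] is at most [eps / 3]; the added 1 covers
   the case where [L] is 0. *)
pose e := eps / (6 * L * K + 1).
have e0 : 0 < e by rewrite divr_gt0.
have LKe : 2 * L * e * K <= eps / 3.
  have : e * (6 * L * K + 1) = eps by rewrite divfK// gt_eqF.
  by move: e0; move: (L * K) => ?; nra.
have cu j : dcontinuous d (unity e j).
  by apply: (lip_dcontinuous dP (L := 2 / e)); exact: unity_lip.
have M10 : 0 < M + 1 by rewrite ltr_wpDl.
pose e2 := eps / 3 / (M + 1).
have e20 : 0 < e2 by rewrite !divr_gt0.
have Me2 : M * e2 <= eps / 3.
  by rewrite mulrCA ler_piMr ?divr_ge0 ?(ltW eps0)// ler_pdivrMr// mul1r lerDl.
pose rest k x := g x * (1 - unity e k x).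
have restg k x : 0 <= rest k x <= g x.
  by rewrite mulr_ge0 ?subr_ge0// ler_piMr// lerBlDr lerDl.
have crest k : dcontinuous d (rest k).
  apply: dcontinuous_mul => // [x|]; first by rewrite ger0_norm ?subr_ge0// lerBlDr lerDl.
  move=> x t t0; have [a a0 h] := cu k x t t0.
  by exists a => // y /h; rewrite distrC opprD opprK addrACA subrr add0r addrC.
have [k hk] : exists k, (int m (rest k) <= (e2 / 2)%:E)%E.
  have cv : (int m (rest k) @[k --> \oo] --> int m (fun=> 0))%E.
    apply: (@dominated_cvg _ _ _ _ _ mCC _ _ (fun x => (g x)%:E)).
    - move=> k; apply/measurable_EFinP/measurable_funTS.
      exact: (dcontinuous_measurable dB (crest k)).
    - move=> x _; apply: cvg_near_cst.
      by apply: filterS (unity_cvg x e0) => k; rewrite /rest => ->; rewrite subrr mulr0.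
    - by [].
    - apply/integrableP; split; first exact/measurable_EFinP/measurable_funTS.
      rewrite (eq_integral (fun x => (g x)%:E)) => [|x _]; last by rewrite /= ger0_norm.
      by rewrite -ge0_fin_numE//; apply: integral_ge0 => x _; rewrite lee_fin.
    - move=> k x _; have /andP[h0 h1] := restg k x.
      by rewrite /= lee_fin ger0_norm.
  rewrite integral0 in cv.
  have [k _ /(_ k (leqnn k))[]] := (cvge_le_addP _ _).1 cv (e2 / 2) (divr_gt0 e20 (ltr0n R 2)).
  by rewrite add0e => hk _; exists k.
have k10 : 0 < k%:R * M + 1 by rewrite ltr_wpDl// mulr_ge0.
pose e1 := eps / 3 / (k%:R * M + 1).
have e10 : 0 < e1 by rewrite !divr_gt0.
have ke1 : k%:R * M * e1 <= eps / 3.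
  by rewrite mulrCA ler_piMr ?divr_ge0 ?(ltW eps0)// ler_pdivrMr// mul1r lerDl.
pose phi j x := g x * (unity e j.+1 x - unity e j x).
have phig j x : 0 <= phi j x <= g x.
  rewrite mulr_ge0 ?subr_ge0// ler_piMr// lerBlDr (le_trans (unity_le1 _ _ _))//.
  by rewrite lerDl.
have cphi j : dcontinuous d (phi j).
  apply: dcontinuous_mul => // [x|].
    rewrite ger0_norm ?subr_ge0// lerBlDr (le_trans (unity_le1 _ _ _))//.
    by rewrite lerDl.
  rewrite (_ : (fun x => _) = unity e j.+1 \+ (fun x => -1 * unity e j x)).
    by apply: dcontinuousD => //; exact: dcontinuousM.
  by apply/funext => x /=; rewrite mulN1r.
have nphi : \forall n \near \oo, forall j : 'I_k,
    (int (m_ n) (phi j) <= int m (phi j) + e1%:E /\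
     int m (phi j) <= int (m_ n) (phi j) + e1%:E)%E.
  by apply: filter_forall => j; exact: near_le.
have ng := near_le g 1 _ cg ltr01.
have nr := near_le _ _ (restg k) (crest k) (divr_gt0 e20 (ltr0n R 2)).
have {}ng := ng (fun x => introT andP (conj (g0 x) (lexx _))).
near=> n.
have hphi : forall j : 'I_k,
    (int (m_ n) (phi j) <= int m (phi j) + e1%:E /\
     int m (phi j) <= int (m_ n) (phi j) + e1%:E)%E by near: n.
have [gn _] : (int (m_ n) g <= int m g + 1%:E /\ int m g <= int (m_ n) g + 1%:E)%E.
  by near: n.
have [rn _] : (int (m_ n) (rest k) <= int m (rest k) + (e2 / 2)%:E /\
   int m (rest k) <= int (m_ n) (rest k) + (e2 / 2)%:E)%E by near: n.
have mngK : (int (m_ n) g <= K%:E)%E.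
  by rewrite (le_trans gn)// -(fineK gfin) -EFinD.
have rn2 : (int (m_ n) (rest k) <= e2%:E)%E.
  by rewrite (le_trans rn)// [in leRHS](splitr e2) EFinD leeD2r.
have rm2 : (int m (rest k) <= e2%:E)%E.
  by rewrite (le_trans hk)// lee_fin; lra.
have tot : 2 * L * e * K + k%:R * M * e1 + M * e2 <= eps by lra.
move=> f fc; split.
  apply: (le_trans (lip_class_approx e0 g01 mg gr (ltW e10) (ltW e20) K0
    (fun j => proj1 (hphi j)) mngK mgK rn2 L0 fc)).
  by rewrite leeD2l.
apply: (le_trans (lip_class_approx e0 g01 mg gr (ltW e10) (ltW e20) K0
  (fun j => proj2 (hphi j)) mgK mngK rm2 L0 fc)).
by rewrite leeD2l.
Unshelve. all: by end_near.
Qed.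

End uniform_convergence.

Lemma integral_le_add {disp : measure_display} {S : measurableType disp}
    {R : realType} (m : {measure set S -> \bar R}) (f g : S -> \bar R)
    (c : R) (D : set S) :
  measurable D -> 0 <= c -> (forall x, 0 <= f x)%E -> (forall x, 0 <= g x)%E ->
  measurable_fun setT f -> measurable_fun setT g ->
  (forall x, f x <= g x + (c * \1_D x)%:E)%E ->
  (\int[m]_x f x <= \int[m]_x g x + c%:E * m D)%E.
Proof.
move=> mD c0 f0 g0 mf mg fg.
have cD : (c%:E * m D = \int[m]_x (c * \1_D x)%:E)%E.
  under eq_integral do rewrite EFinM.
  rewrite ge0_integralZl_EFin//; last by apply/measurable_EFinP; exact: measurable_indic.
  by rewrite integral_indic// setIT.
have mI : measurable_fun setT (fun x => (c * \1_D x)%:E : \bar R).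
  by apply/measurable_EFinP/measurable_funM => //; exact: measurable_indic.
have I0 x : (0 <= (c * \1_D x)%:E :> \bar R)%E by rewrite lee_fin mulr_ge0.
rewrite cD -ge0_integralD//; apply: ge0_le_integral => //.
exact: emeasurable_funD.
Qed.

(** * Uniform convergence of powers of measures *)

Section uniform_power.
Context {disp : measure_display} {S : measurableType disp} {R : realType}.
Variables (d : S -> S -> R) (C : set S).
Hypotheses (dP : pseudometric d) (dB : dopen d `<=` measurable).

(* No bound on the size is imposed, so that the class is stable under fixing the
   first point. *)
Definition multi_lip_class N M L r (h : seq S -> R) :=
  [/\ forall z, 0 <= h z <= M,
    forall u v p q, `|h (u ++ p :: v) - h (u ++ q :: v)| <= L * d p q,
    forall u v p, thicken d C r p -> h (u ++ p :: v) = 0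
  & measurable_fun setT (fun z : N.-tuple S => h z)].

Local Notation far r := (~` thicken d C r).
Local Notation pint m N h :=
  (\int[power_measure m (n := N)]_z ((h : seq S -> R) (tval z))%:E)%E.
Local Notation int m f := (\int[m]_x (f x)%:E)%E.

Let mfar r : measurable (far r).
Proof. by apply: measurableC; exact: (measurable_thicken dP dB). Qed.

Let mfars r N : measurable [set z : N.-tuple S | cnt (far r) z = N].
Proof. exact: (measurable_cnt R). Qed.

Lemma power_measure_far (m : {sigma_finite_measure set S -> \bar R}) (K r : R) N :
  (m (far r) = K%:E)%E ->
  power_measure m [set z : N.-tuple S | cnt (far r) z = N] = (K ^+ N)%:E.
Proof.
move=> mK; elim: N => [|N IH].
  by rewrite expr0 /= diracE mem_set.
rewrite exprS EFinM /= -mK muleC.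
have -> : ((K ^+ N)%:E * m (far r) = \int[m]_(x in far r) cst (K ^+ N)%:E x)%E.
  by rewrite integral_cst.
rewrite [RHS]integral_mkcond; apply: eq_integral => x _; rewrite patchE.
have [/set_mem xf|xf] := boolP (x \in far r).
  apply: etrans IH; congr (power_measure m _); apply/seteqP; split=> z /=;
    rewrite add1n; last by move=> ->.
  by case.
have [M ME] := power_measure_pack m N.
rewrite (_ : [set z | _] = set0); first by rewrite -ME measure0.
rewrite -subset0 => z /=; rewrite add0n => e.
by have := cnt_size (far r) z; rewrite e size_tuple ltnn.
Qed.

Lemma multi_lip_class_far N M L r h z : multi_lip_class N M L r h ->
  cnt (far r) z <> size z -> h z = 0.
Proof.
move=> [_ _ h0 _] /eqP; rewrite -all_count => /allPn[p pz].
move: pz h0 => /splitPr[u v] h0 /negP pf; apply: h0.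
by apply: contrapT => pC; apply: pf; exact: mem_set.
Qed.

Lemma multi_lip_class_cons N M L r h x : multi_lip_class N.+1 M L r h ->
  multi_lip_class N M L r (fun z => h (x :: z)).
Proof.
move=> [h1 h2 h3 h4]; split=> [z|u v p q|u v p|] //.
- exact: (h2 (x :: u)).
- exact: (h3 (x :: u)).
have -> : (fun z : N.-tuple S => h (x :: z)) =
    (fun z : N.+1.-tuple S => h z) \o (fun z => tcons (x, z)) by [].
by apply: measurableT_comp => //; apply: (measurableT_comp (@measurable_tcons _ _ N));
  exact: pair1_measurable.
Qed.

(** Where some point is near [C] the function [h] is 0, so the error [c] is paid only on tuples of
    far points, a set of mass [K ^+ N]. *)
Lemma pint_le_add (m : {sigma_finite_measure set S -> \bar R}) N (h g : seq S -> R)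
    (c K r : R) : (m (far r) = K%:E)%E -> 0 <= c ->
  (forall z, 0 <= h z) -> (forall z, 0 <= g z) ->
  measurable_fun setT (fun z : N.-tuple S => h z) ->
  measurable_fun setT (fun z : N.-tuple S => g z) ->
  (forall z, h z <= g z + c) -> (forall z, cnt (far r) z <> size z -> h z = 0) ->
  (pint m N h <= pint m N g + (c * K ^+ N)%:E)%E.
Proof.
move=> mK c0 h0 g0 mh mg hg hz; rewrite EFinM -(power_measure_far _ mK).
have [M ME] := power_measure_pack m N.
have ME' : (M : set _ -> \bar R) = power_measure m (n := N) by exact/funext.
rewrite -ME'; apply: integral_le_add => //.
- exact: mfars.
- by move=> z; rewrite lee_fin.
- by move=> z; rewrite lee_fin.
- exact/measurable_EFinP.
- exact/measurable_EFinP.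
move=> z; rewrite -EFinD lee_fin indicE.
have [_|/negP zf] := boolP (z \in _); first by rewrite mulr1.
rewrite hz ?addr_ge0 ?mulr_ge0// size_tuple => zN; apply: zf; exact: mem_set.
Qed.

Lemma pint0 (m : {sigma_finite_measure set S -> \bar R}) N :
  (pint m N (fun=> 0) = 0)%E.
Proof.
have [M ME] := power_measure_pack m N.
have ME' : (M : set _ -> \bar R) = power_measure m (n := N) by exact/funext.
by rewrite -ME'; exact: integral0.
Qed.

Section limit.
Variables (m_ : nat -> {sigma_finite_measure set S -> \bar R})
  (m : {sigma_finite_measure set S -> \bar R}).
Hypothesis m_fin : forall r, 0 < r -> (m (far r) < +oo)%E.
Hypothesis unif : forall M L r eps, 0 <= M -> 0 <= L -> 0 < r -> 0 < eps ->
  \forall n \near \oo, forall f, lip_class d C M L r f ->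
    (int (m_ n) f <= int m f + eps%:E /\ int m f <= int (m_ n) f + eps%:E)%E.

(** The Lipschitz cutoff is 1 off the [r]-thickening and 0 on the [r / 2]-thickening. Its integral
    thus bounds the mass off the former under [m_ n], and is bounded by the mass off the latter
    under [m]. *)
Lemma mass_far_bound r : 0 < r ->
  exists2 K, 0 <= K & \forall n \near \oo, (m_ n (far r) <= K%:E)%E.
Proof.
move=> r0; have r20 : 0 < r / 2 by rewrite divr_gt0.
have [g [g01 gL gr2 gr]] := lip_cutoff dP C r0.
have g0 x : 0 <= g x by case/andP: (g01 x).
have mg := dcontinuous_measurable dB (lip_dcontinuous dP gL).
have mK : m (far (r / 2)) = (fine (m (far (r / 2))))%:E.
  by rewrite fineK// ge0_fin_numE// m_fin.
exists (fine (m (far (r / 2))) + 1); first by rewrite addr_ge0 ?fine_ge0.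
have Lr : 0 <= 2 / r by rewrite divr_ge0// ltW.
apply: filterS (unif ler01 Lr r20 ltr01) => n /(_ g)[//|gn _].
apply: (@le_trans _ _ (int (m_ n) g)).
  rewrite -(setIT (far r)) -integral_indic//; apply: ge0_le_integral => //.
  - by apply/measurable_EFinP; exact: measurable_indic.
  - exact/measurable_EFinP.
  move=> x _; rewrite lee_fin indicE.
  by have [/set_mem xf|] := boolP (x \in _) => //; rewrite gr.
apply: (le_trans gn); rewrite EFinD leeD2r//.
have := @integral_le_add _ _ _ m (fun x => (g x)%:E) (cst 0%E) 1 (far (r / 2)) (mfar _) ler01.
rewrite integral0 add0e mul1e -mK; apply => //.
- exact/measurable_EFinP.
move=> x; rewrite add0e lee_fin mul1r indicE.
have [_|/negP xf] := boolP (x \in _); first by case/andP: (g01 x).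
by rewrite gr2//; apply: contrapT => h; apply: xf; exact: mem_set.
Qed.

(** With the first point [x] frozen, the induction hypothesis has an error [e] uniform in [x], paid
    only for [x] far from [C], hence at most [e * K'] after integration. Under the limit power, the
    integrated section [H] is again a bounded Lipschitz function vanishing near [C], with both
    bounds multiplied by [K ^+ N]. Since [H] varies with [h], the one-factor convergence must be
    uniform over the class. *)
Lemma unif_power N M L r eps : 0 <= M -> 0 <= L -> 0 < r -> 0 < eps ->
  \forall n \near \oo, forall h, multi_lip_class N M L r h ->
    (pint (m_ n) N h <= pint m N h + eps%:E /\
     pint m N h <= pint (m_ n) N h + eps%:E)%E.
Proof.
move=> M0 L0 r0; elim: N eps => [|N IH] eps eps0.
  apply: nearW => n h [h1 _ _ h4].
  have h0 (z : 0.-tuple S) : (0 <= (h z)%:E)%E by rewrite lee_fin; case/andP: (h1 z).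
  have mh : measurable_fun setT (fun z : 0.-tuple S => (h z)%:E) by exact/measurable_EFinP.
  by rewrite !power_measure_integral0//; split; rewrite -EFinD lee_fin lerDl ltW.
have [K' K'0 mK'] := mass_far_bound r0.
pose K := fine (m (far r)); have K0 : 0 <= K by rewrite fine_ge0.
have mK : (m (far r) = K%:E)%E by rewrite fineK// ge0_fin_numE// m_fin.
have eps20 : 0 < eps / 2 by rewrite divr_gt0.
have K1 : 0 < K' + 1 by rewrite ltr_wpDl.
pose e := eps / 2 / (K' + 1); have e0 : 0 < e by rewrite divr_gt0.
have eK : e * K' <= eps / 2.
  by rewrite /e -mulrA ler_piMr ?(ltW eps20)// mulrC ler_pdivrMr// mul1r lerDl.
have MK0 : 0 <= M * K ^+ N by rewrite mulr_ge0 ?exprn_ge0.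
have LK0 : 0 <= L * K ^+ N by rewrite mulr_ge0 ?exprn_ge0.
near=> n.
have IHn : forall h, multi_lip_class N M L r h ->
    (pint (m_ n) N h <= pint m N h + e%:E /\ pint m N h <= pint (m_ n) N h + e%:E)%E.
  by near: n; exact: IH.
have Un : forall f, lip_class d C (M * K ^+ N) (L * K ^+ N) r f ->
    (int (m_ n) f <= int m f + (eps / 2)%:E /\ int m f <= int (m_ n) f + (eps / 2)%:E)%E.
  by near: n; exact: unif.
have mKn : (m_ n (far r) <= K'%:E)%E by near: n.
move=> h hc; have [h1 h2 h3 h4] := hc.
have h0 z : 0 <= h z by case/andP: (h1 z).
have hx x := multi_lip_class_cons x hc.
have mhx x : measurable_fun setT (fun z : N.-tuple S => h (x :: z)) by case: (hx x).
pose H_ (m' : {sigma_finite_measure set S -> \bar R}) x := pint m' N (fun z => h (x :: z)).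
have H_0 m' x : (0 <= H_ m' x)%E 
  by apply: power_measure_integral_ge0 => z; rewrite lee_fin.
have mH_ m' : measurable_fun setT (H_ m').
  apply: (measurable_power_section m' (h := fun z => (h z)%:E)) => [|z].
    exact/measurable_EFinP.
  by rewrite lee_fin.
have step (m' : {sigma_finite_measure set S -> \bar R}) : pint m' N.+1 h = (\int[m']_x H_ m' x)%E.
  rewrite (power_measure_integralS m' (h := fun z => (h z)%:E)) => [//||z].
    exact/measurable_EFinP.
  by rewrite lee_fin.
have Hz m' x : thicken d C r x -> H_ m' x = 0%E.
  move=> xC; rewrite -(pint0 m' N) /H_; congr (integral _ _ _).
  by apply/funext => z; rewrite (h3 [::]).
have hfar x z : cnt (far r) z <> size z -> h (x :: z) = 0.
  exact: (multi_lip_class_far (hx x)).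
have Hle x : (H_ m x <= (M * K ^+ N)%:E)%E.
  have := @pint_le_add m N (fun z => h (x :: z)) (fun=> 0) M K r mK M0.
  rewrite pint0 add0e; apply => // [z|z]; last exact: hfar.
  by rewrite add0r; case/andP: (h1 (x :: z)).
pose H x := fine (H_ m x).
have HE x : (H x)%:E = H_ m x.
  by rewrite fineK// ge0_fin_numE// (le_lt_trans (Hle x))// ltry.
have HL : lip_class d C (M * K ^+ N) (L * K ^+ N) r H.
  split=> [x|x y|x xC].
  - by rewrite -!lee_fin HE Hle H_0.
  - have Hxy a b : (H_ m a <= H_ m b + (L * d a b * K ^+ N)%:E)%E.
      have c0 : 0 <= L * d a b by rewrite mulr_ge0// (pseudometric_ge0 dP).
      apply: (@pint_le_add m N (fun z => h (a :: z)) (fun z => h (b :: z)) _ K r mK c0) => //;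
        last exact: hfar.
      move=> z; have := h2 [::] z a b; rewrite /= ler_norml => /andP[_].
      by rewrite lerBlDl.
    have := Hxy x y; have := Hxy y x; rewrite -!HE -!EFinD !lee_fin.
    rewrite (pseudometricC dP y) mulrAC ler_norml => ? ?.
    by apply/andP; split; lra.
  - by rewrite /H Hz.
have mH : measurable_fun setT (fun x => (H x)%:E).
  by rewrite (_ : (fun x => _) = H_ m)//; apply/funext.
have IntH : (\int[m]_x H_ m x = int m H)%E by apply: eq_integral => x _; rewrite HE.
have [U1 U2] := Un H HL.
have tot : ((eps / 2)%:E + (e * K')%:E <= eps%:E :> \bar R)%E by rewrite -EFinD lee_fin; lra.
have en : (e%:E * m_ n (far r) <= (e * K')%:E)%E.
  by rewrite (EFinM e) lee_wpmul2l// lee_fin ltW.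
have He x : (H_ (m_ n) x <= H_ m x + (e * \1_(far r) x)%:E /\
    H_ m x <= H_ (m_ n) x + (e * \1_(far r) x)%:E)%E.
  rewrite indicE; have [_|/negP xf] := boolP (x \in _); first by rewrite mulr1; exact: IHn.
  have xC : thicken d C r x by apply: contrapT => xC; apply: xf; exact: mem_set.
  by rewrite !Hz// mulr0 adde0.
have e00 := ltW e0.
have I1 : (\int[m_ n]_x H_ (m_ n) x <= \int[m_ n]_x H_ m x + e%:E * m_ n (far r))%E.
  by apply: integral_le_add => // x; case: (He x).
have I2 : (\int[m_ n]_x H_ m x <= \int[m_ n]_x H_ (m_ n) x + e%:E * m_ n (far r))%E.
  by apply: integral_le_add => // x; case: (He x).
have IntHn : (\int[m_ n]_x H_ m x = int (m_ n) H)%E by apply: eq_integral => x _; rewrite HE.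
rewrite !step IntH; rewrite IntHn in I1 I2; split.
  apply: (le_trans I1); apply: (le_trans (leeD U1 en)).
  by rewrite -addeA leeD2l.
apply: (le_trans U2); apply: (le_trans (leeD2r _ I2)).
rewrite -addeA leeD2l// (le_trans _ tot)// addeC leeD2l//.
Unshelve. all: by end_near.
Qed.

End limit.
End uniform_power.

(** * Regularly varying intensities *)

Section finite_pack.
Context {d : measure_display} {E : measurableType d} {R : realType}.

Lemma sigma_finite_lty (m : {measure set E -> \bar R}) :
  (m setT < +oo)%E -> sigma_finite setT m.
Proof. by move=> h; exists (fun=> setT) => [|n]; rewrite ?bigcup_const//; exists 0. Qed.

Definition finite_pack (m : {measure set E -> \bar R}) (h : (m setT < +oo)%E) :
    {finite_measure set E -> \bar R} :=
  HB.pack_for (FiniteMeasure.type E R) (Measure.sort m)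
    (@isSFinite.Build _ _ _ (Measure.sort m)
      (sfinite_measure_sigma_finite (sigma_finite_lty h)))
    (@isSigmaFinite.Build _ _ _ (Measure.sort m) (sigma_finite_lty h))
    (@isFinite.Build _ _ _ (Measure.sort m) (lty_fin_num_fun h)).

(** [C] is closed, so the complements of its thickenings exhaust the complement of [C]; adjoining
    the null set [C] keeps their masses finite. *)
Lemma sigma_finite_in_M (dist : E -> E -> R) (C : set E)
    (m : {measure set E -> \bar R}) :
  pseudometric dist -> dopen dist `<=` measurable -> measurable C ->
  (forall x, (forall r, 0 < r -> thicken dist C r x) -> C x) ->
  in_M dist C m -> sigma_finite setT m.
Proof.
move=> dP dB mC Ccl [mC0 mfin].
have mfar r : measurable (~` thicken dist C r).
  by apply: measurableC; exact: (measurable_thicken dP dB).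
exists (fun n => C `|` ~` thicken dist C n.+1%:R^-1) => [|n].
  apply/esym/seteqP; split=> // x _.
  have [Cx|Cx] := pselect (C x); first by exists 0 => //; left.
  have [r r0 Cr] : exists2 r, 0 < r & ~ thicken dist C r x.
    apply: contrapT => h; apply: Cx; apply: Ccl => r r0.
    by apply: contrapT => Cr; apply: h; exists r.
  have [n _ /(_ n (leqnn n)) nr] := near_infty_natSinv_lt (PosNum r0).
  exists n => //; right; apply: contra_not Cr => -[y Cy xy]; exists y => //.
  exact: lt_trans xy nr.
split; first exact: measurableU.
apply: le_lt_trans (measureU2 _ _ _) _ => //.
rewrite [X in (X + _)%E](_ : _ = 0%E)// add0e; apply: mfin.
by rewrite invr_gt0.
Qed.

Lemma integral_off_null (m : {measure set E -> \bar R}) (C : set E) (f : E -> R) :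
  (forall x, C x -> f x = 0) ->
  (\int[m]_(x in ~` C) (f x)%:E = \int[m]_x (f x)%:E)%E.
Proof.
move=> fC; rewrite integral_mkcond; apply: eq_integral => x _; rewrite patchE.
have [//|/negP xC] := boolP (x \in _); rewrite fC//; apply: contrapT => Cx.
by apply: xC; exact: mem_set.
Qed.

End finite_pack.

Section uniform_product.
Context {dT dX : measure_display} {R : realType}.
Context {T : polishType dT R} {X : polishType dX R} {s : scaling X}.
Local Notation E := (T * X)%type.
Variables (lam : {finite_measure set T -> \bar R})
  (m_ : nat -> {sigma_finite_measure set X -> \bar R})
  (m : {sigma_finite_measure set X -> \bar R}).
Local Notation intX m f := (\int[m]_(x in ~` [set origin s]) (f x)%:E)%E.
Local Notation int m f := (\int[m]_x (f x)%:E)%E.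

(** Sections in the second variable inherit the bounds of the class. The error is therefore uniform
    in [t], and integrating it costs a factor at most the total mass of [lam]. *)
Lemma unif_product :
  (forall M L r eps, 0 <= M -> 0 <= L -> 0 < r -> 0 < eps ->
    \forall n \near \oo, forall f, lip_class mdist [set origin s] M L r f ->
    (intX (m_ n) f <= intX m f + eps%:E /\ intX m f <= intX (m_ n) f + eps%:E)%E) ->
  forall M L r eps, 0 <= M -> 0 <= L -> 0 < r -> 0 < eps ->
    \forall n \near \oo, forall f : E -> R,
      lip_class (@prod_dist _ _ R T X) (prod_axis s) M L r f ->
    (int (lam \x m_ n)%E f <= int (lam \x m)%E f + eps%:E /\
     int (lam \x m)%E f <= int (lam \x m_ n)%E f + eps%:E)%E.
Proof.
move=> unif M L r eps M0 L0 r0 eps0.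
pose K := fine (lam setT); have K0 : 0 <= K by rewrite fine_ge0.
have lamK : lam setT = K%:E by rewrite fineK// fin_num_measure.
have K1 : 0 < K + 1 by rewrite ltr_wpDl.
pose e := eps / (K + 1); have e0 : 0 < e by rewrite divr_gt0.
have eK : e * K <= eps.
  by rewrite /e -mulrA ler_piMr ?(ltW eps0)// mulrC ler_pdivrMr// mul1r lerDl.
apply: filterS (unif M L r e M0 L0 r0 e0) => n un f [f01 fL fr].
have f0 p : 0 <= f p by case/andP: (f01 p).
have mf : measurable_fun setT (fun p => (f p)%:E).
  apply/measurable_EFinP; apply: (dcontinuous_measurable prod_dopen_measurable).
  exact: (lip_dcontinuous pseudometric_prod_dist fL).
have fE0 (p : E) : (0 <= (f p)%:E)%E by rewrite lee_fin.
have cf t : lip_class mdist [set origin s] M L r (fun x => f (t, x)).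
  split=> [x //|x y|x [_ /= -> xo]].
    by have := fL (t, x) (t, y); rewrite /prod_dist /= mdistxx add0r.
  by apply: fr; apply/thicken_axis; rewrite /= metric_sym.
pose F (m' : {sigma_finite_measure set X -> \bar R}) t := int m' (fun x => f (t, x)).
have F0 m' t : (0 <= F m' t)%E by apply: integral_ge0 => x _; exact: fE0.
have mF m' : measurable_fun setT (F m').
  exact: (@measurable_fun_fubini_tonelli_F _ _ _ _ _ m' (fun p => (f p)%:E)).
have tonelli (m' : {sigma_finite_measure set X -> \bar R}) :
    (int (lam \x m')%E f = \int[lam]_t F m' t)%E.
  by rewrite fubini_tonelli1.
have FE (m' : {sigma_finite_measure set X -> \bar R}) t : F m' t = intX m' (fun x => f (t, x)).
  rewrite integral_off_null// => x /= ->; apply: fr; apply/thicken_axis => /=.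
  by rewrite mdistxx.
have err (m1 m2 : {sigma_finite_measure set X -> \bar R}) :
    (forall t, F m1 t <= F m2 t + e%:E)%E ->
    (\int[lam]_t F m1 t <= \int[lam]_t F m2 t + eps%:E)%E.
  move=> h; apply: (@le_trans _ _ (\int[lam]_t F m2 t + e%:E * lam setT)%E).
    by apply: integral_le_add => // [|t]; [exact: ltW|rewrite indicE in_setT mulr1].
  by rewrite leeD2l// lamK -EFinM lee_fin.
rewrite !tonelli; split; apply: err => t; rewrite !FE; have [] := un _ (cf t); by [].
Qed.

End uniform_product.

Section power_scale.
Context {d : measure_display} {E : measurableType d} {R : realType}.

Lemma power_measure_scale (m m' : {sigma_finite_measure set E -> \bar R}) (c : {nonneg R}) N
    (h : N.-tuple E -> \bar R) : (forall A, measurable A -> m' A = mscale c m A) ->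
  measurable_fun setT h -> (forall z, 0 <= h z)%E ->
  (\int[power_measure m' (n := N)]_z h z =
   (c%:num ^+ N)%:E * \int[power_measure m (n := N)]_z h z)%E.
Proof.
move=> mE; elim: N h => [|N IH] h mh h0; first by rewrite !power_measure_integral0// expr0 mul1e.
have intm' (g : E -> \bar R) : measurable_fun setT g -> (forall x, 0 <= g x)%E ->
    (\int[m']_x g x = c%:num%:E * \int[m]_x g x)%E.
  move=> mg g0; rewrite (eq_measure_integral (mscale c m)) => [|A mA _]; last exact: mE.
  by rewrite ge0_integral_mscale.
have mh' x : measurable_fun setT (fun z : N.-tuple E => h [tuple of x :: z]).
  have : measurable_fun setT (h \o (fun z => tcons (x, z))).
    by apply: measurableT_comp => //;
      apply: (measurableT_comp (@measurable_tcons _ _ N)); exact: pair1_measurable.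
  by [].
have mS := measurable_power_section m mh h0.
have S0 x := power_measure_integral_ge0 m (fun z : N.-tuple E => h0 [tuple of x :: z]).
rewrite !power_measure_integralS//.
have -> : (fun x => \int[power_measure m' (n := N)]_z h [tuple of x :: z])%E =
    (fun x => (c%:num ^+ N)%:E * \int[power_measure m (n := N)]_z h [tuple of x :: z])%E.
  by apply/funext => x; rewrite IH.
rewrite intm'; last 2 first.
- exact: measurable_funeM.
- by move=> x; rewrite mule_ge0// lee_fin exprn_ge0.
by rewrite ge0_integralZl_EFin ?exprn_ge0// exprS EFinM muleA.
Qed.

End power_scale.

(** * Lipschitz functionals of a Poisson process *)

Section lipschitz_functional.
Context {dT dX : measure_display} {R : realType}.
Context {T : polishType dT R} {X : polishType dX R} {s : scaling X}.
Local Notation E := (T * X)%type.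
Local Notation N := (point_measure T s).
Implicit Types (pi : N) (z : seq E).

Lemma measurable_pm (d : measure_display) (O : measurableType d) (F : O -> N) :
  (forall A j, measurable A -> measurable [set w | F w A = j%:R%:E]) ->
  measurable_fun setT F.
Proof.
by move=> mF _ B mB; rewrite setTI; apply: eval_measurable => //; exact: measurable_eval.
Qed.

Lemma measurable_pm_seq n : measurable_fun setT (fun z : n.-tuple E => pm_seq s z).
Proof.
apply: measurable_pm => A j mA.
rewrite (_ : [set w | _] = [set z : n.-tuple E | cnt (A `\` prod_axis s) z = j]).
  by apply: (measurable_cnt R); apply: measurableD => //; exact: measurable_prod_axis.
apply/seteqP; split=> z /=; rewrite pm_seqE; last by move=> ->.
by case=> /eqP; rewrite eqr_nat => /eqP.
Qed.

Lemma at_most_restr k pi r (mA : measurable (away (T := T) s r)) : 0 < r ->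
  (pi (away s r) <= k%:R%:E)%E -> at_most k (pm_restr mA pi).
Proof.
move=> r0 pik; have [z [zS zE]] := pm_points pi r0; exists z => [|A mA'].
  move: pik; rewrite zE// /cnt lee_fin ler_nat.
  by move: zS; rewrite all_count => /eqP ->.
rewrite pm_restrE zE//; last exact: measurableI.
rewrite sum_diracE; congr (_%:R%:E); apply: eq_in_count => p pz.
by move/allP: zS => /(_ _ pz) /= pS; rewrite in_setI pS andbT.
Qed.

Variables (k : nat) (M L r0 : R) (f : N -> R).
Hypothesis fC : lip_class (@pm_dist _ _ _ T X s) (at_most k) M L r0 f.
Hypothesis L0 : 0 <= L.

Let f01 pi : 0 <= f pi <= M. Proof. by case: fC. Qed.
Let f0 pi : 0 <= f pi. Proof. by case/andP: (f01 pi). Qed.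
Let fL : lip (@pm_dist _ _ _ T X s) L f. Proof. by case: fC. Qed.
Let M0 : 0 <= M. Proof. by case/andP: (f01 point) => h1 h2; exact: le_trans h1 h2. Qed.

Lemma measurable_lip_pm : measurable_fun setT f.
Proof.
apply: (@dcontinuous_measurable _ _ _ (@pm_dist _ _ _ T X s)).
  exact: sub_sigma_algebra.
exact: (lip_dcontinuous pseudometric_pm_dist fL).
Qed.

(** Erasing the points below level [r] moves [pi] into [at_most k], by a distance at most
    [r < r0]. *)
Lemma lip_class_few r pi : 0 < r < r0 -> (pi (away s r) <= k%:R%:E)%E -> f pi = 0.
Proof.
move=> /andP[r_gt0 rr0] pik; case: fC => _ _; apply.
exists (pm_restr (@measurable_away _ _ R T X s r) pi); first exact: at_most_restr.
by rewrite (le_lt_trans (pm_dist_restr _ (ltW r_gt0))).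
Qed.

(** [multi_lip_class] speaks of lists of every length. A longer list can have a point near the axis
    and still k + 1 far points, where [f] need not vanish; hence the value 0 at all other
    lengths. *)
Definition seq_functional z : R := if size z == k.+1 then f (pm_seq s z) else 0.

(** One of k + 1 points below level [r] leaves at most k above it, where [f] vanishes; the factor 2
    is the cost of moving a point. *)
Lemma seq_functional_class r : 0 < r < r0 ->
  multi_lip_class (@prod_dist _ _ R T X) (prod_axis s) k.+1 M (2 * L) r seq_functional.
Proof.
move=> rr0; rewrite /seq_functional; split.
- by move=> z; case: ifP => _ //; rewrite lexx.
- move=> u v p q; rewrite !size_cat /=; case: ifP => _; last first.
    by rewrite subrr normr0 !mulr_ge0// (pseudometric_ge0 pseudometric_prod_dist).
  rewrite (le_trans (fL _ _))// [2 * L]mulrC -mulrA ler_wpM2l//.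
  exact: pm_dist_seq_mid.
- move=> u v p pr; case: eqP => // sz; apply: (lip_class_few rr0).
  rewrite pm_seq_off; last first.
    by case/andP: rr0 => r_gt0 _; exact: (away_axis r_gt0 (@subset_refl _ _)).
  rewrite lee_fin ler_nat -ltnS -sz /cnt !count_cat size_cat /= -!addnS.
  have -> : (p \in away s r) = false.
    by apply/negP => /set_mem; rewrite /away /setC /=.
  by rewrite add0n; apply: leq_add; rewrite ?ltnS count_size.
- apply: (eq_measurable_fun (f \o (fun z : k.+1.-tuple E => pm_seq s z))).
    by move=> z _; rewrite /= size_tuple eqxx.
  exact: measurableT_comp measurable_lip_pm (@measurable_pm_seq _).
Qed.

Context {dO : measure_display} {O : measurableType dO} {P : probability O R}.
Variables (Lam : {finite_measure set E -> \bar R}) (Pi : O -> N).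
Hypothesis PiP : poisson_process P Lam Pi.
Variables (r r' : R).
Hypotheses (rr0 : 0 < r < r0) (r'r : 0 < r' <= r).

Let r_gt0 : 0 < r. Proof. by case/andP: rr0. Qed.
Let r'_gt0 : 0 < r'. Proof. by case/andP: r'r. Qed.
Let mA := @measurable_away _ _ R T X s.

Let few_eq w n t : 0 < t -> ~ (n%:R%:E <= Pi w (away s t))%E ->
  exists2 j, (j < n)%N & Pi w (away s t) = j%:R%:E.
Proof.
move=> t0 nw; have [z [_ zE]] := pm_points (Pi w) t0.
exists (cnt (away s t) z); last by rewrite zE.
by rewrite ltnNge; apply/negP => nz; apply: nw; rewrite zE// lee_fin ler_nat.
Qed.

Let mcount t n : 0 < t -> measurable [set w | (n%:R%:E <= Pi w (away s t))%E].
Proof.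
move=> t0.
rewrite (_ : [set w | _] = ~` \bigcup_(j in `I_n) [set w | Pi w (away s t) = j%:R%:E]).
  apply: measurableC; apply: bigcup_measurable => j _; exact: (poisson_measurable PiP).
apply/seteqP; split=> w /= h.
  by move=> [j /= jn jE]; move: h; rewrite jE lee_fin ler_nat leqNgt jn.
by apply: contrapT => /(few_eq t0)[j jn jE]; apply: h; exists j.
Qed.

(* The restriction radius r' is allowed to be much smaller than r: dropping the
   points below level r' costs L * r', but only on the event that k + 1 points are
   above level r, whose probability does not depend on r'. *)
Lemma poisson_expansion :
  let J := (\int[power_measure Lam (n := k.+1)]_z (seq_functional z)%:E)%E in
  let c := expR (- fine (Lam (away s r'))) / (k.+1)`!%:R in
  let err := L * r' * fine (Lam (away s r)) ^+ k.+1 +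
             M * fine (Lam (away s r')) ^+ k.+2 in
  (\int[P]_w (f (Pi w))%:E <= c%:E * J + err%:E /\
   c%:E * J <= \int[P]_w (f (Pi w))%:E + err%:E)%E.
Proof.
move=> J c err.
pose D0 := [set w | Pi w (away s r') = k.+1%:R%:E].
pose D1 := [set w | (k.+1%:R%:E <= Pi w (away s r))%E].
pose D2 := [set w | (k.+2%:R%:E <= Pi w (away s r'))%E].
have mD0 : measurable D0 by exact: (poisson_measurable PiP).
have mPi : measurable_fun setT Pi by case: PiP.
have mRes : measurable_fun setT (fun w => pm_restr (mA r') (Pi w)).
  apply: measurable_pm => A j mA'; apply: (poisson_measurable PiP).
  exact: measurableI.
pose g w := f (pm_restr (mA r') (Pi w)) * \1_D0 w.
have g0 w : 0 <= g w by rewrite mulr_ge0.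
have mg : measurable_fun setT g.
  apply: measurable_funM; last exact: measurable_indic.
  exact: measurableT_comp measurable_lip_pm mRes.
have mf : measurable_fun setT (fun w => f (Pi w)).
  exact: measurableT_comp measurable_lip_pm mPi.
have gE : (\int[P]_w (g w)%:E = c%:E * J)%E.
  transitivity (\int[P]_(w in D0) (f (pm_restr (mA r') (Pi w)))%:E)%E.
    rewrite [RHS]integral_mkcond; apply: eq_integral => w _.
    by rewrite patchE /g indicE; case: ifP => _; rewrite ?mulr1 ?mulr0.
  rewrite (conditional_expectation PiP r'_gt0 _ f0 measurable_lip_pm).
  congr (_ * _)%E; have [Mp ME] := power_measure_pack Lam k.+1.
  have ME' : (Mp : set _ -> \bar R) = power_measure Lam (n := k.+1) by exact/funext.
  rewrite /J -ME' integral_mkcond; congr (integral _ _ _).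
  apply/funext => z; rewrite patchE /seq_functional size_tuple eqxx.
  (* A tuple with a point below level [r'] has at most k points above [r], so the restriction of the
     integral to tuples above [r'] loses nothing. *)
  case: ifPn => // /negP zr; rewrite (lip_class_few rr0)//.
  rewrite pm_seq_off; last exact: (away_axis r_gt0 (@subset_refl _ _)).
  rewrite lee_fin ler_nat -ltnS; apply: leq_trans (_ : cnt (away s r') z < _)%N.
    by rewrite ltnS sub_cnt//; apply: sub_away; case/andP: r'r.
  have := cnt_size (away s r') z; rewrite size_tuple ltn_neqAle => ->; rewrite andbT.
  apply/eqP => h.
  by apply: zr; exact: mem_set.
have far_le w : (Pi w (away s r) <= Pi w (away s r'))%E.
  by apply: le_measure; rewrite ?inE//; apply: sub_away; case/andP: r'r.
(* Off [D1] both terms vanish. On [D2] only the bound [M] is used. On [D1] off [D2] exactly k + 1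
   points lie above [r'], because those above [r] are among them, and only the restriction is paid
   for. *)
have close w : `|f (Pi w) - g w| <= L * r' * \1_D1 w + M * \1_D2 w.
  have I0 : 0 <= L * r' * \1_D1 w by rewrite !mulr_ge0// ltW.
  have I2 : 0 <= M * \1_D2 w by rewrite mulr_ge0.
  have [D1w|D1w] := boolP (w \in D1); last first.
    have few : (Pi w (away s r) <= k%:R%:E)%E.
      have [|j jk ->] := few_eq (w := w) (n := k.+1) r_gt0; last by rewrite lee_fin ler_nat.
      by move=> h; move/negP: D1w; apply; exact: mem_set.
    rewrite (lip_class_few rr0 few) /g (lip_class_few rr0) ?mul0r ?subrr ?normr0 ?addr_ge0//.
    by rewrite pm_restrE setIidl//; apply: sub_away; case/andP: r'r.
  have [D2w|D2w] := boolP (w \in D2).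
    rewrite [\1_D2 w]indicE D2w mulr1 ler_wpDl// ler_norml /g indicE.
    have /set_mem D2w' := D2w.
    have -> : (w \in D0) = false.
      apply/negP => /set_mem D0w; move: D2w'; rewrite /D2 /= D0w lee_fin ler_nat.
      by rewrite ltnn.
    by rewrite mulr0 subr0; have /andP[? ?] := f01 (Pi w); apply/andP; split; lra.
  have D0w : w \in D0.
    apply: mem_set; rewrite /D0 /=.
    have [|j jk jE] := few_eq (w := w) (n := k.+2) r'_gt0.
      by move=> h; move/negP: D2w; apply; exact: mem_set.
    rewrite jE; congr (_%:R%:E); apply/eqP; rewrite eqn_leq -ltnS jk /=.
    have /set_mem D1w' := D1w; have := le_trans D1w' (far_le w).
    by rewrite jE lee_fin ler_nat.
  rewrite /g !indicE D1w D0w (negbTE D2w) !mulr1 mulr0 addr0 (le_trans (fL _ _))//.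
  by rewrite ler_wpM2l// pm_dist_restr// ltW.
have mD1 : measurable D1 by exact: mcount.
have mD2 : measurable D2 by exact: mcount.
have m2 : measurable_fun setT (fun w => M * \1_D2 w : R).
  by apply: measurable_funM; [exact: measurable_cst|exact: measurable_indic].
have tail t n : 0 < t -> (P [set w | (n%:R%:E <= Pi w (away s t))%E] <=
    (fine (Lam (away s t)) ^+ n)%:E)%E.
  by move=> t0; exact: (poisson_tail PiP).
have err_le (F G : O -> R) : (forall w, 0 <= F w) -> (forall w, 0 <= G w) ->
    measurable_fun setT F -> measurable_fun setT G ->
    (forall w, F w <= G w + (L * r' * \1_D1 w + M * \1_D2 w)) ->
    (\int[P]_w (F w)%:E <= \int[P]_w (G w)%:E + err%:E)%E.
  move=> F0 G0 mF mG FG.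
  have Lr0 : 0 <= L * r' by rewrite mulr_ge0// ltW.
  pose G2 w := G w + M * \1_D2 w.
  have G20 w : 0 <= G2 w by rewrite addr_ge0// mulr_ge0.
  have mG2 : measurable_fun setT G2 by exact: measurable_funD.
  apply: (@le_trans _ _ (\int[P]_w (G2 w)%:E + (L * r')%:E * P D1)%E).
    apply: integral_le_add => //; try exact/measurable_EFinP.
    move=> w; rewrite -EFinD lee_fin (le_trans (FG w))// /G2.
    by rewrite addrA addrAC.
  apply: (@le_trans _ _ (\int[P]_w (G w)%:E + M%:E * P D2 + (L * r')%:E * P D1)%E).
    by rewrite leeD2r//; apply: integral_le_add => //; exact/measurable_EFinP.
  rewrite -addeA leeD2l// /err EFinD addeC; apply: leeD.
      by rewrite [leRHS]EFinM lee_wpmul2l ?lee_fin//; exact: tail.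
  by rewrite [leRHS]EFinM lee_wpmul2l ?lee_fin//; exact: tail.
rewrite -gE; split; apply: err_le => // w.
  by have := close w; rewrite ler_norml lerBlDl => /andP[].
by have := close w; rewrite distrC ler_norml lerBlDl => /andP[].
Qed.

End lipschitz_functional.

Section scaled_intensity.
Context {dT dX : measure_display} {R : realType}.
Context {T : polishType dT R} {X : polishType dX R} {s : scaling X}.
Local Notation E := (T * X)%type.
Variables (lam : {finite_measure set T -> \bar R}) (nu : probability X R).
Implicit Types v : {posnum R}.

Let nuv v := pushforward_pack nu (measurable_act s (gt0 v)).

Let nuv_lty v : (nuv v setT < +oo)%E.
Proof. by rewrite /nuv /= /pushforward preimage_setT probability_setT ltry. Qed.

Definition scaled_law v : {finite_measure set X -> \bar R} := finite_pack (nuv_lty v).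

Let prod_lty (m : {finite_measure set X -> \bar R}) : ((lam \x m)%E setT < +oo)%E.
Proof.
rewrite -setXTT product_measure1E// lte_mul_pinfty ?measure_ge0//.
- exact: fin_num_measure.
- by rewrite ltey_eq fin_num_measure.
Qed.

Definition intensity (m : {finite_measure set X -> \bar R}) :
  {finite_measure set E -> \bar R} := finite_pack (prod_lty m).

Lemma pushforward_intensity v :
  pushforward (intensity nu) (prod_act s v%:num : E -> E) = intensity (scaled_law v).
Proof.
apply/funext => A; rewrite /pushforward /intensity /= /product_measure1.
apply: eq_integral => t _ /=; rewrite /pushforward; congr (nu _).
Qed.

Lemma poisson_process_scaled (dO : measure_display) (O : measurableType dO)
    (P : probability O R) (Pi : O -> point_measure T s) v :
  poisson_process P (lam \x nu)%E Pi ->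
  poisson_process P (intensity (scaled_law v)) (fun w => pm_scale v (Pi w)).
Proof.
move=> PiP; rewrite -pushforward_intensity.
exact: (@poisson_process_scale _ _ _ _ _ _ s _ _ (intensity nu)).
Qed.

End scaled_intensity.

Section regular_variation.
Context {dT dX : measure_display} {R : realType}.
Context {T : polishType dT R} {X : polishType dX R} {s : scaling X}.
Local Notation E := (T * X)%type.
Variables (lam : {finite_measure set T -> \bar R}) (nu : probability X R)
  (a : nat -> {posnum R}) (mu : {measure set X -> \bar R}).
Hypothesis rv : regularly_varying s nu a mu.

Let o := [set origin s].
Let v n : {posnum R} := ((a n)%:num^-1)%:pos.

Lemma polish_dopen_measurable : dopen (@mdist R X) `<=` measurable.
Proof.
move=> U dU; rewrite polish_borel; apply: sub_sigma_algebra.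
rewrite openE => x /dU[r r0 rU]; apply/nbhs_ballP; exists r => //.
by rewrite ballEmdist.
Qed.

Let polish_singleton_closed (x y : X) :
  (forall r, 0 < r -> thicken mdist [set x] r y) -> y = x.
Proof.
move=> h; apply: contrapT => yx.
have xy : 0 < mdist y x by rewrite lt0r mdist_ge0 andbT; apply/eqP => /mdist_positivity.
by have [_ -> ] := h _ xy; rewrite ltxx.
Qed.

Lemma polish_singleton_measurable (x : X) : measurable [set x].
Proof.
rewrite (_ : [set x] = \bigcap_n thicken mdist [set x] n.+1%:R^-1).
  apply: bigcap_measurable => // n _; apply: measurable_thicken => //.
    exact: pseudometric_mdist.
  exact: polish_dopen_measurable.
apply/seteqP; split=> [y -> n _|y yx].
  by exists x; rewrite // mdistxx invr_gt0.
apply: polish_singleton_closed => r r0.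
have [n _ /(_ n (leqnn n)) nr] := near_infty_natSinv_lt (PosNum r0).
by have [z zx yz] := yx n I; exists z => //; exact: lt_trans yz nr.
Qed.

Let muM : in_M mdist o mu. Proof. by case: rv. Qed.

Definition limit_law : {sigma_finite_measure set X -> \bar R} :=
  sigma_finite_pack (sigma_finite_in_M (pseudometric_mdist X) polish_dopen_measurable
    (polish_singleton_measurable (origin s)) (@polish_singleton_closed (origin s)) muM).

Definition limit_intensity : {sigma_finite_measure set E -> \bar R} :=
  sigma_finite_pack (sigma_finite_product lam limit_law).

Let nX n : {finite_measure set X -> \bar R} := mscale n%:R%:nng (scaled_law nu (v n) (s := s)).
Let nE n : {sigma_finite_measure set E -> \bar R} :=
  sigma_finite_pack (sigma_finite_product lam (nX n)).

(** Scaling by the inverse of [a n] undoes scaling by [a n], so the images in [regularly_varying]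
    are preimages, and the measures there are pushforwards. *)
Let nXE n A : nX n A = (n%:R%:E * nu (s (a n)%:num @` A))%E.
Proof.
rewrite /nX /= /mscale /= /pushforward; congr (_ * nu _)%E.
apply/seteqP; split=> [x Ax|_ [x Ax <-]] /=.
  by exists (s (a n)%:num^-1 x) => //; rewrite actM ?invr_gt0// divff ?act1// gt_eqF.
by rewrite actM ?invr_gt0// mulVf ?act1// gt_eqF.
Qed.

Let unifX M L r eps : 0 <= M -> 0 <= L -> 0 < r -> 0 < eps ->
  \forall n \near \oo, forall f, lip_class mdist o M L r f ->
    (\int[nX n]_(x in ~` o) (f x)%:E <= \int[limit_law]_(x in ~` o) (f x)%:E + eps%:E /\
     \int[limit_law]_(x in ~` o) (f x)%:E <= \int[nX n]_(x in ~` o) (f x)%:E + eps%:E)%E.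
Proof.
have [q qd] := polish_dense_seq X.
apply: (cvg_uniform_lip (pseudometric_mdist X) polish_dopen_measurable
  (polish_singleton_measurable (origin s)) qd) => //.
have -> : (fun n => nX n : set X -> \bar R) =
    (fun n A => n%:R%:E * nu (s (a n)%:num @` A))%E.
  by apply/funext => n; apply/funext => A; rewrite nXE.
by case: rv.
Qed.

Let unifE M L r eps : 0 <= M -> 0 <= L -> 0 < r -> 0 < eps ->
  \forall n \near \oo, forall f, lip_class (@prod_dist _ _ R T X) (prod_axis s) M L r f ->
    (\int[nE n]_x (f x)%:E <= \int[limit_intensity]_x (f x)%:E + eps%:E /\
     \int[limit_intensity]_x (f x)%:E <= \int[nE n]_x (f x)%:E + eps%:E)%E.
Proof. exact: unif_product unifX M L r eps. Qed.

Lemma limit_intensity_away r : 0 < r -> (limit_intensity (away s r) < +oo)%E.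
Proof.
move=> r0; pose far := ~` thicken mdist o r.
have mfar : measurable far.
  apply: measurableC; apply: measurable_thicken; first exact: pseudometric_mdist.
  exact: polish_dopen_measurable.
rewrite (_ : away s r = setT `*` far); last first.
  rewrite awayE; apply/seteqP; split=> [[t x] /= h|[t x] [_ /= h]].
    by split=> //= -[y -> ]; rewrite metric_sym ltNge h.
  by rewrite leNgt; apply/negP => xr; apply: h; exists (origin s); rewrite // metric_sym.
have -> : limit_intensity (setT `*` far) = (lam setT * limit_law far)%E.
  exact: product_measure1E.
rewrite lte_mul_pinfty ?measure_ge0//; first exact: fin_num_measure.
by case: muM => _; exact.
Qed.

(** Regular variation puts the factor n on the second marginal, whereas the Poisson intensity is
    without it; this passes from one to the other. *)
Let nE_scale n A : measurable A ->
  nE n A = mscale n%:R%:nng (intensity lam (scaled_law nu (v n) (s := s))) A.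
Proof.
move=> mA; rewrite /nE /= /mscale /intensity /= /product_measure1.
rewrite -ge0_integralZl_EFin//.
exact: (measurable_fun_xsection (scaled_law nu (v n) (s := s)) mA).
Qed.

(** The mean number of rescaled points above a fixed level is of order 1/n. Its powers bound the
    probabilities of seeing k + 1 or k + 2 points. *)
Lemma scaled_intensity_away r : 0 < r -> exists2 K, 0 <= K & \forall n \near \oo,
  n%:R * fine (intensity lam (scaled_law nu (v n) (s := s)) (away s r)) <= K.
Proof.
move=> r0; have [K K0 nK] := mass_far_bound pseudometric_prod_dist prod_dopen_measurable
  limit_intensity_away unifE r0.
exists K => //; apply: filterS nK => n; rewrite nE_scale; last exact: measurable_away.
rewrite /mscale -lee_fin EFinM fineK//.
exact: (fin_num_measure (intensity _ _) _ (measurable_away r)).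
Qed.

Lemma scaled_power_cvg k M L r eps : 0 <= M -> 0 <= L -> 0 < r -> 0 < eps ->
  \forall n \near \oo, forall h : seq E -> R,
    multi_lip_class (@prod_dist _ _ R T X) (prod_axis s) k M L r h ->
    let J := (\int[power_measure limit_intensity (n := k)]_z (h z)%:E)%E in
    let Jn := ((n%:R ^+ k)%:E *
      \int[power_measure (intensity lam (scaled_law nu (v n) (s := s))) (n := k)]_z (h z)%:E)%E in
    (Jn <= J + eps%:E /\ J <= Jn + eps%:E)%E.
Proof.
move=> M0 L0 r0 eps0.
have := unif_power pseudometric_prod_dist prod_dopen_measurable
  limit_intensity_away unifE k M0 L0 r0 eps0.
apply: filterS => n h f hf; have := h f hf.
rewrite (power_measure_scale (c := n%:R%:nng) (@nE_scale n))//.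
- by apply/measurable_EFinP; case: hf.
- by move=> z; rewrite lee_fin; case: hf => /(_ z)/andP[].
Qed.

End regular_variation.

(** * Convergence for Lipschitz functionals of the rescaled process *)

Section poisson_convergence.
Context {dT dX dO : measure_display} {R : realType}.
Context {T : polishType dT R} {X : polishType dX R} {s : scaling X}.
Local Notation E := (T * X)%type.
Local Notation N := (point_measure T s).
Variables (lam : {finite_measure set T -> \bar R}) (nu : probability X R)
  (a : nat -> {posnum R}) (mu : {measure set X -> \bar R}).
Hypothesis rv : regularly_varying s nu a mu.
Context {O : measurableType dO} {P : probability O R}.
Variable Pi : O -> N.
Hypothesis PiP : poisson_process P (lam \x nu)%E Pi.
Variables (k : nat) (M L r0 : R) (f : N -> R).
Hypotheses (r0_gt0 : 0 < r0) (L0 : 0 <= L).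
Hypothesis fC : lip_class (@pm_dist _ _ _ T X s) (at_most k) M L r0 f.

Let v n : {posnum R} := ((a n)%:num^-1)%:pos.
Let Lam n := intensity lam (scaled_law nu (v n) (s := s)).
Let LI := limit_intensity lam rv.

(** The constant [C] at level [r] does not depend on [r'], so [r'] can be chosen to make the
    restriction error small after multiplication by [n%:R ^+ k.+1]. The constant [C'] at level [r']
    may be large, but it only enters terms that carry one more factor 1/n. *)
Lemma poisson_functional_cvg :
  ((n%:R ^+ k.+1)%:E * \int[P]_w (f (pm_scale (v n) (Pi w)))%:E @[n --> \oo] -->
   (k.+1)`!%:R^-1%:E *
   \int[power_measure LI (n := k.+1)]_z (seq_functional k f z)%:E)%E.
Proof.
have [f01 _ _] := fC; have f0 pi : 0 <= f pi by case/andP: (f01 pi).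
have M0 : 0 <= M by case/andP: (f01 point); exact: le_trans.
pose r := r0 / 2; have r_gt0 : 0 < r by rewrite divr_gt0.
have rr0 : 0 < r < r0 by rewrite r_gt0 /r; move: r0_gt0; lra.
pose J := (\int[power_measure LI (n := k.+1)]_z (seq_functional k f z)%:E)%E.
have hC := seq_functional_class fC L0 rr0.
have [h01 _ _ mh] := hC; have h0 z : 0 <= seq_functional k f z by case/andP: (h01 z).
have J0 : (0 <= J)%E by apply: power_measure_integral_ge0 => z; rewrite lee_fin.
have Jfin : J \is a fin_num.
  have LIK : (LI (away s r) = (fine (LI (away s r)))%:E)%E.
    rewrite fineK// ge0_fin_numE; first exact: limit_intensity_away.
    exact: measure_ge0.
  have := pint_le_add pseudometric_prod_dist prod_dopen_measurable LIK M0
    h0 (fun _ => lexx 0) mh (measurable_cst _) _ (fun z => multi_lip_class_far hC (z := z)).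
  rewrite pint0 add0e => JM; rewrite ge0_fin_numE// (le_lt_trans (JM _)) ?ltry// => z.
  by rewrite add0r; case/andP: (h01 z).
have [j JE] : exists x, J = x%:E by exists (fine J); rewrite fineK.
have j0 : 0 <= j by rewrite -lee_fin -JE.
have fE0 n w : (0 <= (f (pm_scale (v n) (Pi w)))%:E)%E by rewrite lee_fin.
have [C C0 nC] := scaled_intensity_away lam rv r_gt0.
pose F : R := (k.+1)`!%:R; have F1 : 1 <= F by rewrite ler1n fact_gt0.
have F0 : 0 < F by exact: lt_le_trans F1.
rewrite -/J JE -EFinM; apply/cvge_le_addP => eps eps0.
pose e := eps / 4; have e0 : 0 < e by rewrite divr_gt0.
have LC1 : 0 < L * C ^+ k.+1 + 1 by rewrite ltr_wpDl// mulr_ge0// exprn_ge0.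
pose r' := Num.min r (e / (L * C ^+ k.+1 + 1)).
have r'r : 0 < r' <= r by rewrite lt_min r_gt0 divr_gt0//= ge_min lexx.
have r'_gt0 : 0 < r' by case/andP: r'r.
have Lr' : L * r' * C ^+ k.+1 <= e.
  rewrite mulrAC (le_trans (ler_wpM2l _ (_ : r' <= e / (L * C ^+ k.+1 + 1))))//.
  - by rewrite mulr_ge0// exprn_ge0.
  - by rewrite ge_min lexx orbT.
  by rewrite mulrCA ler_piMr ?(ltW e0)// ler_pdivrMr// mul1r lerDl.
have [C' C'0 nC'] := scaled_intensity_away lam rv r'_gt0.
(* The first summand accounts for k + 2 points, the second for replacing the exponential factor by
   1; both will be divided by [n]. *)
pose B := M * C' ^+ k.+2 + C' * (j + e).
have B0 : 0 <= B by rewrite addr_ge0// mulr_ge0// ?exprn_ge0// addr_ge0// ltW.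
have L20 : 0 <= 2 * L by rewrite mulr_ge0.
pose th_ n t := fine (Lam n (away s t)).
near=> n.
have n0 : 0 < n%:R :> R by rewrite ltr0n; near: n; exact: nbhs_infty_gt.
have Bn : B / n%:R <= e.
  rewrite ler_pdivrMr// mulrC -ler_pdivrMr//; near: n; exact: nbhs_infty_ger.
have thC : n%:R * th_ n r <= C by near: n.
have thC' : n%:R * th_ n r' <= C' by near: n.
set th := th_ n in thC thC'; have th0 t : 0 <= th t by exact: fine_ge0.
pose Jn' := (\int[power_measure (Lam n) (n := k.+1)]_z (seq_functional k f z)%:E)%E.
have [Jn1 Jn2] : ((n%:R ^+ k.+1)%:E * Jn' <= J + e%:E /\
    J <= (n%:R ^+ k.+1)%:E * Jn' + e%:E)%E.
  suff : forall h, multi_lip_class (@prod_dist _ _ R T X) (prod_axis s) k.+1 M (2 * L) r h ->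
    let J := (\int[power_measure LI (n := k.+1)]_z (h z)%:E)%E in
    let Jn := ((n%:R ^+ k.+1)%:E *
      \int[power_measure (Lam n) (n := k.+1)]_z (h z)%:E)%E in
    (Jn <= J + e%:E /\ J <= Jn + e%:E)%E by apply.
  by near: n; exact: (scaled_power_cvg lam rv k.+1 M0 L20 r_gt0 e0).
have Jn0 : (0 <= Jn')%E by apply: power_measure_integral_ge0 => z; rewrite lee_fin.
have nk0 : 0 < n%:R ^+ k.+1 :> R by rewrite exprn_gt0.
have Jnfin : Jn' \is a fin_num.
  rewrite ge0_fin_numE//; move: Jn1; rewrite JE -EFinD.
  move: Jn' Jn0 {Jn2} => [y _ _|_|//]; first exact: ltry.
  by rewrite mulry gtr0_sg// mul1e leye_eq.
have [A1 A2] := poisson_expansion fC L0 (poisson_process_scaled (v n) PiP) rr0 r'r.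
move: A1 A2; rewrite -/(Lam n) -/Jn'.
rewrite -[fine (Lam n (away s r))]/(th r) -[fine (Lam n (away s r'))]/(th r').
set err := L * r' * _ + _.
have : (0 <= \int[P]_w (f (pm_scale (v n) (Pi w)))%:E)%E.
  by apply: integral_ge0 => w _; exact: fE0.
move: (\int[P]_w _)%E => A A0 A1 A2.
have [jn' JnE] : exists x, Jn' = x%:E by exists (fine Jn'); rewrite fineK.
have jn0 : 0 <= jn' by rewrite -lee_fin -JnE.
rewrite JnE in Jn1 Jn2 A1 A2.
have [x AE] : exists x, A = x%:E.
  exists (fine A); rewrite fineK// ge0_fin_numE// (le_lt_trans A1)//.
  by rewrite -EFinM -EFinD ltry.
rewrite AE -EFinM -!EFinD lee_fin in A1.
rewrite AE -EFinM -!EFinD lee_fin in A2.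
rewrite JE -EFinM -!EFinD lee_fin in Jn1.
rewrite JE -EFinM -!EFinD lee_fin in Jn2.
rewrite AE -EFinM -!EFinD !lee_fin.
move: A1 A2; set E1 := expR _; rewrite -/F => A1 A2.
set nk := n%:R ^+ k.+1 in nk0 Jn1 Jn2 *.
have nerr : nk * err <= e + M * C' ^+ k.+2 / n%:R.
  rewrite /err mulrDr; apply: lerD.
    rewrite mulrCA (le_trans _ Lr')// ler_wpM2l ?mulr_ge0 ?(ltW r'_gt0)//.
    by rewrite /nk -exprMn lerXn2r// ?nnegrE// mulr_ge0// ltW.
  rewrite -mulrA mulrCA ler_wpM2l// ler_pdivlMr//.
  rewrite /nk mulrAC -exprSr -exprMn lerXn2r// ?nnegrE// mulr_ge0// ltW.
have E11 : E1 <= 1 by rewrite /E1 -expR0 ler_expR oppr_le0.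
have E1th : 1 - th r' <= E1 by have := expR_ge1Dx (- th r').
have njn : 0 <= nk * jn' by rewrite mulr_ge0// ltW.
have FI : F^-1 <= 1 by rewrite invf_le1.
have FI0 : 0 <= F^-1 by rewrite invr_ge0 ltW.
pose y := F^-1 * (nk * jn').
have y0 : 0 <= y by rewrite mulr_ge0.
have cE : nk * (E1 / F * jn') = E1 * y by rewrite /y; ring.
have yj : y <= F^-1 * j + e.
  by apply: (le_trans (ler_wpM2l FI0 Jn1)); rewrite mulrDr lerD2l ler_piMl// ltW.
have jy : F^-1 * j <= y + e.
  by apply: (le_trans (ler_wpM2l FI0 Jn2)); rewrite mulrDr lerD2l ler_piMl// ltW.
have yje : y <= j + e by apply: le_trans Jn1; rewrite ler_piMl.
have E1y : E1 * y <= y by rewrite ler_piMl.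
have thy : th r' * y <= C' * (j + e) / n%:R.
  rewrite ler_pdivlMr// mulrAC [th r' * _]mulrC.
  by apply: ler_pM => //; rewrite mulr_ge0// ltW.
have yE1 : y <= E1 * y + th r' * y by have := ler_wpM2r y0 E1th; rewrite mulrBl mul1r lerBlDr.
have BnE : M * C' ^+ k.+2 / n%:R + C' * (j + e) / n%:R <= e by rewrite -mulrDl.
have q1 : 0 <= M * C' ^+ k.+2 / n%:R by rewrite divr_ge0 ?(ltW n0)// mulr_ge0// exprn_ge0.
have q2 : 0 <= C' * (j + e) / n%:R.
  by rewrite divr_ge0 ?(ltW n0)// mulr_ge0// addr_ge0// ltW.
have := ler_wpM2l (ltW nk0) A1; have := ler_wpM2l (ltW nk0) A2.
rewrite cE (mulrDr nk _ err) (mulrDr nk _ err) cE.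
have e4 : 4 * e = eps by rewrite /e; field.
move: yj jy E1y thy yE1 nerr BnE q1 q2 e4; clear.
move: (nk * err) (nk * x) (E1 * y) (F^-1 * j) (th r' * y) (M * _ / _) (C' * _ / _).
move=> ? ? ? ? ? ? ? *.
by split; lra.
Unshelve. all: by end_near.
Qed.

End poisson_convergence.

(** * The limit measure *)

Section limit_measure.
Context {dT dX : measure_display} {R : realType}.
Context {T : polishType dT R} {X : polishType dX R} {s : scaling X}.
Local Notation E := (T * X)%type.
Local Notation N := (point_measure T s).
Variables (LI : {sigma_finite_measure set E -> \bar R}) (k : nat).
Hypothesis LI_away : forall r, 0 < r -> (LI (away s r) < +oo)%E.
Implicit Types (z : seq E) (B : set N).

Let mF := @measurable_prod_axis _ _ R T X s.

Lemma pm_seq_sum z : cnt (prod_axis s) z = 0%N ->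
  forall A, pm_seq s z A = sum_dirac z A :> \bar R.
Proof.
move=> z0 A; rewrite pm_seqE sum_diracE; congr (_%:R%:E).
rewrite -[in RHS](setUIDK A (prod_axis s)) cnt_setU; last first.
  by rewrite -subset0 => p [[_ ?] []].
suff -> : cnt (A `&` prod_axis s) z = 0%N by rewrite add0n.
by apply/eqP; rewrite -leqn0 -z0 sub_cnt// => p [].
Qed.

Lemma sum_dirac_pm_seq z (m : N) : (forall A, measurable A -> m A = sum_dirac z A) ->
  cnt (prod_axis s) z = 0%N /\ forall A, measurable A -> m A = pm_seq s z A.
Proof.
move=> mE; have z0 : cnt (prod_axis s) z = 0%N.
  by have := pm_axis m; rewrite mE// sum_diracE => -[] /eqP; rewrite pnatr_eq0 => /eqP.
by split=> // A mA; rewrite mE// pm_seq_sum.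
Qed.

(** A point on the axis would be discarded and leave at most k. Outside [at_most k] nothing is
    discarded, so [pm_seq] is there the full sum of Dirac masses. *)
Lemma pm_seq_not_at_most z : size z = k.+1 -> ~ at_most k (pm_seq s z) ->
  cnt (prod_axis s) z = 0%N.
Proof.
move=> zk nz; apply: contrapT => z0; apply: nz.
exists [seq p <- z | p \in ~` prod_axis s] => [|A mA].
  rewrite size_filter -ltnS -zk -(count_predC (mem (prod_axis s)) z) addnC -addn1 leq_add//.
    by apply: sub_count => p /=; rewrite in_setC.
  by rewrite lt0n; exact/eqP.
by rewrite pm_seqE sum_diracE cnt_filter -setDE.
Qed.

Lemma pm_seq_away z r : 0 < r -> size z = k.+1 -> cnt (away s r) z = k.+1 ->
  ~ at_most k (pm_seq s z).
Proof.
move=> r0 zk zr /at_most_le/(_ (@measurable_away _ _ R T X s r)).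
rewrite pm_seq_off; last exact: (away_axis r0 (@subset_refl _ _)).
by rewrite zr lee_fin ler_nat ltnn.
Qed.

(** Otherwise erasing the points below level [r / 2] would yield a measure with at most k points at
    distance less than [r]. *)
Lemma pm_seq_far_away z r : 0 < r -> size z = k.+1 ->
  ~ thicken (@pm_dist _ _ _ T X s) (at_most k) r (pm_seq s z) ->
  cnt (away s (r / 2)) z = k.+1.
Proof.
move=> r0 zk zr; have r20 : 0 < r / 2 by rewrite divr_gt0.
apply/eqP; rewrite eqn_leq -{1}zk cnt_size /= ltnNge; apply/negP => zc; apply: zr.
exists (pm_restr (@measurable_away _ _ R T X s (r / 2)) (pm_seq s z)).
  apply: at_most_restr => //; rewrite pm_seq_off ?lee_fin ?ler_nat//.
  exact: (away_axis r20 (@subset_refl _ _)).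
by rewrite (le_lt_trans (pm_dist_restr _ (ltW r20)))//; lra.
Qed.

Let mpm : measurable_fun setT (fun z : k.+1.-tuple E => pm_seq s z) :=
  @measurable_pm_seq _ _ R T X s k.+1.

Let D : set (k.+1.-tuple E) := [set z | ~ at_most k (pm_seq s z)].

Let mD : measurable D.
Proof.
rewrite -[D]setTI; apply: (mpm measurableT (Y := ~` at_most k)).
by apply: measurableC; exact: measurable_at_most.
Qed.

(** The power is restricted to the tuples mapped outside [at_most k] before its image is taken, so
    that [at_most k] is null, as [in_M] demands. *)
Lemma limit_measure_exists : exists mu_star : {measure set N -> \bar R},
  [/\ forall B, measurable B -> mu_star B = ((k.+1)`!%:R^-1%:E *
        power_measure LI [set z : k.+1.-tuple E | B (pm_seq s z) /\ ~ at_most k (pm_seq s z)])%E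
  & forall f : N -> R, (forall pi, 0 <= f pi) -> measurable_fun setT f ->
      (forall pi, at_most k pi -> f pi = 0) ->
      (\int[mu_star]_(pi in ~` at_most k) (f pi)%:E =
       (k.+1)`!%:R^-1%:E * \int[power_measure LI (n := k.+1)]_z (f (pm_seq s z))%:E)%E].
Proof.
have [M ME] := power_measure_pack LI k.+1.
have ME' : (M : set _ -> \bar R) = power_measure LI (n := k.+1) by exact/funext.
have c0 : 0 <= (k.+1)`!%:R^-1 :> R by rewrite invr_ge0.
exists (mscale (NngNum c0) (pushforward_pack (mrestr M mD) mpm)); split=> [B mB|f f0 mf fk].
  by rewrite -ME.
have f00 pi : (0 <= (f pi)%:E)%E by rewrite lee_fin.
have mEf : measurable_fun setT (EFin \o f) by exact/measurable_EFinP.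
rewrite integral_off_null// ge0_integral_mscale//.
congr (_ * _)%E; rewrite ge0_integral_pushforward//.
rewrite preimage_setT ge0_integral_mrestr//; last 2 first.
- exact: measurableT_comp mEf mpm.
- by move=> z; exact: f00.
rewrite -ME' integral_mkcond; apply: eq_integral => z _; rewrite patchE.
case: ifPn => // /negP zD /=; rewrite fk//; apply: contrapT => zk; apply: zD.
exact: mem_set.
Qed.

(** A measure [m] equal to the sum of Dirac masses on measurable sets may be another element than
    [pm_seq s z], but Borel sets do not separate them. A tuple meeting the axis is the sum of no
    point measure, and [pm_seq] sends it into [at_most k]. *)
Lemma limit_measure_formula B : measurable B -> B `<=` ~` at_most k ->
  power_measure LI [set z : k.+1.-tuple E | B (pm_seq s z) /\ ~ at_most k (pm_seq s z)] =
  (\int[power_measure LI (n := k.+1)]_z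
     (\1_[set z : k.+1.-tuple E | exists2 m : N, B m &
        forall A, measurable A -> m A = sum_dirac z A] z)%:E)%E.
Proof.
move=> mB Bk; have [M ME] := power_measure_pack LI k.+1.
have ME' : (M : set _ -> \bar R) = power_measure LI (n := k.+1) by exact/funext.
have -> : [set z : k.+1.-tuple E | exists2 m : N, B m &
        forall A, measurable A -> m A = sum_dirac z A] =
    [set z : k.+1.-tuple E | B (pm_seq s z) /\ ~ at_most k (pm_seq s z)].
  apply/seteqP; split=> z /=.
    move=> [m Bm /sum_dirac_pm_seq[z0 mE]].
    have Bz := eval_invariant (measurable_eval mB) mE Bm.
    by split=> //; exact: Bk.
  move=> [Bz /(pm_seq_not_at_most (size_tuple z)) z0].
  by exists (pm_seq s z) => // A _; exact: pm_seq_sum.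
rewrite -ME' integral_indic ?setIT//; apply: measurableI => //.
by rewrite -[X in measurable X]setTI; exact: mpm.
Qed.

Lemma power_measure_away r : 0 < r ->
  power_measure LI [set z : k.+1.-tuple E | cnt (away s r) z = k.+1] =
  (fine (LI (away s r)) ^+ k.+1)%:E.
Proof.
move=> r0; apply: (power_measure_far pseudometric_prod_dist prod_dopen_measurable).
by rewrite fineK// ge0_fin_numE ?LI_away.
Qed.

Let mDB B : measurable B ->
  measurable [set z : k.+1.-tuple E | B (pm_seq s z) /\ ~ at_most k (pm_seq s z)].
Proof.
move=> mB; apply: measurableI => //.
by rewrite -[X in measurable X]setTI; exact: mpm.
Qed.

Let mcount r : measurable [set z : k.+1.-tuple E | cnt (away s r) z = k.+1].
Proof. by apply: (measurable_cnt R); exact: measurable_away. Qed.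

Let power_mono (A B : set (k.+1.-tuple E)) : measurable A -> measurable B ->
  A `<=` B -> (power_measure LI A <= power_measure LI B)%E.
Proof.
move=> mA mB AB; have [M ME] := power_measure_pack LI k.+1.
by rewrite -!ME; apply: le_measure; rewrite ?inE.
Qed.

Variable mu_star : {measure set N -> \bar R}.
Hypothesis muE : forall B, measurable B -> mu_star B = ((k.+1)`!%:R^-1%:E *
  power_measure LI [set z : k.+1.-tuple E | B (pm_seq s z) /\ ~ at_most k (pm_seq s z)])%E.

Lemma limit_measure_in_M : in_M (@pm_dist _ _ _ T X s) (at_most k) mu_star.
Proof.
split=> [|r r0].
  rewrite muE; last exact: measurable_at_most.
  rewrite (_ : [set z | _] = set0); last by rewrite -subset0 => z [].
  by have [M ME] := power_measure_pack LI k.+1; rewrite -ME measure0 mule0.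
have r20 : 0 < r / 2 by rewrite divr_gt0.
have mth : measurable (~` thicken (@pm_dist _ _ _ T X s) (at_most k) r).
  apply: measurableC; apply: measurable_thicken; first exact: pseudometric_pm_dist.
  exact: sub_sigma_algebra.
rewrite muE// lte_mul_pinfty ?lee_fin ?invr_ge0//.
apply: (@le_lt_trans _ _ (power_measure LI [set z : k.+1.-tuple E |
    cnt (away s (r / 2)) z = k.+1])); last by rewrite power_measure_away// ltry.
apply: power_mono => //; first exact: mDB.
by move=> z [/(pm_seq_far_away r0 (size_tuple z))].
Qed.

Lemma limit_measure_neq0 r : 0 < r -> LI (away s r) != 0%E ->
  mu_star (~` at_most k) != 0%E.
Proof.
move=> r0 Lr; have mk : measurable (~` (at_most k : set N)).
  by apply: measurableC; exact: measurable_at_most.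
rewrite muE// mule_neq0//.
rewrite gt_eqF//; apply: (@lt_le_trans _ _ (power_measure LI [set z : k.+1.-tuple E |
    cnt (away s r) z = k.+1])).
  rewrite power_measure_away// lte_fin exprn_gt0// fine_gt0//.
  by rewrite lt0e Lr measure_ge0 LI_away.
apply: power_mono => //; first exact: mDB.
by move=> z zr; split; exact: (pm_seq_away r0 (size_tuple z) zr).
Qed.

End limit_measure.

(** Were all the sets [away s r] null, so would be their union, on which the mass is the product of
    the masses of [lam] and of [mu] off the origin. *)
Lemma limit_intensity_neq0 {dT dX : measure_display} {R : realType}
    {T : polishType dT R} {X : polishType dX R} {s : scaling X}
    (lam : {finite_measure set T -> \bar R}) (nu : probability X R)
    (a : nat -> {posnum R}) (mu : {measure set X -> \bar R})
    (rv : regularly_varying s nu a mu) : lam setT != 0%E ->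
  exists2 r, 0 < r & limit_intensity lam rv (away s r) != 0%E.
Proof.
move=> lam0; apply: contrapT => h.
have null r : 0 < r -> limit_intensity lam rv (away s r) = 0%E.
  by move=> r0; apply: contrapT => /eqP Lr; apply: h; exists r.
have mo : measurable (~` [set origin s]).
  by apply: measurableC; exact: polish_singleton_measurable.
have : limit_intensity lam rv (setT `*` ~` [set origin s]) = 0%E.
  apply: measure_negligible; first exact: measurableX.
  apply: (negligibleS (_ : _ `<=` \bigcup_n away s n.+1%:R^-1)); last first.
    apply: negligible_bigcup => n; apply/negligibleP; first exact: measurable_away.
    by apply: null; rewrite invr_gt0.
  move=> [t x] [_ /= xo]; have xr : 0 < level s (t, x).
    rewrite lt0r level_ge0 andbT; apply/eqP => x0; apply: xo.
    by case/prod_axisP: x0 => _.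
  have [n _ /(_ n (leqnn n)) nr] := near_infty_natSinv_lt (PosNum xr).
  by exists n => //; rewrite awayE /= ltW.
have -> : limit_intensity lam rv (setT `*` ~` [set origin s]) =
    (lam setT * mu (~` [set origin s]))%E.
  exact: (product_measure1E _ (limit_law rv)).
by apply/eqP; rewrite mule_neq0//; case: (rv).
Qed.

(** Non-nullity is claimed when [lambda] has mass: for [lambda] equal to 0 the intensity, and with
    it the limit measure, is 0. *)
Theorem theorem3p1 (R : realType) (dT dX dO : measure_display)
    (T : polishType dT R) (X : polishType dX R) (s : scaling X)
    (lambda : {finite_measure set T -> \bar R}) (nu : probability X R)
    (a : nat -> {posnum R}) (mu : {measure set X -> \bar R})
    (O : measurableType dO) (P : probability O R)
    (Pi : O -> point_measure T s) :
  nu [set origin s] = 0%E ->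
  regularly_varying s nu a mu ->
  poisson_process P (lambda \x nu)%E Pi ->
  forall k : nat,
  exists mu_star : {measure set (point_measure T s) -> \bar R},
    [/\ forall B : set (point_measure T s),
          measurable B -> B `<=` ~` at_most k ->
          mu_star B = ((k.+1)`!%:R^-1%:E *
            \int[power_measure (lambda \x mu) (n := k.+1)]_z
              (\1_[set z : k.+1.-tuple (T * X) |
                   exists2 m : point_measure T s, B m &
                     forall A, measurable A -> m A = sum_dirac z A] z)%:E)%E,
        in_M (@pm_dist _ _ _ T X s) (at_most k) mu_star,
        lambda [set: T] != 0%E -> mu_star (~` at_most k) != 0%E
      & cvg_M (@pm_dist _ _ _ T X s) (at_most k)
          (fun n B => ((n%:R ^+ k.+1)%:E *
            P [set w | B (pm_scale ((a n)%:num^-1)%:pos%R (Pi w))])%E)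
          mu_star].
Proof.
move=> _ rv PiP k.
pose LI := limit_intensity lambda rv.
have LI_away r : 0 < r -> (LI (away s r) < +oo)%E by exact: limit_intensity_away.
have [mu_star [muE intE]] := limit_measure_exists (s := s) LI k.
have dB : dopen (@pm_dist _ _ _ T X s) `<=` measurable by exact: sub_sigma_algebra.
have muM := limit_measure_in_M LI_away muE.
exists mu_star; split=> // [B mB Bk|lam0|].
- by rewrite muE// (limit_measure_formula LI mB Bk).
- have [r r0 Lr] := limit_intensity_neq0 rv lam0.
  exact: limit_measure_neq0 LI_away mu_star muE r r0 Lr.
have mPi n : measurable_fun setT (fun w => pm_scale ((a n)%:num^-1)%:pos%R (Pi w)).
  by case: (poisson_process_scaled ((a n)%:num^-1)%:pos%R PiP).
have nk0 n : 0 <= n%:R ^+ k.+1 :> R by rewrite exprn_ge0.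
pose Q n : {measure set (point_measure T s) -> \bar R} :=
  mscale (NngNum (nk0 n)) (pushforward_pack P (mPi n)).
have cvg_lip := @cvg_M_lip _ _ _ _ _ pseudometric_pm_dist dB (measurable_at_most k) Q _ muM.
apply: cvg_lip.
move=> f M L r r0 fM fL fr.
(* [lip] puts no sign on its constant, while the estimates for powers need a nonnegative one. *)
have L0 : 0 <= Num.max L 0 by rewrite le_max lexx orbT.
have fC : lip_class (@pm_dist _ _ _ T X s) (at_most k) M (Num.max L 0) r f.
  split=> // x y; rewrite (le_trans (fL x y))// ler_wpM2r ?le_max ?lexx//.
  exact: (pseudometric_ge0 pseudometric_pm_dist).
have f0 pi : 0 <= f pi by case/andP: (fM pi).
have mf := measurable_lip_pm fC.
have fk pi : at_most k pi -> f pi = 0.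
  by move=> pik; apply: fr; exists pi => //; rewrite (pseudometric_xx pseudometric_pm_dist).
have QE n : (\int[Q n]_(x in ~` at_most k) (f x)%:E =
    (n%:R ^+ k.+1)%:E * \int[P]_w (f (pm_scale ((a n)%:num^-1)%:pos%R (Pi w)))%:E)%E.
  have f00 pi : (0 <= (f pi)%:E)%E by rewrite lee_fin.
  have mEf : measurable_fun setT (EFin \o f) by exact/measurable_EFinP.
  rewrite integral_off_null// ge0_integral_mscale//; congr (_ * _)%E.
  by rewrite ge0_integral_pushforward.
rewrite (_ : (fun n => _) = (fun n => (n%:R ^+ k.+1)%:E *
    \int[P]_w (f (pm_scale ((a n)%:num^-1)%:pos%R (Pi w)))%:E)%E); last exact/funext.
rewrite intE//; have := poisson_functional_cvg (rv := rv) PiP r0 L0 fC.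
rewrite (_ : (\int[power_measure LI (n := k.+1)]_z (f (pm_seq s z))%:E)%E =
  (\int[power_measure LI (n := k.+1)]_z (seq_functional k f z)%:E)%E)//.
by congr (integral _ _ _); apply/funext => z; rewrite /seq_functional size_tuple eqxx.
Qed.
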